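(* Let $Gr=Gr_2(\mathbb{H}^{n+2})=\mathrm{Sp}(n+2)/(\mathrm{Sp}(n)\times\mathrm{Sp}(2))$. There is a rank $5$ vector sub-bundle $E\subset\mathrm{End}^+(T\,Gr_2(\mathbb{H}^{n+2}))$ that is locally generated by anti-commuting orthogonal self-dual involutions $\sigma_1,\dots,\sigma_5$, and $E$ gives rise to an even, non-flat, parallel Clifford structure of rank $5$ on $Gr_2(\mathbb{H}^{n+2})$. The Clifford morphism $\varphi$ is constructed as follows. Let $u,v$ be local orthonormal sections of $E$, and let the composition $uv$ act diagonally on the $n$-tuples $(\vec h_1,\vec h_2,\dots,\vec h_n)$ of pairs of local tangent vectors, looked at as elements of $(\mathbb{H}\oplus\mathbb{H})^n$. Then the morphism $$\varphi:\ \mathrm{Cl}^0E\to\mathrm{End}(T\,Gr_2(\mathbb{H}^{n+2}))$$ is given by the Clifford extension of the map $$u\wedge v\in\Lambda^2E\ \longmapsto\ [\,uv:(\mathbb{H}\oplus\mathbb{H})^n\to(\mathbb{H}\oplus\mathbb{H})^n\,].$$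
   Context: $\mathrm{End}^+$ denotes symmetric endomorphisms with respect to the (symmetric space) Riemannian metric; ''self-dual'' means self-adjoint. An even Clifford structure of rank $r$ on a Riemannian manifold $(M,g)$ is a real oriented Euclidean vector bundle $(E,h)$ of rank $r$ with an algebra bundle morphism $\varphi:\mathrm{Cl}^0(E)\to\mathrm{End}(TM)$ mapping $\Lambda^2E$ into skew-symmetric endomorphisms ($\mathrm{Cl}^0(E)$ is the even Clifford algebra bundle). It is parallel if there is a metric connection $\nabla^E$ on $E$ with $\varphi(\nabla^E_X\sigma)=\nabla^g_X\varphi(\sigma)$ for every tangent vector $X$ and section $\sigma$ of $\mathrm{Cl}^0E$, where $\nabla^g$ is the Levi-Civita connection; it is non-flat if the connection $\nabla^E$ is not flat. Setting: $T\,Gr\cong W\otimes W^\perp$ (over $\mathbb{H}$), where $W$ is the tautological quaternionic rank-$2$ bundle and $W^\perp$ its orthogonal complement in the trivial bundle with fiber $\mathbb{H}^{n+2}$. For local orthonormal bases $w_1,w_2$ of $W$ and $w_1^\perp,\dots,w_n^\perp$ of $W^\perp$, put $h_{a,\lambda}=w_a\otimes w_\lambda^\perp$ ($a=1,2$; $\lambda=1,\dots,n$) and $\vec h_\lambda=(h_{1,\lambda},h_{2,\lambda})$; in this way tangent vectors are identified with $n$-tuples of elements of $\mathbb{H}\oplus\mathbb{H}$. The bundle $E=E^5$ is locally generated by the Clifford system $C_4$, i.e. $\sigma_1,\dots,\sigma_5$ act diagonally on $(\mathbb{H}\oplus\mathbb{H})^n$, on each $\mathbb{H}\oplus\mathbb{H}=\mathbb{R}^8$,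 by the symmetric anti-commuting involutions (in $4\times4$ blocks) $$\begin{pmatrix}0&\mathrm{Id}\\ \mathrm{Id}&0\end{pmatrix},\quad\begin{pmatrix}0&-R_i\\ R_i&0\end{pmatrix},\quad\begin{pmatrix}0&-R_j\\ R_j&0\end{pmatrix},\quad\begin{pmatrix}0&-R_k\\ R_k&0\end{pmatrix},\quad\begin{pmatrix}\mathrm{Id}&0\\0&-\mathrm{Id}\end{pmatrix},$$ where $R_i,R_j,R_k$ are right multiplications by $i,j,k$ on $\mathbb{H}$. *)

(* Defs.v *)
From HB Require Import structures.
From mathcomp Require Import all_boot all_order all_algebra.
From mathcomp Require Import all_classical all_reals all_analysis.

Set Implicit Arguments.
Unset Strict Implicit.
Unset Printing Implicit Defensive.

Import Order.TTheory GRing.Theory Num.Theory.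
Import numFieldNormedType.Exports.
Local Open Scope classical_set_scope.
Local Open Scope ring_scope.

(** * Smooth calculus on a subset M of a finite-dimensional normed space V

    Manifolds are embedded submanifolds M of V.  A field over M (function,
    vector field, section of a bundle) is a total function on V of which only
    the values at points of M matter. *)

Section Smooth.
Context {R : realType} {V W : normedModType R}.

Fixpoint Ck (k : nat) (U : set V) (f : V -> W) : Prop :=
  if k is k'.+1 then
    (forall x, U x -> differentiable f x) /\
    (forall v, Ck k' U (fun x => 'D_v f x))
  else forall x, U x -> {for x, continuous f}.

Definition smooth_on (U : set V) (f : V -> W) : Prop := forall k, Ck k U f.

(* f is smooth on the relatively open subset M `&` U of M: near each of its
   points f is the restriction of a smooth function of the ambient space. *)
Definition msmooth (M U : set V) (f : V -> W) : Prop :=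
  forall x, M x -> U x -> exists (O : set V) (F : V -> W),
    [/\ open O, O x, smooth_on O F &
        forall y, M y -> U y -> O y -> f y = F y].

End Smooth.

Section Tangent.
Context {R : realType} {V : normedModType R}.
Variable M : set V.

Definition mcurve (x v : V) (c : R^o -> V) : Prop :=
  [/\ smooth_on setT c, forall t, M (c t), c 0 = x & derive1 c 0 = v].

Definition tspace (x : V) : set V := [set v | exists c, mcurve x v c].

(* The derivative df_x(v) of a smooth f : M -> W along a tangent vector v,
   computed on some curve representing v. *)
Definition tder {W : normedModType R} (f : V -> W) (x v : V) : W :=
  derive1 (f \o xget (fun=> x) [set c : R^o -> V | mcurve x v c]) 0.

Definition vfield (U : set V) (X : V -> V) : Prop :=
  msmooth M U X /\ forall x, M x -> U x -> tspace x (X x).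

(* The Lie bracket [X, Y], in the linear coordinates of V. *)
Definition lie (X Y : V -> V) (x : V) : V :=
  tder Y x (X x) - tder X x (Y x).

(* D X s stands for \nabla_X s; S is the set of (global) smooth sections of a
   vector bundle over M whose fibres are subspaces of B. *)
Record connection {B : lmodType R} (S : set (V -> B))
    (D : (V -> V) -> (V -> B) -> (V -> B)) : Prop := {
  conn_section : forall X s, vfield setT X -> S s -> S (D X s);
  conn_tensorial : forall (X Y : V -> V) (f : V -> R^o) s,
    vfield setT X -> vfield setT Y -> msmooth M setT f -> S s ->
    forall x, M x ->
      D (fun y => f y *: X y + Y y) s x = f x *: D X s x + D Y s x;
  conn_leibniz : forall (X : V -> V) (f : V -> R^o) s t,
    vfield setT X -> msmooth M setT f -> S s -> S t ->
    forall x, M x ->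
      D X (fun y => f y *: s y + t y) x
        = tder f x (X x) *: s x + f x *: D X s x + D X t x
}.

Definition flat {B : lmodType R} (S : set (V -> B))
    (D : (V -> V) -> (V -> B) -> (V -> B)) : Prop :=
  forall X Y s, vfield setT X -> vfield setT Y -> S s -> forall x, M x ->
    D X (D Y s) x - D Y (D X s) x - D (lie X Y) s x = 0.

(* A bundle metric is a family of bilinear forms h x on the fibres. *)
Definition compatible {B : lmodType R} (S : set (V -> B))
    (D : (V -> V) -> (V -> B) -> (V -> B)) (h : V -> B -> B -> R^o) : Prop :=
  forall X s t, vfield setT X -> S s -> S t -> forall x, M x ->
    tder (fun y => h y (s y) (t y)) x (X x)
      = h x (D X s x) (t x) + h x (s x) (D X t x).

Definition levi_civita (g : V -> V -> V -> R^o)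
    (D : (V -> V) -> (V -> V) -> (V -> V)) : Prop :=
  [/\ connection (vfield setT) D, compatible (vfield setT) D g &
      forall X Y, vfield setT X -> vfield setT Y -> forall x, M x ->
        D X Y x - D Y X x = lie X Y x].

(* An endomorphism of T_xM is encoded as a function on V that is linear on
   T_xM and takes the junk value 0 outside T_xM; thus equality, sums and
   composites of endomorphisms are those of functions. *)
Definition endT (x : V) : set (V -> V) :=
  [set A | [/\ forall v, ~ tspace x v -> A v = 0,
               forall v, tspace x v -> tspace x (A v) &
               forall (a : R) u v, tspace x u -> tspace x v ->
                 A (a *: u + v) = a *: A u + A v]].

Definition idT (x : V) : V -> V := patch (fun=> 0) (tspace x) id.

Definition selfadjT (g : V -> V -> V -> R^o) (x : V) (A : V -> V) : Prop :=
  forall u v, tspace x u -> tspace x v -> g x (A u) v = g x u (A v).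

Definition skewT (g : V -> V -> V -> R^o) (x : V) (A : V -> V) : Prop :=
  forall u v, tspace x u -> tspace x v -> g x (A u) v = - g x u (A v).

Definition orthogonalT (g : V -> V -> V -> R^o) (x : V) (A : V -> V) : Prop :=
  forall u v, tspace x u -> tspace x v -> g x (A u) (A v) = g x u v.

(* Smooth sections over M `&` U of End(TM). *)
Definition endsec (U : set V) (A : V -> (V -> V)) : Prop :=
  (forall x, M x -> U x -> endT x (A x)) /\
  (forall Y, vfield U Y -> msmooth M U (fun x => A x (Y x))).

(* Smooth sections over M `&` U of a sub-bundle E of End(TM). *)
Definition esec (E : V -> set (V -> V)) (U : set V) (s : V -> (V -> V)) : Prop :=
  endsec U s /\ forall x, M x -> U x -> E x (s x).

End Tangent.

Section Frames.
Context {R : realType} {B : lmodType R} {r : nat}.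

Definition basis_for (F : set B) (e : 'I_r -> B) : Prop :=
  F = [set b | exists a : 'I_r -> R, b = \sum_i a i *: e i] /\
  forall a : 'I_r -> R, \sum_i a i *: e i = 0 -> forall i, a i = 0.

Definition orthonormal_for (h : B -> B -> R^o) (e : 'I_r -> B) : Prop :=
  forall i j, h (e i) (e j) = (i == j)%:R.

End Frames.

(** * The Clifford algebra Cl(F, h) = T(F) / (v (x) v - h(v, v))

    F is a subspace of B.  A sequence of pairs (c, [v_1; ...; v_p]) stands for
    the sum of the c v_1 ... v_p, and [cl_eq] is equality in Cl(F, h).  The
    sign convention v^2 = + h(v, v) is the one satisfied by symmetric
    involutions. *)

Section Clifford.
Context {R : realType} {B : lmodType R}.
Implicit Types (F : set B) (h : B -> B -> R^o) (s t : seq (R * seq B)).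

Definition word_in F (w : seq B) : Prop := forall v, v \in w -> F v.
Definition cl_in F s : Prop := forall p, p \in s -> word_in F p.2.

(* Membership in the even part Cl^0(F, h). *)
Definition cl0_in F s : Prop :=
  cl_in F s /\ forall p, p \in s -> ~~ odd (size p.2).

Definition cl_one : seq (R * seq B) := [:: (1, [::])].
Definition cl_scale (a : R) s : seq (R * seq B) :=
  [seq (a * p.1, p.2) | p <- s].
Definition cl_mul s t : seq (R * seq B) :=
  [seq (p.1 * q.1, p.2 ++ q.2) | p <- s, q <- t].

Inductive cl_eq F h : seq (R * seq B) -> seq (R * seq B) -> Prop :=
| cl_refl s : cl_in F s -> cl_eq F h s s
| cl_sym s t : cl_eq F h s t -> cl_eq F h t s
| cl_trans s t u : cl_eq F h s t -> cl_eq F h t u -> cl_eq F h s u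
| cl_add s s' t t' :
    cl_eq F h s s' -> cl_eq F h t t' -> cl_eq F h (s ++ t) (s' ++ t')
| cl_comm s t : cl_in F s -> cl_in F t -> cl_eq F h (s ++ t) (t ++ s)
| cl_zero w : word_in F w -> cl_eq F h [:: (0, w)] [::]
| cl_coef (a b : R) w : word_in F w ->
    cl_eq F h [:: (a + b, w)] [:: (a, w); (b, w)]
| cl_lin (c a : R) u v w w' :
    F u -> F v -> word_in F w -> word_in F w' ->
    cl_eq F h [:: (c, w ++ (a *: u + v) :: w')]
              [:: (c * a, w ++ u :: w'); (c, w ++ v :: w')]
| cl_sq (c : R) v w w' : F v -> word_in F w -> word_in F w' ->
    cl_eq F h [:: (c, w ++ v :: v :: w')] [:: (c * h v v, w ++ w')].

(* The image (u v - v u) / 2 of u /\ v under the embedding of Lambda^2 F. *)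
Definition wedge (u v : B) : seq (R * seq B) :=
  [:: (2^-1, [:: u; v]); (- 2^-1, [:: v; u])].

End Clifford.

(** * Even Clifford structures, for a bundle E inside End(TM) *)

Section EvenClifford.
Context {R : realType} {V : normedModType R}.
Variables (M : set V) (g : V -> V -> V -> R^o).
Variables (r : nat) (E : V -> set (V -> V)).
Variable h : V -> (V -> V) -> (V -> V) -> R^o.
(* the bundle of positively oriented orthonormal frames of E *)
Variable o : V -> set ('I_r -> (V -> V)).
(* phi x is a map on Cl^0(E_x, h_x), see [algebra_bundle_morphism] *)
Variable phi : V -> seq (R * seq (V -> V)) -> (V -> V).

Definition subbundle : Prop := forall x, M x ->
  exists (U : set V) (e : 'I_r -> V -> (V -> V)),
    [/\ open U, U x, forall i, endsec M U (e i) &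
        forall y, M y -> U y -> basis_for (E y) (fun i => e i y)].

Record bundle_metric : Prop := {
  bm_linear : forall x, M x -> forall (a : R) u v w, E x u -> E x v -> E x w ->
    h x (a *: u + v) w = a * h x u w + h x v w;
  bm_sym : forall x, M x -> forall u v, E x u -> E x v -> h x u v = h x v u;
  bm_pos : forall x, M x -> forall u, E x u -> u <> 0 -> 0 < h x u u;
  bm_smooth : forall (U : set V) s t, open U ->
    esec M E U s -> esec M E U t -> msmooth M U (fun x => h x (s x) (t x))
}.

(* An orientation, given as a reduction of the structure group to SO(r). *)
Record orientation : Prop := {
  or_frame : forall x e, M x -> o x e ->
    basis_for (E x) e /\ orthonormal_for (h x) e;
  or_SO : forall x e (A : 'M[R]_r), M x -> o x e ->
    o x (fun i => \sum_j A i j *: e j) <-> (A *m A^T = 1%:M /\ \det A = 1);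
  or_local : forall x, M x ->
    exists (U : set V) (e : 'I_r -> V -> (V -> V)),
      [/\ open U, U x, forall i, esec M E U (e i) &
          forall y, M y -> U y -> o y (fun i => e i y)]
}.

(* Smooth sections over M `&` U of Cl^0(E) are represented by finite sums of
   terms f u_1 ... u_2p, with f a smooth function and u_i smooth sections
   of E. *)
Definition cl0_section (U : set V)
    (s : seq ((V -> R^o) * seq (V -> (V -> V)))) : Prop :=
  forall p, p \in s ->
    [/\ msmooth M U p.1, forall u, u \in p.2 -> esec M E U u &
        ~~ odd (size p.2)].

Definition cl_at (s : seq ((V -> R^o) * seq (V -> (V -> V)))) (x : V) :
    seq (R * seq (V -> V)) :=
  [seq (p.1 x, [seq u x | u : V -> (V -> V) <- p.2]) | p <- s].

Record algebra_bundle_morphism : Prop := {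
  abm_end : forall x s, M x -> cl0_in (E x) s -> endT M x (phi x s);
  abm_eq : forall x s t, M x -> cl0_in (E x) s -> cl0_in (E x) t ->
    cl_eq (E x) (h x) s t -> phi x s = phi x t;
  abm_add : forall x s t, M x -> cl0_in (E x) s -> cl0_in (E x) t ->
    phi x (s ++ t) = phi x s + phi x t;
  abm_scale : forall x (a : R) s, M x -> cl0_in (E x) s ->
    phi x (cl_scale a s) = a *: phi x s;
  abm_one : forall x, M x -> phi x cl_one = idT M x;
  abm_mul : forall x s t, M x -> cl0_in (E x) s -> cl0_in (E x) t ->
    phi x (cl_mul s t) = phi x s \o phi x t;
  abm_smooth : forall (U : set V) s, open U -> cl0_section U s ->
    endsec M U (fun x => phi x (cl_at s x))
}.

Record even_clifford_structure : Prop := {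
  ecs_bundle : subbundle;
  ecs_metric : bundle_metric;
  ecs_orientation : orientation;
  ecs_morphism : algebra_bundle_morphism;
  ecs_skew : forall x u v, M x -> E x u -> E x v ->
    skewT M g x (phi x (wedge u v))
}.

(* The derivation of Cl(E) extending a connection D on E (X is fixed):
   X (f u_1 ... u_p) = X(f) u_1 ... u_p + f sum_k u_1 ... (D_X u_k) ... u_p *)
Fixpoint leibniz_word (DX : (V -> (V -> V)) -> (V -> (V -> V)))
    (w : seq (V -> (V -> V))) : seq (seq (V -> (V -> V))) :=
  if w is u :: w' then
    (DX u :: w') :: [seq u :: w'' | w'' <- leibniz_word DX w']
  else [::].

Definition cl_conn (D : (V -> V) -> (V -> (V -> V)) -> (V -> (V -> V)))
    (X : V -> V) (s : seq ((V -> R^o) * seq (V -> (V -> V)))) :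
    seq ((V -> R^o) * seq (V -> (V -> V))) :=
  flatten [seq ((fun x => tder M p.1 x (X x)), p.2)
               :: [seq (p.1, w) | w <- leibniz_word (D X) p.2] | p <- s].

(* phi (\nabla^E_X s) = \nabla^g_X (phi s), evaluated on vector fields Y by
   (\nabla_X A) Y = \nabla_X (A Y) - A (\nabla_X Y). *)
Definition parallel_for (Dg : (V -> V) -> (V -> V) -> (V -> V))
    (DE : (V -> V) -> (V -> (V -> V)) -> (V -> (V -> V))) : Prop :=
  forall X Y s, vfield M setT X -> vfield M setT Y -> cl0_section setT s ->
  forall x, M x ->
    phi x (cl_at (cl_conn DE X s) x) (Y x)
      = Dg X (fun y => phi y (cl_at s y) (Y y)) x
        - phi x (cl_at s x) (Dg X Y x).

Definition nonflat_parallel : Prop :=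
  exists (Dg : (V -> V) -> (V -> V) -> (V -> V))
         (DE : (V -> V) -> (V -> (V -> V)) -> (V -> (V -> V))),
    [/\ levi_civita M g Dg,
        connection M (esec M E setT) DE, compatible M (esec M E setT) DE h,
        parallel_for Dg DE & ~ flat M (esec M E setT) DE].

End EvenClifford.

(** * Quaternionic matrices: (A, B, C, D) stands for A + B i + C j + D k *)

Notation qmx R m p :=
  ('M[R]_(m, p) * 'M[R]_(m, p) * 'M[R]_(m, p) * 'M[R]_(m, p))%type.

Section Quaternions.
Context {R : realType}.

Definition qmul {m p q : nat} (A : qmx R m p) (B : qmx R p q) : qmx R m q :=
  let: (a0, a1, a2, a3) := A in let: (b0, b1, b2, b3) := B in
  (a0 *m b0 - a1 *m b1 - a2 *m b2 - a3 *m b3,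
   a0 *m b1 + a1 *m b0 + a2 *m b3 - a3 *m b2,
   a0 *m b2 - a1 *m b3 + a2 *m b0 + a3 *m b1,
   a0 *m b3 + a1 *m b2 - a2 *m b1 + a3 *m b0).

(* the conjugate transpose *)
Definition qadj {m p : nat} (A : qmx R m p) : qmx R p m :=
  let: (a0, a1, a2, a3) := A in (a0^T, - a1^T, - a2^T, - a3^T).

(* the scalars, i.e. the quaternions themselves, are qmx R 1 1 *)
Definition qone : qmx R 1 1 := (1%:M, 0, 0, 0).
Definition qi : qmx R 1 1 := (0, 1%:M, 0, 0).
Definition qj : qmx R 1 1 := (0, 0, 1%:M, 0).
Definition qk : qmx R 1 1 := (0, 0, 0, 1%:M).

(* right multiplication by u on H *)
Definition Rmul (u x : qmx R 1 1) : qmx R 1 1 := qmul x u.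

(* H^m is the right H-module of columns qmx R m 1 *)
Definition qherm {m : nat} (u v : qmx R m 1) : qmx R 1 1 := qmul (qadj u) v.

Definition qorthonormal {m p : nat} (w : 'I_p -> qmx R m 1) : Prop :=
  forall a b, qherm (w a) (w b) = if a == b then qone else 0.

End Quaternions.

(** * The Grassmannian Gr_2(H^{n+2})

    A quaternionic plane W of H^{n+2} is represented by the orthogonal
    projector P onto W, a Hermitian quaternionic matrix.  The symmetric metric
    (unique up to a constant factor) is the one induced by Re tr(X Y). *)

Section Grassmannian.
Context {R : realType} {n : nat}.
Local Notation V := (qmx R n.+2 n.+2).

Definition qplane (w : 'I_2 -> qmx R n.+2 1) : V :=
  \sum_a qmul (w a) (qadj (w a)).

Definition Gr : set V :=
  [set P | exists2 w, qorthonormal w & P = qplane w].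

Definition gGr (P X Y : V) : R^o := \tr ((qmul X Y).1.1.1).

(* orthonormal bases w of W and wp of its orthogonal complement *)
Definition adapted (P : V) (w : 'I_2 -> qmx R n.+2 1)
    (wp : 'I_n -> qmx R n.+2 1) : Prop :=
  [/\ qorthonormal w, P = qplane w, qorthonormal wp &
      forall a l, qherm (w a) (wp l) = 0].

Definition adapted_local (U : set V) (w : 'I_2 -> V -> qmx R n.+2 1)
    (wp : 'I_n -> V -> qmx R n.+2 1) : Prop :=
  [/\ forall a, msmooth Gr U (w a), forall l, msmooth Gr U (wp l) &
      forall P, Gr P -> U P -> adapted P (w ^~ P) (wp ^~ P)].

(* The n-tuple (h_1, ..., h_n) of pairs of quaternions of a tangent vector X:
   X restricts to an H-linear map from W to its orthogonal complement, with
   X w_a = \sum_l wp_l h_{l,a}. *)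
Definition coords (w : 'I_2 -> qmx R n.+2 1) (wp : 'I_n -> qmx R n.+2 1)
    (X : V) (l : 'I_n) : qmx R 1 1 * qmx R 1 1 :=
  (qherm (wp l) (qmul X (w ord0)), qherm (wp l) (qmul X (w ord_max))).

Definition of_coords (w : 'I_2 -> qmx R n.+2 1) (wp : 'I_n -> qmx R n.+2 1)
    (q : 'I_n -> qmx R 1 1 * qmx R 1 1) : V :=
  let A := \sum_l (qmul (qmul (wp l) (q l).1) (qadj (w ord0)) +
                   qmul (qmul (wp l) (q l).2) (qadj (w ord_max))) in
  A + qadj A.

(* the Clifford system C_4 on H + H *)
Definition C4 (k : 'I_5) (p : qmx R 1 1 * qmx R 1 1) :
    qmx R 1 1 * qmx R 1 1 :=
  let: (x, y) := p in
  match nat_of_ord k with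
  | 0 => (y, x)
  | 1 => (- Rmul qi y, Rmul qi x)
  | 2 => (- Rmul qj y, Rmul qj x)
  | 3 => (- Rmul qk y, Rmul qk x)
  | _ => (x, - y)
  end.

(* the involutions of T_P Gr given by the diagonal action of C_4 *)
Definition sigma (w : 'I_2 -> qmx R n.+2 1) (wp : 'I_n -> qmx R n.+2 1)
    (P : V) (k : 'I_5) : V -> V :=
  patch (fun=> 0) (tspace Gr P)
    (fun X => of_coords w wp (fun l => C4 k (coords w wp X l))).

(* the action on H + H of the element of E with components a on sigma *)
Definition C4lin (a : 'I_5 -> R) (p : qmx R 1 1 * qmx R 1 1) :
    qmx R 1 1 * qmx R 1 1 := \sum_k a k *: C4 k p.

End Grassmannian.
Arguments Gr : clear implicits.
Arguments gGr : clear implicits.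

(* E is generated over M `&` U by the anti-commuting orthogonal self-dual
   involutions s_1, ..., s_r, which are orthonormal for h. *)
Record involutions_generate {R : realType} {V : normedModType R} {r : nat}
    (M : set V) (g : V -> V -> V -> R^o) (E : V -> set (V -> V))
    (h : V -> (V -> V) -> (V -> V) -> R^o)
    (U : set V) (s : 'I_r -> V -> (V -> V)) : Prop := {
  ig_section : forall i, endsec M U (s i);
  ig_basis : forall x, M x -> U x -> basis_for (E x) (fun i => s i x);
  ig_orthonormal : forall x, M x -> U x ->
    orthonormal_for (h x) (fun i => s i x);
  ig_involution : forall x i, M x -> U x -> s i x \o s i x = idT M x;
  ig_anticommute : forall x i j, M x -> U x -> i != j ->
    s i x \o s j x = - (s j x \o s i x);
  ig_orthogonal : forall x i, M x -> U x -> orthogonalT M g x (s i x);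
  ig_selfdual : forall x i, M x -> U x -> selfadjT M g x (s i x)
}.

(* Main.v *)
Require Import Defs.
From HB Require Import structures.
From mathcomp Require Import all_boot all_order all_algebra all_fingroup.
From mathcomp Require Import all_classical all_reals all_analysis.
From mathcomp Require Import ring lra.
Import Order.TTheory GRing.Theory Num.Theory.
Import numFieldNormedType.Exports.
Local Open Scope classical_set_scope.
Local Open Scope ring_scope.

(* A plane W is encoded by its projector P, and T_P Gr consists of the Hermitian
   X with X P + P X = X.  Right multiplication of tangent vectors by a traceless
   Hermitian endomorphism S of W becomes X |-> X S + S X, so E_P is the space of
   these operators for the S with S = S^*, P S = S and Re tr S = 0: a description
   which uses no frame, and in which C_4 acts by the five basic such S of an
   adapted frame.  The relation S T + T S = Re tr(S T) P gives the Clifford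
   morphism.  The Levi-Civita connection is the tangential projection of the flat
   derivative, and the connection of E is S |-> P dS P; that the Clifford morphism
   is parallel is an identity between words in P, S, X, Y, dS.  The curvature of
   E at X, Y is S |-> P [[X, Y], S] P. *)

Set Implicit Arguments.
Unset Strict Implicit.

(** * Smooth maps *)

(** Why C_4 defines a global bundle: in an adapted frame a tangent vector is a family of rows (x, y)
    over H. A change of basis of the complement of W multiplies this family on the left and so
    commutes with C_4, which acts on the right. A change of basis of W conjugates C_4 by Sp(2), and
    the span of C_4 is the space of all traceless Hermitian 2x2 quaternionic matrices (one real
    diagonal and one quaternionic off-diagonal parameter), which is invariant. Two obstacles shape
    the proof. A section of E is given as a family of operators, while every computation is done on
    S; so S has to be read off the operator linearly and smoothly in P, which costs a division by tr
    (1 - P) = n. And derivatives are taken along some curve inside Gr defined for all times, so each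
    solution X of the tangent equations has to be realized by such a curve; this asks for a
    Gram-Schmidt process with control of where it degenerates. Curvature is tested on compressions
    to W of constant ambient matrices: these are global sections, and their second derivatives are
    again words. *)

Lemma near_eq_differentiable {R : realType} {V W : normedModType R}
    (f g : V -> W) (x : V) :
  (\near x, f x = g x) -> differentiable f x -> differentiable g x.
Proof.
move=> fg df.
have E : g \o shift x = cst (g x) + 'd f x +o_ 0 id.
  apply/eqaddoP => e e0.
  have /eqaddoP/(_ e e0) H := diff_locally df.
  have fg0 : \forall y \near (0 : V), f (y + x) = g (y + x).
    move: fg; rewrite (near_shift 0 x); apply: filterS => y /=; rewrite subr0.
    by rewrite /= addrC.
  near=> y.
  have : `|(f \o shift x - (cst (f x) + 'd f x)) y| <= e * `|id y| by near: y.
  rewrite !fctE /= (nbhs_singleton fg).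
  suff -> : f (y + x) = g (y + x) by [].
  near: y.
  exact: fg0.
apply/diff_locallyP; rewrite (diff_unique (diff_continuous df) E).
split=> //; exact: diff_continuous.
Unshelve. all: by end_near. Qed.

Section Ck_theory.
Context {R : realType} {V : normedModType R}.
Implicit Types (k : nat) (U : set V).

(** On an open set equality holds near each point, hence passes to directional derivatives of every
    order. *)
Lemma Ck_eq {W : normedModType R} k U (f g : V -> W) : open U ->
  (forall x, U x -> f x = g x) -> Ck k U f -> Ck k U g.
Proof.
move=> oU; elim: k f g => [|k IH] f g fg /=.
  move=> cf x Ux.
  have nfg : \forall y \near x, f y = g y.
    by near=> y; apply: fg; near: y; apply: open_nbhs_nbhs.
  have := cf x Ux; rewrite /prop_for /continuous_at (fg _ Ux) => cfx.
  by apply: cvg_trans cfx; apply: near_eq_cvg.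
move=> [df ddf]; split=> [x Ux|v].
  apply: near_eq_differentiable (df _ Ux).
  by near=> y; apply: fg; near: y; apply: open_nbhs_nbhs.
apply: IH (ddf v) => x Ux; apply: near_eq_derive.
by near=> y; apply: fg; near: y; apply: open_nbhs_nbhs.
Unshelve. all: by end_near. Qed.

Lemma Ck_sub {W : normedModType R} k U U' (f : V -> W) :
  (forall x, U' x -> U x) -> Ck k U f -> Ck k U' f.
Proof.
move=> sU; elim: k f => [|k IH] f /= H; first by move=> x /sU /H.
by case: H => d dd; split=> [x /sU /d|v] //; apply: IH.
Qed.

Lemma Ck_pred {W : normedModType R} k U (f : V -> W) : Ck k.+1 U f -> Ck k U f.
Proof.
elim: k f => [|k IH] f.
  by case=> df _ x /df /differentiable_continuous.
move=> -[df ddf]; split=> // v; apply: IH; exact: ddf.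
Qed.

Lemma Ck_cst {W : normedModType R} k U (a : W) : open U -> Ck k U (cst a).
Proof.
move=> oU; elim: k a => [|k IH] a /=; first by move=> x _; exact: cst_continuous.
split=> [x _|v]; first exact: differentiable_cst.
by apply: Ck_eq (IH 0) => // x _ /=; rewrite derive_cst.
Qed.

Lemma CkD {W : normedModType R} k U (f g : V -> W) : open U ->
  Ck k U f -> Ck k U g -> Ck k U (fun x => f x + g x).
Proof.
move=> oU; elim: k f g => [|k IH] f g /=.
  by move=> cf cg x Ux; apply: continuousD; [exact: cf|exact: cg].
move=> [df ddf] [dg ddg]; split=> [x Ux|v].
  by apply: (differentiableD (df _ Ux) (dg _ Ux)).
apply: Ck_eq (IH _ _ (ddf v) (ddg v)) => // x Ux.
by rewrite -[RHS]/(derive (f + g) x v) deriveD //; apply: diff_derivable; auto.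
Qed.

Lemma Ck_lin {W W' : normedModType R} k U (L : {linear W -> W'}) (f : V -> W) :
  open U -> continuous L -> Ck k U f -> Ck k U (fun x => L (f x)).
Proof.
move=> oU cL; elim: k f => [|k IH] f /=.
  by move=> cf x Ux; apply: continuous_comp; [exact: cf|exact: cL].
move=> [df ddf]; have dL y : differentiable L y by apply: linear_differentiable.
split=> [x Ux|v]; first by apply: (differentiable_comp (df _ Ux)).
apply: Ck_eq (IH _ (ddf v)) => // x Ux.
rewrite !deriveE //; auto; last by apply: (differentiable_comp (df _ Ux)).
by rewrite (diff_comp (df _ Ux)) // diff_lin.
Qed.

End Ck_theory.

(** * Bilinear maps and the Leibniz rule *)

Definition is_bilinear {R : realType} {U V W : lmodType R} (B : U -> V -> W) :=
  (forall y, linear (B ^~ y)) /\ (forall x, linear (B x)).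

Section Bilinear.
Context {R : realType} {X : normedModType R} {U V W : normedModType R}.
Variable B : U -> V -> W.
Hypothesis bilB : is_bilinear B.
Hypothesis contB : continuous (fun p : U * V => B p.1 p.2).

Lemma bil_derive (f : X -> U) (g : X -> V) x :
  differentiable f x -> differentiable g x ->
  differentiable (fun y => B (f y) (g y)) x /\
  forall v, 'D_v (fun y => B (f y) (g y)) x
            = B ('D_v f x) (g x) + B (f x) ('D_v g x).
Proof.
move=> df dg.
have bB : bilinear_for (GRing.Scale.Law.clone _ _ *:%R _)
    (GRing.Scale.Law.clone _ _ *:%R _) B.
  by case: bilB => Bl Br; split=> u a x1 x2; [exact: Bl|exact: Br].
pose BM := bilinear_isBilinear.Build R U V W _ _ B bB.
pose BB : {bilinear U -> V -> W} := HB.pack B BM.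
have dp := differentiable_pair df dg.
have dB := @differentiable_bilin _ _ _ _ BB (f x, g x) contB.
have dc := differentiable_comp dp dB.
split=> [|v]; first exact: dc.
rewrite (deriveE v dc) (diff_comp dp dB) /= diff_pair //=.
rewrite (@diff_bilin _ _ _ _ BB (f x, g x) contB) /= !deriveE // addrC.
by [].
Qed.

(** Each term of the Leibniz rule keeps one factor undifferentiated; [Ck_pred] lowers the class of
    that factor, which closes the induction. *)
Lemma Ck_bil k (O : set X) (f : X -> U) (g : X -> V) : open O ->
  Ck k O f -> Ck k O g -> Ck k O (fun x => B (f x) (g x)).
Proof.
move=> oO; elim: k f g => [|k IH] f g.
  move=> /= cf cg x Ox.
  have cp : {for x, continuous (fun y => (f y, g y))}.
    by apply: cvg_pair; [exact: cf|exact: cg].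
  exact: (continuous_comp cp (@contB _)).
move=> Hf Hg; have [df ddf] := Hf; have [dg ddg] := Hg; split=> [x Ox|v].
  by case: (bil_derive (df _ Ox) (dg _ Ox)).
apply: Ck_eq (CkD oO (IH _ _ (ddf v) (Ck_pred Hg)) (IH _ _ (Ck_pred Hf) (ddg v))) => //.
by move=> x Ox; case: (bil_derive (df _ Ox) (dg _ Ox)) => _ ->.
Qed.

End Bilinear.

(** * Finite-dimensional spaces *)

Section Findim.
Context {R : realType}.

Lemma continuous_sum_fun {T : topologicalType} {W : normedModType R}
    (I : finType) (F : I -> T -> W) (x : T) :
  (forall i, {for x, continuous (F i)}) -> {for x, continuous (fun y => \sum_i F i y)}.
Proof.
move=> cF; elim: (index_enum I) => [|i r IH].
  rewrite (_ : (fun=> _) = cst 0); first exact: cst_continuous.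
  by apply/funext => y; rewrite big_nil.
rewrite (_ : (fun=> _) = (fun y => F i y + \sum_(j <- r) F j y)).
  by apply: continuousD; [exact: cF|exact: IH].
by apply/funext => y; rewrite big_cons.
Qed.

(** A finite generating family with continuous coordinate functionals. It makes every linear or
    bilinear map out of such spaces a finite sum of continuous maps, so that only algebraic
    linearity has to be checked afterwards. *)
Definition findim (V : normedModType R) : Prop :=
  exists (I : finType) (b : I -> V) (k : I -> {linear V -> R^o}),
    (forall i, continuous (k i)) /\ forall x, x = \sum_i k i x *: b i.

Lemma findim_linear_continuous {V W : normedModType R} (L : {linear V -> W}) :
  findim V -> continuous L.
Proof.
move=> [I [b [k [ck dec]]]].
have -> : (L : V -> W) = (fun x => \sum_i k i x *: L (b i)).
  apply/funext => x; rewrite [in LHS](dec x) linear_sum.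
  by apply: eq_bigr => i _; rewrite linearZ.
move=> x; apply: continuous_sum_fun => i; apply: cvgZr_tmp; exact: ck.
Qed.

Lemma findim_bilinear_continuous {U V W : normedModType R} (B : U -> V -> W) :
  is_bilinear B -> findim U -> findim V ->
  continuous (fun p : U * V => B p.1 p.2).
Proof.
move=> [Bl Br] [I [b [k [ck dec]]]] [J [c [l [cl dec']]]].
have B0l y : B 0 y = 0 by move: (Bl y (-1) 0 0); rewrite scaler0 addr0 scaleN1r addNr.
have B0r x : B x 0 = 0 by move: (Br x (-1) 0 0); rewrite scaler0 addr0 scaleN1r addNr.
have -> : (fun p : U * V => B p.1 p.2) =
    (fun p => \sum_i k i p.1 *: \sum_j l j p.2 *: B (b i) (c j)).
  apply/funext => -[x y] /=.
  have Bsl (F : I -> U) : B (\sum_i F i) y = \sum_i B (F i) y.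
    elim/big_ind2: _ => // [u1 u2 v1 v2 <- <-].
    by have := Bl y 1 u2 v2; rewrite !scale1r.
  have Bsr x' (F : J -> V) : B x' (\sum_i F i) = \sum_i B x' (F i).
    elim/big_ind2: _ => // [u1 u2 v1 v2 <- <-].
    by have := Br x' 1 u2 v2; rewrite !scale1r.
  rewrite [in LHS](dec x) Bsl; apply: eq_bigr => i _.
  have -> : B (k i x *: b i) y = k i x *: B (b i) y.
    by have := Bl y (k i x) (b i) 0; rewrite addr0 B0l addr0.
  rewrite [in LHS](dec' y) Bsr; congr (_ *: _); apply: eq_bigr => j _.
  by have := Br (b i) (l j y) (c j) 0; rewrite addr0 B0r addr0.
move=> -[x y]; apply: continuous_sum_fun => i; apply: cvgZ.
  by apply: (@continuous_comp _ _ _ fst (k i)); [exact: cvg_fst|exact: ck].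
apply: continuous_sum_fun => j; apply: cvgZr_tmp.
by apply: (@continuous_comp _ _ _ snd (l j)); [exact: cvg_snd|exact: cl].
Qed.

Lemma findim_R : findim R^o.
Proof.
exists unit, (fun=> 1 : R^o), (fun=> idfun); split=> [_ x|x]; first exact: cvg_id.
by rewrite (bigD1 tt) //= big1 ?addr0; [rewrite -[LHS]mulr1|case].
Qed.

Lemma findim_prod {V W : normedModType R} : findim V -> findim W ->
  findim (V * W)%type.
Proof.
move=> [I [b [k [ck dec]]]] [J [c [l [cl dec']]]].
pose B (s : I + J) : V * W := match s with inl i => (b i, 0) | inr j => (0, c j) end.
pose K (s : I + J) : {linear (V * W)%type -> R^o} :=
  match s with inl i => k i \o fst | inr j => l j \o snd end.
exists (I + J)%type, B, K; split=> [[i|j] /= x|[x y]].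
- by apply: (@continuous_comp _ _ _ fst (k i)); [exact: cvg_fst|exact: ck].
- by apply: (@continuous_comp _ _ _ snd (l j)); [exact: cvg_snd|exact: cl].
rewrite big_sumType /=; apply/eqP/andP; split; apply/eqP => /=.
  rewrite !(raddf_sum fst) /= [X in _ + X]big1 ?addr0.
    exact: dec.
  by move=> j _; rewrite scaler0.
rewrite !(raddf_sum snd) /= [X in X + _]big1 ?add0r.
  exact: dec'.
by move=> j _; rewrite scaler0.
Qed.

Lemma findim_mx m p : findim 'M[R]_(m, p).
Proof.
pose K (s : 'I_m * 'I_p) (A : 'M[R]_(m, p)) : R^o := A s.1 s.2.
have linK s : linear (K s) by move=> a A B; rewrite /K !mxE.
pose KL s : {linear 'M[R]_(m, p) -> R^o} :=
  HB.pack (K s) (GRing.isLinear.Build _ _ _ _ _ (linK s)).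
exists ('I_m * 'I_p)%type, (fun s => delta_mx s.1 s.2), KL.
split=> [s A|A]; first exact: coord_continuous.
rewrite [LHS]matrix_sum_delta pair_big /=; exact: eq_bigr.
Qed.

End Findim.

(** * Operations on smooth functions *)

Section SmoothOn.
Context {R : realType} {X : normedModType R}.
Implicit Types (O : set X).

Lemma smooth_on_eq {W : normedModType R} O (f g : X -> W) : open O ->
  (forall x, O x -> f x = g x) -> smooth_on O f -> smooth_on O g.
Proof. by move=> oO fg sf k; apply: Ck_eq (sf k). Qed.

Lemma smooth_on_sub {W : normedModType R} O O' (f : X -> W) :
  (forall x, O' x -> O x) -> smooth_on O f -> smooth_on O' f.
Proof. by move=> sO sf k; apply: Ck_sub (sf k). Qed.

Lemma smooth_on_differentiable {W : normedModType R} O (f : X -> W) x :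
  smooth_on O f -> O x -> differentiable f x.
Proof. by move=> /(_ 1) /= [+ _] Ox; apply. Qed.

Lemma smooth_on_continuous {W : normedModType R} O (f : X -> W) x :
  smooth_on O f -> O x -> {for x, continuous f}.
Proof. by move=> /(_ 0) /=; apply. Qed.

Lemma smooth_on_derive {W : normedModType R} O (f : X -> W) v :
  smooth_on O f -> smooth_on O ('D_v f).
Proof. by move=> sf k; have [_] := sf k.+1; apply. Qed.

Lemma smooth_on_cst {W : normedModType R} O (a : W) :
  open O -> smooth_on O (cst a).
Proof. by move=> oO k; apply: Ck_cst. Qed.

Lemma smooth_on_id O : open O -> smooth_on O id.
Proof.
move=> oO [|k] /=; first by move=> x _; exact: cvg_id.
split=> // v; apply: Ck_eq (Ck_cst k v oO) => // x _.
by rewrite derive_id.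
Qed.

Lemma smooth_onD {W : normedModType R} O (f g : X -> W) : open O ->
  smooth_on O f -> smooth_on O g -> smooth_on O (fun x => f x + g x).
Proof. by move=> oO sf sg k; apply: CkD. Qed.

Lemma smooth_on_lin {W W' : normedModType R} O (L : {linear W -> W'})
    (f : X -> W) : open O -> findim W ->
  smooth_on O f -> smooth_on O (fun x => L (f x)).
Proof.
move=> oO fW sf k; apply: Ck_lin => //; exact: findim_linear_continuous.
Qed.

Lemma smooth_on_bil {U V W : normedModType R} O (B : U -> V -> W)
    (f : X -> U) (g : X -> V) : open O -> is_bilinear B -> findim U -> findim V ->
  smooth_on O f -> smooth_on O g -> smooth_on O (fun x => B (f x) (g x)).
Proof.
move=> oO bB fU fV sf sg k; apply: Ck_bil => //; exact: findim_bilinear_continuous.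
Qed.

Lemma scale_is_bilinear {W : lmodType R} :
  is_bilinear (fun (a : R^o) (w : W) => a *: w).
Proof.
by split=> u a x y; rewrite ?scalerDl ?scalerDr ?scalerA // mulrC.
Qed.

Lemma smooth_onZ {W : normedModType R} O (f : X -> R^o) (g : X -> W) :
  open O -> smooth_on O f -> smooth_on O g -> smooth_on O (fun x => f x *: g x).
Proof.
move=> oO sf sg k; apply: (Ck_bil scale_is_bilinear) => // -[a w].
by apply: cvgZ; [exact: cvg_fst|exact: cvg_snd].
Qed.

Lemma smooth_onN {W : normedModType R} O (f : X -> W) : open O ->
  smooth_on O f -> smooth_on O (fun x => - f x).
Proof.
move=> oO sf; apply: smooth_on_eq (smooth_onZ oO (smooth_on_cst (-1 : R^o) oO) sf) => //.
by move=> x _; rewrite scaleN1r.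
Qed.

Lemma smooth_onB {W : normedModType R} O (f g : X -> W) : open O ->
  smooth_on O f -> smooth_on O g -> smooth_on O (fun x => f x - g x).
Proof. by move=> oO sf sg; apply: smooth_onD => //; apply: smooth_onN. Qed.

Lemma smooth_on_sum {W : normedModType R} O (I : Type) (r : seq I)
    (F : I -> X -> W) : open O ->
  (forall i, smooth_on O (F i)) -> smooth_on O (fun x => \sum_(i <- r) F i x).
Proof.
move=> oO sF; elim: r => [|i r IH].
  by apply: smooth_on_eq (smooth_on_cst 0 oO) => // x _; rewrite big_nil.
by apply: smooth_on_eq (smooth_onD oO (sF i) IH) => // x _; rewrite big_cons.
Qed.

(** The derivative is written as a polynomial in g itself and the derivative of f; in this form
    smoothness of g follows by induction on the order. *)
Lemma differentiable_invsqrt (f : X -> R^o) x : differentiable f x -> 0 < f x ->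
  let g := fun x => (Num.sqrt (f x))^-1 : R^o in
  differentiable g x /\
  forall v, 'D_v g x = - 2^-1 *: 'D_v f x * (g x * (g x * g x)).
Proof.
move=> df f0 g.
pose q : R -> R := fun y => (Num.sqrt y)^-1.
have s0 : 0 < Num.sqrt (f x) by rewrite sqrtr_gt0.
have [sd sv] : is_derive (f x) 1 (@Num.sqrt R) (2 * Num.sqrt (f x))^-1.
  exact: is_derive1_sqrt.
have qd : derivable q (f x) 1 by apply: derivableV => //; rewrite gt_eqF.
have qv : 'D_1 q (f x) = - (2^-1 * (g x * (g x * g x))).
  rewrite deriveV ?gt_eqF // sv /g /GRing.scale /=.
  by field; rewrite gt_eqF.
have dq : differentiable q (f x) by apply/derivable1_diffP.
have dc := differentiable_comp df dq.
split=> [|v]; first exact: dc.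
rewrite (deriveE v dc) (diff_comp df dq) /= deriv1E //= derive1E qv -deriveE //.
rewrite /GRing.scale /=; lra.
Qed.

Lemma smooth_on_invsqrt O (f : X -> R^o) : open O -> smooth_on O f ->
  (forall x, O x -> 0 < f x) ->
  smooth_on O (fun x => (Num.sqrt (f x))^-1 : R^o).
Proof.
move=> oO sf f0 k; elim: k => [|k IH] /=.
  move=> x Ox; have df := smooth_on_differentiable sf Ox.
  by have [/differentiable_continuous] := differentiable_invsqrt df (f0 _ Ox).
split=> [x Ox|v].
  have df := smooth_on_differentiable sf Ox.
  by have [] := differentiable_invsqrt df (f0 _ Ox).
have mulb : forall p q : X -> R^o, Ck k O p -> Ck k O q ->
    Ck k O (fun x => p x * q x : R^o).
  move=> p q; apply: (Ck_bil (@scale_is_bilinear R^o)) => // -[a w].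
  by apply: cvgZ; [exact: cvg_fst|exact: cvg_snd].
apply: Ck_eq (mulb _ _ (mulb _ _ (Ck_cst k (- 2^-1 : R^o) oO) (smooth_on_derive v sf k))
   (mulb _ _ IH (mulb _ _ IH IH))) => // x Ox.
have df := smooth_on_differentiable sf Ox.
by have [_ ->] := differentiable_invsqrt df (f0 _ Ox).
Qed.

End SmoothOn.

(** * Calculus on a submanifold *)

Section MSmooth.
Context {R : realType} {V : normedModType R}.
Variable M : set V.
Implicit Types (U : set V).

Lemma msmooth_of {W : normedModType R} U Q (F : V -> W) : open Q ->
  (forall x, M x -> U x -> Q x) -> smooth_on Q F -> msmooth M U F.
Proof. by move=> oO UO sF x Mx Ux; exists Q, F; split=> //; exact: UO. Qed.

Lemma msmooth_eq {W : normedModType R} U (f g : V -> W) :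
  (forall x, M x -> U x -> f x = g x) -> msmooth M U f -> msmooth M U g.
Proof.
move=> fg sf x Mx Ux; have [Q [F [oO Ox sF E]]] := sf x Mx Ux.
by exists Q, F; split=> // y My Uy Oy; rewrite -fg // E.
Qed.

Lemma msmooth_op2 {W1 W2 W : normedModType R} (op : W1 -> W2 -> W) U f g :
  (forall Q F G, open Q -> smooth_on Q F -> smooth_on Q G ->
     smooth_on Q (fun x : V => op (F x) (G x))) ->
  msmooth M U f -> msmooth M U g -> msmooth M U (fun x => op (f x) (g x)).
Proof.
move=> sop sf sg x Mx Ux.
have [Q [F [oO Ox sF EF]]] := sf x Mx Ux.
have [Q' [G [oO' Ox' sG EG]]] := sg x Mx Ux.
have oI : open (Q `&` Q') by apply: openI.
exists (Q `&` Q'), (fun x => op (F x) (G x)); split=> //.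
  by apply: sop => //; [move: sF|move: sG]; apply: smooth_on_sub => y [].
by move=> y My Uy [Oy Oy']; rewrite EF // EG.
Qed.

Lemma msmooth_cst {W : normedModType R} U (a : W) : msmooth M U (fun=> a).
Proof.
by apply: (@msmooth_of _ _ setT) => //; [exact: openT|apply: smooth_on_cst; exact: openT].
Qed.

Lemma msmooth_id U : msmooth M U id.
Proof.
by apply: (@msmooth_of _ _ setT) => //; [exact: openT|apply: smooth_on_id; exact: openT].
Qed.

Lemma msmoothD {W : normedModType R} U (f g : V -> W) :
  msmooth M U f -> msmooth M U g -> msmooth M U (fun x => f x + g x).
Proof. by apply: (@msmooth_op2 _ _ _ +%R) => Q F G; apply: smooth_onD. Qed.

Lemma msmooth_bil {W1 W2 W : normedModType R} U (B : W1 -> W2 -> W) f g :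
  is_bilinear B -> findim W1 -> findim W2 ->
  msmooth M U f -> msmooth M U g -> msmooth M U (fun x => B (f x) (g x)).
Proof. by move=> *; apply: msmooth_op2 => // *; apply: smooth_on_bil. Qed.

Lemma msmoothZ {W : normedModType R} U (f : V -> R^o) (g : V -> W) :
  msmooth M U f -> msmooth M U g -> msmooth M U (fun x => f x *: g x).
Proof.
by apply: (@msmooth_op2 _ _ _ (fun (a : R^o) w => a *: w)) => *; apply: smooth_onZ.
Qed.

Lemma msmooth_lin {W W' : normedModType R} U (L : {linear W -> W'})
    (f : V -> W) : findim W ->
  msmooth M U f -> msmooth M U (fun x => L (f x)).
Proof.
move=> fW sf x Mx Ux; have [Q [F [oO Ox sF E]]] := sf x Mx Ux.
exists Q, (fun x => L (F x)); split=> //; first exact: smooth_on_lin.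
by move=> y My Uy Oy; rewrite E.
Qed.

Lemma msmooth_sum {W : normedModType R} U (I : Type) (r : seq I)
    (F : I -> V -> W) :
  (forall i, msmooth M U (F i)) -> msmooth M U (fun x => \sum_(i <- r) F i x).
Proof.
move=> sF; elim: r => [|i r IH].
  by apply: (msmooth_eq _ (@msmooth_cst W U 0)) => x _ _; rewrite big_nil.
by apply: (msmooth_eq _ (@msmoothD W U _ _ (sF i) IH)) => x _ _; rewrite big_cons.
Qed.

Lemma tderE {W : normedModType R} (f : V -> W) x v (Q : set V) (F : V -> W) :
  M x -> tspace M x v -> open Q -> Q x -> smooth_on Q F ->
  (forall y, M y -> Q y -> f y = F y) -> tder M f x v = 'D_v F x.
Proof.
move=> Mx /xgetPex-/(_ (fun=> x)) + oO Ox sF E; rewrite /tder.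
set c := xget _ _ => -[sc Mc c0 cv].
have dc : differentiable c 0 by apply: smooth_on_differentiable sc _.
have cO : \forall t \near (0 : R^o), Q (c t).
  have cc := differentiable_continuous dc.
  by apply: cc; rewrite c0; apply: open_nbhs_nbhs.
have dF : differentiable F (c 0) by rewrite c0; apply: smooth_on_differentiable sF Ox.
rewrite derive1E (@near_eq_derive _ _ _ _ (F \o c)); last first.
  by near=> t; apply: E => //; near: t.
rewrite deriveE; last exact: differentiable_comp.
have cv' : 'd c 0 1 = v by rewrite -cv derive1E deriveE.
rewrite diff_comp //= cv' c0 deriveE //.
by rewrite -c0.
Unshelve. all: by end_near. Qed.

(** The chosen curve stays in M, so both composites are the same function of time; this covers maps
    not known to be smooth. *)
Lemma tder_eq {W : normedModType R} (f g : V -> W) x v :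
  tspace M x v -> (forall y, M y -> f y = g y) -> tder M f x v = tder M g x v.
Proof.
move=> /xgetPex-/(_ (fun=> x)) + E; rewrite /tder.
set c := xget _ _ => -[sc Mc c0 cv].
by congr (derive1 _ 0); apply/funext => t /=; apply: E.
Qed.

Lemma tder_bil {W1 W2 W : normedModType R} (B : W1 -> W2 -> W) f g x v :
  is_bilinear B -> findim W1 -> findim W2 -> M x -> tspace M x v ->
  msmooth M setT f -> msmooth M setT g ->
  tder M (fun y => B (f y) (g y)) x v
    = B (tder M f x v) (g x) + B (f x) (tder M g x v).
Proof.
move=> bB f1 f2 Mx Tv sf sg.
have [Q [F [oO Ox sF EF]]] := sf x Mx I.
have [Q' [G [oO' Ox' sG EG]]] := sg x Mx I.
rewrite (@tderE _ f x v Q F) //; last by move=> y My; apply: EF.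
rewrite (@tderE _ g x v Q' G) //; last by move=> y My; apply: EG.
have oI : open (Q `&` Q') by apply: openI.
have cB := findim_bilinear_continuous bB f1 f2.
rewrite (@tderE _ _ x v (Q `&` Q') (fun y => B (F y) (G y))) //; last 2 first.
- apply: smooth_on_bil => //.
    by move: sF; apply: smooth_on_sub => y [].
  by move: sG; apply: smooth_on_sub => y [].
- by move=> y My [Oy Oy']; rewrite EF // EG.
rewrite EF // EG //.
have [_ ->] // := bil_derive bB cB (smooth_on_differentiable sF Ox)
  (smooth_on_differentiable sG Ox').
Qed.

Lemma tder_lin {W W' : normedModType R} (L : {linear W -> W'}) f x v :
  findim W -> M x -> tspace M x v -> msmooth M setT f ->
  tder M (fun y => L (f y)) x v = L (tder M f x v).
Proof.
move=> fW Mx Tv sf.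
have [Q [F [oO Ox sF EF]]] := sf x Mx I.
rewrite (@tderE _ f x v Q F) //; last by move=> y My; apply: EF.
rewrite (@tderE _ _ x v Q (fun y => L (F y))) //; last 2 first.
- exact: smooth_on_lin.
- by move=> y My Oy; rewrite EF.
have dF := smooth_on_differentiable sF Ox.
have cL : continuous L by apply: findim_linear_continuous.
have dL y : differentiable L y by apply: linear_differentiable.
rewrite !deriveE //; last exact: (differentiable_comp dF).
by rewrite (diff_comp dF) // diff_lin.
Qed.

Lemma tderD {W : normedModType R} (f g : V -> W) x v :
  M x -> tspace M x v -> msmooth M setT f -> msmooth M setT g ->
  tder M (fun y => f y + g y) x v = tder M f x v + tder M g x v.
Proof.
move=> Mx Tv sf sg.
have [Q [F [oO Ox sF EF]]] := sf x Mx I.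
have [Q' [G [oO' Ox' sG EG]]] := sg x Mx I.
rewrite (@tderE _ f x v Q F) //; last by move=> y My; apply: EF.
rewrite (@tderE _ g x v Q' G) //; last by move=> y My; apply: EG.
have oI : open (Q `&` Q') by apply: openI.
rewrite (@tderE _ _ x v (Q `&` Q') (fun y => F y + G y)) //; last 2 first.
- apply: smooth_onD => //.
    by move: sF; apply: smooth_on_sub => y [].
  by move: sG; apply: smooth_on_sub => y [].
- by move=> y My [Oy Oy']; rewrite EF // EG.
by rewrite -[LHS]/(derive (F + G) x v) deriveD //; apply: diff_derivable;
  [apply: smooth_on_differentiable sF _|apply: smooth_on_differentiable sG _].
Qed.

Lemma tderZ {W : normedModType R} (f : V -> R^o) (g : V -> W) x v :
  findim W -> M x -> tspace M x v -> msmooth M setT f -> msmooth M setT g ->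
  tder M (fun y => f y *: g y) x v
    = tder M f x v *: g x + f x *: tder M g x v.
Proof.
by move=> fW *; apply: (tder_bil scale_is_bilinear) => //; apply: findim_R.
Qed.

Lemma tder_cst {W : normedModType R} (a : W) x v :
  M x -> tspace M x v -> tder M (fun=> a) x v = 0.
Proof.
move=> Mx Tv; rewrite (@tderE _ _ x v setT (cst a)) //; first exact: derive_cst.
  exact: openT.
apply: smooth_on_cst; exact: openT.
Qed.

Lemma tder_id x v : M x -> tspace M x v -> tder M id x v = v.
Proof.
move=> Mx Tv; rewrite (@tderE _ _ x v setT id) //; first exact: derive_id.
  exact: openT.
apply: smooth_on_id; exact: openT.
Qed.

Lemma tder_linear {W : normedModType R} (f : V -> W) x a u v :
  M x -> tspace M x u -> tspace M x v -> tspace M x (a *: u + v) ->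
  msmooth M setT f ->
  tder M f x (a *: u + v) = a *: tder M f x u + tder M f x v.
Proof.
move=> Mx Tu Tv Tuv sf.
have [Q [F [oO Ox sF EF]]] := sf x Mx I.
have EF' y : M y -> Q y -> f y = F y by move=> My; apply: EF.
rewrite !(@tderE _ f x _ Q F) //.
by have dF := smooth_on_differentiable sF Ox; rewrite !deriveE // linearP.
Qed.

(** The direction X x varies with x. Expanding it in coordinates leaves derivatives in the fixed
    directions [b i], with smooth coefficients. *)
Lemma msmooth_tder {W : normedModType R} (f : V -> W) (X : V -> V) :
  findim V -> vfield M setT X -> msmooth M setT f ->
  msmooth M setT (fun x => tder M f x (X x)).
Proof.
move=> [I [b [k [ck dec]]]] [sX TX] sf x Mx _.
have fV : findim V by exists I, b, k.
have [Q [F [oO Ox sF EF]]] := sf x Mx Logic.I.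
have [Q' [G [oO' Ox' sG EG]]] := sX x Mx Logic.I.
have oI : open (Q `&` Q') by apply: openI.
exists (Q `&` Q'), (fun y => \sum_i (k i (G y) : R^o) *: 'D_(b i) F y); split=> //.
  apply: smooth_on_sum => // i; apply: smooth_onZ => //.
    apply: smooth_on_lin => //.
    by move: sG; apply: smooth_on_sub => y [].
  apply: smooth_on_derive.
  by move: sF; apply: smooth_on_sub => y [].
move=> y My _ [Oy Oy'].
rewrite (@tderE _ f y _ Q F) //; [|exact: TX|by move=> *; apply: EF].
have dF := smooth_on_differentiable sF Oy.
rewrite deriveE // EG // [in LHS](dec (G y)) linear_sum; apply: eq_bigr => i _.
by rewrite linearZ deriveE.
Qed.

End MSmooth.

(** * Quaternionic matrices *)

Section BilinearTheory.
Context {R : realType} {U V W : lmodType R} (B : U -> V -> W).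
Hypothesis bB : is_bilinear B.

Lemma bilDl x x' y : B (x + x') y = B x y + B x' y.
Proof. by have := bB.1 y 1 x x'; rewrite !scale1r. Qed.
Lemma bilDr x y y' : B x (y + y') = B x y + B x y'.
Proof. by have := bB.2 x 1 y y'; rewrite !scale1r. Qed.
Lemma bil0l y : B 0 y = 0.
Proof. by apply: (addrI (B 0 y)); rewrite -bilDl !addr0. Qed.
Lemma bil0r x : B x 0 = 0.
Proof. by apply: (addrI (B x 0)); rewrite -bilDr !addr0. Qed.
Lemma bilZl a x y : B (a *: x) y = a *: B x y.
Proof. by have := bB.1 y a x 0; rewrite bil0l !addr0. Qed.
Lemma bilZr a x y : B x (a *: y) = a *: B x y.
Proof. by have := bB.2 x a y 0; rewrite bil0r !addr0. Qed.
Lemma bilNl x y : B (- x) y = - B x y.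
Proof. by rewrite -scaleN1r bilZl scaleN1r. Qed.
Lemma bilNr x y : B x (- y) = - B x y.
Proof. by rewrite -scaleN1r bilZr scaleN1r. Qed.
Lemma bil_suml I (r : seq I) (P : pred I) F y :
  B (\sum_(i <- r | P i) F i) y = \sum_(i <- r | P i) B (F i) y.
Proof. by elim/big_ind2: _ => [|? ? ? ? <- <-|//]; rewrite ?bil0l ?bilDl. Qed.
Lemma bil_sumr I (r : seq I) (P : pred I) F x :
  B x (\sum_(i <- r | P i) F i) = \sum_(i <- r | P i) B x (F i).
Proof. by elim/big_ind2: _ => [|? ? ? ? <- <-|//]; rewrite ?bil0r ?bilDr. Qed.
End BilinearTheory.

Section LinearTheory.
Context {R : realType} {U V : lmodType R} (f : U -> V).
Hypothesis lf : linear f.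

Lemma linD x y : f (x + y) = f x + f y.
Proof. by have := lf 1 x y; rewrite !scale1r. Qed.
Lemma lin0 : f 0 = 0.
Proof. by apply: (addrI (f 0)); rewrite -linD !addr0. Qed.
Lemma linZ a x : f (a *: x) = a *: f x.
Proof. by have := lf a x 0; rewrite lin0 !addr0. Qed.
Lemma linN x : f (- x) = - f x.
Proof. by rewrite -scaleN1r linZ scaleN1r. Qed.
Lemma lin_sum I (r : seq I) (P : pred I) F :
  f (\sum_(i <- r | P i) F i) = \sum_(i <- r | P i) f (F i).
Proof. by elim/big_ind2: _ => [|? ? ? ? <- <-|//]; rewrite ?lin0 ?linD. Qed.
End LinearTheory.

Section LinearCalculus.
Context {R : realType} {V : normedModType R} {W W' : normedModType R}.
Variables (M : set V) (L : W -> W').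
Hypotheses (lL : linear L) (fW : findim W).

Let LL : {linear W -> W'} := HB.pack L (GRing.isLinear.Build _ _ _ _ _ lL).

Lemma smooth_on_linear (D : set V) (f : V -> W) :
  open D -> smooth_on D f -> smooth_on D (fun x => L (f x)).
Proof. by move=> oD; apply: (smooth_on_lin LL). Qed.

Lemma msmooth_linear (U : set V) (f : V -> W) :
  msmooth M U f -> msmooth M U (fun x => L (f x)).
Proof. exact: (msmooth_lin LL). Qed.

Lemma tder_of_linear f x v : M x -> tspace M x v -> msmooth M setT f ->
  tder M (fun y => L (f y)) x v = L (tder M f x v).
Proof. exact: (tder_lin LL). Qed.
End LinearCalculus.

Notation "A *q B" := (qmul A B) (at level 40, left associativity).
Notation "A ^*q" := (qadj A) (at level 8, format "A ^*q").

(** * Products, adjoints and traces *)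

Section QuaternionMatrices.
Context {R : realType}.
Implicit Types (m p q r : nat).

Lemma addmxE m p (A B : 'M[R]_(m, p)) i j : (A + B) i j = A i j + B i j.
Proof. by rewrite mxE. Qed.
Lemma oppmxE m p (A : 'M[R]_(m, p)) i j : (- A) i j = - A i j.
Proof. by rewrite mxE. Qed.
Lemma scalemxE m p a (A : 'M[R]_(m, p)) i j : (a *: A) i j = a * A i j.
Proof. by rewrite mxE. Qed.

Lemma trmxD m p (A B : 'M[R]_(m, p)) : (A + B)^T = A^T + B^T.
Proof. exact: linearD. Qed.
Lemma trmxN m p (A : 'M[R]_(m, p)) : (- A)^T = - A^T.
Proof. exact: linearN. Qed.
Lemma mxtrN m (A : 'M[R]_m) : \tr (- A) = - \tr A.
Proof. exact: linearN. Qed.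

Lemma qmx_eq m p (a b c d a' b' c' d' : 'M[R]_(m, p)) :
  a = a' -> b = b' -> c = c' -> d = d' -> (a, b, c, d) = (a', b', c', d').
Proof. by move=> -> -> -> ->. Qed.

Lemma qmulA m p q r (A : qmx R m p) (B : qmx R p q) (C : qmx R q r) :
  A *q (B *q C) = A *q B *q C.
Proof.
move: A B C => [[[a0 a1] a2] a3] [[[b0 b1] b2] b3] [[[c0 c1] c2] c3] /=.
apply: qmx_eq; rewrite ?(mulmxDl, mulmxDr, mulmxN, mulNmx, mulmxA);
  by apply/matrixP => i j; rewrite ?(addmxE, oppmxE); ring.
Qed.

Lemma qmul_is_bilinear m p q : is_bilinear (@qmul R m p q).
Proof.
split=> [[[[b0 b1] b2] b3] a [[[x0 x1] x2] x3] [[[y0 y1] y2] y3]|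
         [[[b0 b1] b2] b3] a [[[x0 x1] x2] x3] [[[y0 y1] y2] y3]] /=;
apply: qmx_eq; rewrite /= ?(mulmxDl, mulmxDr) -?(scalemxAl, scalemxAr) ?opprD;
  by apply/matrixP => i j; rewrite ?(addmxE, oppmxE, scalemxE); ring.
Qed.

Definition qmulDl m p q := bilDl (@qmul_is_bilinear m p q).
Definition qmulDr m p q := bilDr (@qmul_is_bilinear m p q).
Definition qmulNl m p q := bilNl (@qmul_is_bilinear m p q).
Definition qmulNr m p q := bilNr (@qmul_is_bilinear m p q).
Definition qmulZl m p q := bilZl (@qmul_is_bilinear m p q).
Definition qmulZr m p q := bilZr (@qmul_is_bilinear m p q).
Definition qmul0l m p q := bil0l (@qmul_is_bilinear m p q).
Definition qmul0r m p q := bil0r (@qmul_is_bilinear m p q).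
Definition qmul_suml m p q := bil_suml (@qmul_is_bilinear m p q).
Definition qmul_sumr m p q := bil_sumr (@qmul_is_bilinear m p q).
Lemma qmulBl m p q (A B : qmx R m p) (C : qmx R p q) :
  (A - B) *q C = A *q C - B *q C.
Proof. by rewrite qmulDl qmulNl. Qed.
Lemma qmulBr m p q (A : qmx R m p) (B C : qmx R p q) :
  A *q (B - C) = A *q B - A *q C.
Proof. by rewrite qmulDr qmulNr. Qed.

Lemma qadj_is_linear m p : linear (@qadj R m p).
Proof.
move=> a [[[x0 x1] x2] x3] [[[y0 y1] y2] y3] /=.
by apply: qmx_eq => /=; rewrite linearP //= opprD scalerN.
Qed.

Lemma qadjD m p (A B : qmx R m p) : (A + B)^*q = A^*q + B^*q.
Proof. exact: (linD (@qadj_is_linear m p)). Qed.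
Lemma qadjN m p (A : qmx R m p) : (- A)^*q = - A^*q.
Proof. exact: (linN (@qadj_is_linear m p)). Qed.
Lemma qadjB m p (A B : qmx R m p) : (A - B)^*q = A^*q - B^*q.
Proof. by rewrite qadjD qadjN. Qed.
Lemma qadjZ m p a (A : qmx R m p) : (a *: A)^*q = a *: A^*q.
Proof. exact: (linZ (@qadj_is_linear m p)). Qed.
Lemma qadj0 m p : (0 : qmx R m p)^*q = 0.
Proof. exact: (lin0 (@qadj_is_linear m p)). Qed.
Lemma qadj_sum m p I (r : seq I) (Q : pred I) (F : I -> qmx R m p) :
  (\sum_(i <- r | Q i) F i)^*q = \sum_(i <- r | Q i) (F i)^*q.
Proof. exact: (lin_sum (@qadj_is_linear m p)). Qed.

Lemma qadjK m p (A : qmx R m p) : A^*q^*q = A.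
Proof.
by case: A => [[[a b] c] d] /=; rewrite !trmxN !opprK !trmxK.
Qed.

Lemma qadjM m p q (A : qmx R m p) (B : qmx R p q) :
  (A *q B)^*q = B^*q *q A^*q.
Proof.
move: A B => [[[a0 a1] a2] a3] [[[b0 b1] b2] b3] /=.
apply: qmx_eq; rewrite ?(trmxD, trmxN, trmx_mul, mulmxN, mulNmx);
  by apply/matrixP => i j; rewrite ?(addmxE, oppmxE); ring.
Qed.

Definition qid m : qmx R m m := (1%:M, 0, 0, 0).

Lemma qmul1l m p (A : qmx R m p) : qid m *q A = A.
Proof.
by case: A => [[[a b] c] d] /=; rewrite !mul1mx !mul0mx !subr0 !addr0.
Qed.
Lemma qmul1r m p (A : qmx R m p) : A *q qid p = A.
Proof.
by case: A => [[[a b] c] d] /=; rewrite !mulmx1 !mulmx0 !subr0 !addr0 !add0r.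
Qed.
Lemma qadj1 m : (qid m)^*q = qid m.
Proof. by rewrite /= trmx1 trmx0 oppr0. Qed.
Lemma qoneE : qone = qid 1. Proof. by []. Qed.

Definition qre m (A : qmx R m m) : R^o := \tr A.1.1.1.

Lemma qre_is_linear m : linear (@qre m).
Proof. by move=> a A B; rewrite /qre /= linearP. Qed.

Lemma qreD m (A B : qmx R m m) : qre (A + B) = qre A + qre B.
Proof. exact: (linD (@qre_is_linear m)). Qed.
Lemma qreN m (A : qmx R m m) : qre (- A) = - qre A.
Proof. exact: (linN (@qre_is_linear m)). Qed.
Lemma qreB m (A B : qmx R m m) : qre (A - B) = qre A - qre B.
Proof. by rewrite qreD qreN. Qed.
Lemma qreZ m a (A : qmx R m m) : qre (a *: A) = a * qre A.
Proof. exact: (linZ (@qre_is_linear m)). Qed.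
Lemma qre0 m : qre (0 : qmx R m m) = 0.
Proof. exact: (lin0 (@qre_is_linear m)). Qed.
Lemma qre_sum m I (r : seq I) (Q : pred I) (F : I -> qmx R m m) :
  qre (\sum_(i <- r | Q i) F i) = \sum_(i <- r | Q i) qre (F i).
Proof. exact: (lin_sum (@qre_is_linear m)). Qed.

Lemma qre_mulC m p (A : qmx R m p) (B : qmx R p m) : qre (A *q B) = qre (B *q A).
Proof.
move: A B => [[[a0 a1] a2] a3] [[[b0 b1] b2] b3]; rewrite /qre /=.
rewrite !mxtraceD !mxtrN (mxtrace_mulC a0) (mxtrace_mulC a1) (mxtrace_mulC a2).
by rewrite (mxtrace_mulC a3).
Qed.

Lemma qre1 m : qre (qid m) = m%:R.
Proof. exact: mxtrace1. Qed.

Lemma mxtr_sq m p (A : 'M[R]_(m, p)) : \tr (A^T *m A) = \sum_i \sum_j A j i ^+ 2.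
Proof.
rewrite /mxtrace; apply: eq_bigr => i _; rewrite mxE; apply: eq_bigr => j _.
by rewrite mxE expr2.
Qed.

Lemma mxtr_sq_ge0 m p (A : 'M[R]_(m, p)) : 0 <= \tr (A^T *m A).
Proof. by rewrite mxtr_sq; do 2 apply: sumr_ge0 => ? _; apply: sqr_ge0. Qed.

Lemma mxtr_sq_eq0 m p (A : 'M[R]_(m, p)) : \tr (A^T *m A) = 0 -> A = 0.
Proof.
rewrite mxtr_sq => /eqP; rewrite psumr_eq0 => [|? _]; last first.
  by apply: sumr_ge0 => ? _; apply: sqr_ge0.
move=> /allP H; apply/matrixP => i j; rewrite mxE.
have /implyP/(_ isT) := H j (mem_index_enum _).
rewrite psumr_eq0 => [|? _]; last exact: sqr_ge0.
by move=> /allP/(_ i (mem_index_enum _))/implyP/(_ isT); rewrite sqrf_eq0 => /eqP.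
Qed.

(** A sum of squares of all real entries: the source of norms, and the way a matrix is shown to
    vanish. *)
Lemma qsqE m p (A : qmx R m p) : qre (A^*q *q A) =
  \tr (A.1.1.1^T *m A.1.1.1) + \tr (A.1.1.2^T *m A.1.1.2)
  + \tr (A.1.2^T *m A.1.2) + \tr (A.2^T *m A.2).
Proof.
case: A => [[[a b] c] d]; rewrite /qre /= !mulNmx !opprK.
by rewrite !mxtraceD.
Qed.

Lemma qsq_ge0 m p (A : qmx R m p) : 0 <= qre (A^*q *q A).
Proof. by rewrite qsqE !addr_ge0 // mxtr_sq_ge0. Qed.

Lemma qsq_eq0 m p (A : qmx R m p) : qre (A^*q *q A) = 0 -> A = 0.
Proof.
rewrite qsqE.
have := mxtr_sq_ge0 A.1.1.1; have := mxtr_sq_ge0 A.1.1.2.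
have := mxtr_sq_ge0 A.1.2; have := mxtr_sq_ge0 A.2.
move=> h3 h2 h1 h0 e.
have /mxtr_sq_eq0 e0 : \tr (A.1.1.1^T *m A.1.1.1) = 0 by lra.
have /mxtr_sq_eq0 e1 : \tr (A.1.1.2^T *m A.1.1.2) = 0 by lra.
have /mxtr_sq_eq0 e2 : \tr (A.1.2^T *m A.1.2) = 0 by lra.
have /mxtr_sq_eq0 e3 : \tr (A.2^T *m A.2) = 0 by lra.
by case: A e0 e1 e2 e3 {e h0 h1 h2 h3} => [[[a b] c] d] /= -> -> -> ->.
Qed.

Lemma qsq_gt0 m p (A : qmx R m p) : A <> 0 -> 0 < qre (A^*q *q A).
Proof.
by move=> A0; rewrite lt_neqAle qsq_ge0 eq_sym andbT; apply/eqP => /qsq_eq0.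
Qed.

(** Norms and diagonal entries of Hermitian matrices thereby become real scalars, which can be moved
    out of noncommutative products. *)
Lemma qherm_real (A : qmx R 1 1) : A^*q = A -> A = qre A *: qone.
Proof.
have tr1 (a : 'M[R]_1) : a^T = a by apply/matrixP => i j; rewrite mxE !ord1.
have opp0 (a : 'M[R]_1) : - a = a -> a = 0.
  move=> /matrixP E; apply/matrixP => i j; have := E i j; rewrite !mxE; lra.
case: A => [[[a b] c] d] /=; rewrite !tr1 => -[/opp0 -> /opp0 -> /opp0 ->].
rewrite /qre /= /qone; apply: qmx_eq => /=; rewrite ?scaler0 //.
by rewrite scalemx1 [LHS]mx11_scalar [a in RHS]mx11_scalar mxtrace_scalar mulr1n.
Qed.

Lemma findim_qmx m p : findim (qmx R m p).
Proof. by do 3 (apply: findim_prod; last exact: findim_mx); exact: findim_mx. Qed.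

Definition qe m (j : 'I_m) : qmx R m 1 := (delta_mx j 0, 0, 0, 0).

Lemma qe_sum m : \sum_j qe j *q (qe j)^*q = qid m.
Proof.
have E (j : 'I_m) : qe j *q (qe j)^*q = (delta_mx j j, 0, 0, 0).
  rewrite /qe /= !trmx0 !oppr0 !mulmx0 !mul0mx !subr0 !addr0 trmx_delta.
  by rewrite mul_delta_mx.
under eq_bigr do rewrite E.
have S : forall r : seq 'I_m, \sum_(j <- r) ((delta_mx j j, 0, 0, 0) : qmx R m m)
    = (\sum_(j <- r) delta_mx j j, 0, 0, 0).
  elim=> [|j r IH]; first by rewrite !big_nil.
  by rewrite !big_cons IH; apply: qmx_eq => /=; rewrite ?addr0.
rewrite S; apply: qmx_eq => //.
apply/matrixP => i k; rewrite summxE mxE (bigD1 i) //= mxE eqxx big1 /=.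
  by rewrite addr0 eq_sym.
by move=> j /negPf ji; rewrite mxE eq_sym ji.
Qed.

Lemma qe_herm m (i j : 'I_m) : (qe i)^*q *q qe j = if i == j then qone else 0.
Proof.
rewrite /qe /= !trmx0 !oppr0 !mulmx0 !mul0mx !subr0 !addr0 trmx_delta.
case: eqVneq => [->|ij]; first by rewrite mul_delta_mx /qone; apply: qmx_eq => //;
  apply/matrixP => a b; rewrite !mxE !ord1.
by rewrite mul_delta_mx_0.
Qed.

Lemma qmx_ext m p (A B : qmx R m p) :
  (forall i j, (qe i)^*q *q A *q qe j = (qe i)^*q *q B *q qe j) -> A = B.
Proof.
have E (C : qmx R m p) :
    C = \sum_i \sum_j qe i *q ((qe i)^*q *q C *q qe j) *q (qe j)^*q.
  rewrite -[LHS]qmul1l -[LHS]qmul1r -!qe_sum qmul_suml qmul_suml.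
  apply: eq_bigr => i _; rewrite qmul_sumr; apply: eq_bigr => j _.
  by rewrite !qmulA.
by move=> AB; rewrite (E A) (E B); do 2 (apply: eq_bigr => ? _); rewrite AB.
Qed.

(** Gathering the family into a rectangular matrix W turns orthonormality into [W^*q *q W = qid k]
    and the projector onto the span into [W *q W^*q]. *)
Definition qcols m k (w : 'I_k -> qmx R m 1) : qmx R m k :=
  \sum_j w j *q (qe j)^*q.

Lemma qcolsE m k (w : 'I_k -> qmx R m 1) j : qcols w *q qe j = w j.
Proof.
rewrite /qcols qmul_suml (bigD1 j) //= -qmulA qe_herm eqxx qoneE qmul1r.
by rewrite big1 ?addr0 // => i /negPf ij; rewrite -qmulA qe_herm ij qmul0r.
Qed.

Lemma qcols_adj m k (w : 'I_k -> qmx R m 1) j :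
  (qe j)^*q *q (qcols w)^*q = (w j)^*q.
Proof. by rewrite -qadjM qcolsE. Qed.

Lemma qcols_sum m k (w w' : 'I_k -> qmx R m 1) :
  qcols w *q (qcols w')^*q = \sum_j w j *q (w' j)^*q.
Proof.
rewrite -[qcols w]qmul1r -qe_sum qmul_sumr qmul_suml; apply: eq_bigr => j _.
by rewrite qmulA qcolsE -qmulA qcols_adj.
Qed.

Lemma qorthonormalP m k (w : 'I_k -> qmx R m 1) :
  qorthonormal w <-> (qcols w)^*q *q qcols w = qid k.
Proof.
split=> [ow|E i j].
  by apply: qmx_ext => i j; rewrite qmulA qcols_adj -qmulA qcolsE qmul1r qe_herm -ow.
rewrite /qherm -(qcolsE w i) -(qcolsE w j) qadjM -qmulA (qmulA (qcols w)^*q) E.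
by rewrite qmul1l qe_herm.
Qed.

End QuaternionMatrices.

Arguments qmul : simpl never.
Arguments qadj : simpl never.

(** * The Clifford system C_4 *)

Section CliffordSystem.
Context {R : realType}.

Definition mx2 (a b c d : R) : 'M[R]_2 :=
  \matrix_(i, j) if i == 0 then if j == 0 then a else b
                 else if j == 0 then c else d.

Lemma mx2_eq a b c d a' b' c' d' :
  a = a' -> b = b' -> c = c' -> d = d' -> mx2 a b c d = mx2 a' b' c' d'.
Proof. by move=> -> -> -> ->. Qed.

Lemma ord2P (i : 'I_2) : i = 0 \/ i = 1.
Proof.
by case: i => -[|[|//]] i; [left|right]; apply: val_inj.
Qed.

Lemma mx2E (A : 'M[R]_2) : A = mx2 (A 0 0) (A 0 1) (A 1 0) (A 1 1).
Proof.
by apply/matrixP => i j; rewrite mxE; have [->|->] := ord2P i; have [->|->] := ord2P j.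
Qed.

Lemma mx2M a b c d a' b' c' d' : mx2 a b c d *m mx2 a' b' c' d' =
  mx2 (a * a' + b * c') (a * b' + b * d') (c * a' + d * c') (c * b' + d * d').
Proof.
rewrite [LHS]mx2E; apply: mx2_eq; by rewrite !mxE !big_ord_recl big_ord0 !mxE /= addr0.
Qed.

Lemma mx2D a b c d a' b' c' d' : mx2 a b c d + mx2 a' b' c' d' =
  mx2 (a + a') (b + b') (c + c') (d + d').
Proof. by rewrite [LHS]mx2E; apply: mx2_eq; rewrite !mxE. Qed.

Lemma mx2N a b c d : - mx2 a b c d = mx2 (- a) (- b) (- c) (- d).
Proof. by rewrite [LHS]mx2E; apply: mx2_eq; rewrite !mxE. Qed.

Lemma mx2Z k a b c d : k *: mx2 a b c d = mx2 (k * a) (k * b) (k * c) (k * d).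
Proof. by rewrite [LHS]mx2E; apply: mx2_eq; rewrite !mxE. Qed.

Lemma mx2T a b c d : (mx2 a b c d)^T = mx2 a c b d.
Proof. by rewrite [LHS]mx2E; apply: mx2_eq; rewrite !mxE. Qed.

Lemma mx2_1 : 1%:M = mx2 1 0 0 1.
Proof. by rewrite [LHS]mx2E; apply: mx2_eq; rewrite !mxE. Qed.

Lemma mx2_0 : 0 = mx2 0 0 0 0.
Proof. by rewrite [LHS]mx2E; apply: mx2_eq; rewrite !mxE. Qed.

Lemma mx2_tr a b c d : \tr (mx2 a b c d) = a + d.
Proof. by rewrite /mxtrace !big_ord_recl big_ord0 !mxE /= addr0. Qed.

Definition o0 : 'I_5 := @Ordinal 5 0 isT.
Definition o1 : 'I_5 := @Ordinal 5 1 isT.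
Definition o2 : 'I_5 := @Ordinal 5 2 isT.
Definition o3 : 'I_5 := @Ordinal 5 3 isT.
Definition o4 : 'I_5 := @Ordinal 5 4 isT.

Lemma ord5P (i : 'I_5) : i = o0 \/ i = o1 \/ i = o2 \/ i = o3 \/ i = o4.
Proof.
by case: i => -[|[|[|[|[|//]]]]] i; [left|right; left|do 2 right; left|
  do 3 right; left|do 4 right]; apply: val_inj.
Qed.

Lemma sum5 (T : nmodType) (F : 'I_5 -> T) :
  \sum_k F k = F o0 + F o1 + F o2 + F o3 + F o4.
Proof.
rewrite !big_ord_recl big_ord0 addr0 !addrA.
by congr (_ + _ + _ + _ + _); congr F; apply: val_inj.
Qed.

(* [s2 a] is the matrix by which [C4lin a] multiplies the row (x, y) on the right *)
Definition s2 (a : 'I_5 -> R) : qmx R 2 2 :=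
  (mx2 (a o4) (a o0) (a o0) (- a o4), mx2 0 (a o1) (- a o1) 0,
   mx2 0 (a o2) (- a o2) 0, mx2 0 (a o3) (- a o3) 0).

Lemma s2_adj a : (s2 a)^*q = s2 a.
Proof.
rewrite /s2 /qadj !mx2T; apply: qmx_eq => //; rewrite mx2N;
  by apply: mx2_eq; rewrite ?oppr0 ?opprK.
Qed.

Lemma s2_tr a : qre (s2 a) = 0.
Proof. by rewrite /qre mx2_tr subrr. Qed.

Lemma s2_linear c a b : s2 (fun k => c * a k + b k) = c *: s2 a + s2 b.
Proof.
by apply: qmx_eq => /=; rewrite mx2Z mx2D; apply: mx2_eq; ring.
Qed.

Lemma s2_polar a b :
  s2 a *q s2 b + s2 b *q s2 a = (2 * \sum_k a k * b k) *: qid 2.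
Proof.
rewrite sum5 /s2 /qmul; apply: qmx_eq => /=; rewrite ?scaler0;
  by rewrite ?mx2_1 ?mx2_0 ?mx2Z ?mx2M ?mx2N ?mx2D ?mx2N ?mx2D; apply: mx2_eq; ring.
Qed.

(** A parameter count: the real part is symmetric of trace zero, two parameters; each of the three
    imaginary parts is antisymmetric, one parameter. *)
Lemma s2_surj (S : qmx R 2 2) : S^*q = S -> qre S = 0 -> exists a, S = s2 a.
Proof.
case: S => [[[A B] C] D]; rewrite /qadj /qre /=.
rewrite (mx2E A) (mx2E B) (mx2E C) (mx2E D) !mx2T !mx2N mx2_tr.
have mxI : forall p q r s p' q' r' s', mx2 p q r s = mx2 p' q' r' s' ->
    [/\ p = p', q = q', r = r' & s = s'].
  move=> p q r s p' q' r' s' /matrixP E.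
  by have := E 0 0; have := E 0 1; have := E 1 0; have := E 1 1; rewrite !mxE.
move=> [/mxI[_ a1 a2 _] /mxI[b0 b1 b2 b3] /mxI[c0 c1 c2 c3] /mxI[d0 d1 d2 d3]] t.
have {}t : A 0 0 + A 1 1 = 0 :> R by [].
exists (fun k => if k == o0 then A 1 0 else if k == o1 then B 0 1 else
  if k == o2 then C 0 1 else if k == o3 then D 0 1 else A 0 0).
by apply: qmx_eq => /=; apply: mx2_eq; lra.
Qed.

Definition dlt (k : 'I_5) : 'I_5 -> R := fun j => (k == j)%:R.

Lemma s2_sum a : s2 a = \sum_k a k *: s2 (dlt k).
Proof.
rewrite sum5; apply: qmx_eq => /=; rewrite !mx2Z !mx2D;
  by apply: mx2_eq; rewrite /dlt /=; ring.
Qed.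

(** The volume element of the Clifford system is a scalar; its sign is what later distinguishes the
    two orientations of E. *)
Lemma s2_volume : s2 (dlt o0) *q s2 (dlt o1) *q s2 (dlt o2) *q s2 (dlt o3)
  *q s2 (dlt o4) = - qid 2.
Proof.
have E0 : s2 (dlt o0) = (mx2 0 1 1 0, 0, 0, 0).
  by rewrite mx2_0; apply: qmx_eq; rewrite /dlt /= ?oppr0.
have E1 : s2 (dlt o1) = (0, mx2 0 1 (- 1) 0, 0, 0).
  by rewrite mx2_0; apply: qmx_eq; rewrite /dlt /= ?oppr0.
have E2 : s2 (dlt o2) = (0, 0, mx2 0 1 (- 1) 0, 0).
  by rewrite mx2_0; apply: qmx_eq; rewrite /dlt /= ?oppr0.
have E3 : s2 (dlt o3) = (0, 0, 0, mx2 0 1 (- 1) 0).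
  by rewrite mx2_0; apply: qmx_eq; rewrite /dlt /= ?oppr0.
have E4 : s2 (dlt o4) = (mx2 1 0 0 (- 1), 0, 0, 0).
  by rewrite mx2_0; apply: qmx_eq; rewrite /dlt /= ?oppr0.
(* Every factor has a single quaternionic component, and so has every partial product: i, then i j =
   k, then k k = -1, then a real factor. *)
have F (A B : 'M[R]_2) : [/\ ((A, 0, 0, 0) : qmx R 2 2) *q (0, B, 0, 0) = (0, A *m B, 0, 0),
    ((0, A, 0, 0) : qmx R 2 2) *q (0, 0, B, 0) = (0, 0, 0, A *m B),
    ((0, 0, 0, A) : qmx R 2 2) *q (0, 0, 0, B) = (- (A *m B), 0, 0, 0) &
    ((A, 0, 0, 0) : qmx R 2 2) *q (B, 0, 0, 0) = (A *m B, 0, 0, 0)].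
  by split; rewrite /qmul; apply: qmx_eq;
    rewrite ?(mul0mx, mulmx0) ?subr0 ?addr0 ?add0r ?subr0 ?sub0r.
rewrite E0 E1 E2 E3 E4.
have [-> _ _ _] := F (mx2 0 1 1 0) (mx2 0 1 (- 1) 0).
rewrite mx2M; set Z := mx2 (_ + _) _ _ _; have [_ -> _ _] := F Z (mx2 0 1 (- 1) 0).
rewrite /Z mx2M; set X := mx2 (_ + _) _ _ _; have [_ _ -> _] := F X (mx2 0 1 (- 1) 0).
rewrite /X mx2M mx2N; set Y := mx2 (- _) _ _ _; have [_ _ _ ->] := F Y (mx2 1 0 0 (- 1)).
rewrite /Y mx2M; apply: qmx_eq => /=; rewrite ?oppr0 // mx2_1 mx2N.
by apply: mx2_eq; ring.
Qed.

Definition qrow (p : qmx R 1 1 * qmx R 1 1) : qmx R 1 2 :=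
  p.1 *q (qe 0)^*q + p.2 *q (qe 1)^*q.

Lemma qrow0 p : qrow p *q qe 0 = p.1.
Proof.
by rewrite /qrow qmulDl -!qmulA !qe_herm /= qmul0r addr0 qoneE qmul1r.
Qed.
Lemma qrow1 p : qrow p *q qe 1 = p.2.
Proof.
by rewrite /qrow qmulDl -!qmulA !qe_herm /= qmul0r add0r qoneE qmul1r.
Qed.

Lemma qrow_eta (A : qmx R 1 2) : A = qrow (A *q qe 0, A *q qe 1).
Proof.
rewrite /qrow /= -!qmulA -qmulDr -[LHS]qmul1r; congr (_ *q _).
by rewrite -qe_sum !big_ord_recl big_ord0 addr0; congr (_ + qe _ *q (qe _)^*q);
  apply: val_inj.
Qed.

Lemma qrow_inj p p' : qrow p = qrow p' -> p = p'.
Proof.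
by move=> E; rewrite [p]surjective_pairing [p']surjective_pairing -!qrow0 -!qrow1 E.
Qed.

Lemma qent m p (A : qmx R m p) i j : (qe i)^*q *q A *q qe j =
  ((A.1.1.1 i j)%:M, (A.1.1.2 i j)%:M, (A.1.2 i j)%:M, (A.2 i j)%:M).
Proof.
case: A => [[[a b] c] d].
rewrite /qe /qadj /qmul /= !trmx0 !oppr0 !mul0mx !mulmx0 !subr0 ?addr0 ?add0r.
have E (X : 'M[R]_(m, p)) :
    (delta_mx i 0)^T *m X *m delta_mx j 0 = (X i j)%:M :> 'M[R]_1.
  rewrite trmx_delta -rowE -colE; apply/matrixP => s t.
  by rewrite !ord1 !mxE eqxx mulr1n.
by rewrite !E.
Qed.

Lemma qrow_C4 k p : qrow (C4 k p) = qrow p *q s2 (dlt k).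
Proof.
have z0 : (0%:M, 0%:M, 0%:M, 0%:M) = 0 :> qmx R 1 1.
  by apply: qmx_eq; apply/matrixP => a b; rewrite !mxE mul0rn.
have E j : qrow p *q s2 (dlt k) *q qe j =
    p.1 *q ((qe 0)^*q *q s2 (dlt k) *q qe j)
    + p.2 *q ((qe 1)^*q *q s2 (dlt k) *q qe j).
  by rewrite /qrow !qmulDl !qmulA.
rewrite [RHS]qrow_eta; congr qrow; rewrite !E !qent.
case: p {E} => x y.
have zM : 0%:M = 0 :> 'M[R]_1 by apply/matrixP => a b; rewrite !mxE mul0rn.
have nM : (- 1)%:M = - 1%:M :> 'M[R]_1 by apply/matrixP => a b; rewrite !mxE mulNrn.
have q1 : (1%:M, 0, 0, 0) = qid 1 :> qmx R 1 1 by [].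
have qn1 : (- 1%:M, 0, 0, 0) = - qid 1 :> qmx R 1 1 by apply: qmx_eq; rewrite ?oppr0.
have qni : (0, - 1%:M, 0, 0) = - qi :> qmx R 1 1 by apply: qmx_eq; rewrite ?oppr0.
have qnj : (0, 0, - 1%:M, 0) = - qj :> qmx R 1 1 by apply: qmx_eq; rewrite ?oppr0.
have qnk : (0, 0, 0, - 1%:M) = - qk :> qmx R 1 1 by apply: qmx_eq; rewrite ?oppr0.
have z4 : (0, 0, 0, 0) = 0 :> qmx R 1 1 by [].
by have [->|[->|[->|[->|->]]]] := ord5P k; rewrite /s2 /dlt /= !mxE /= ?oppr0 ?zM ?nM
  ?q1 ?qn1 ?qni ?qnj ?qnk ?z4 ?(qmul0r, qmul1r, qmulNr, add0r, addr0).
Qed.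

End CliffordSystem.

(** * Pointwise algebra at a projector *)

Section LinearExtensionality.
Context {R : realType}.

Lemma qmx_functional_ext m p (A B : qmx R m p) :
  (forall L : qmx R m p -> R, (forall x y, L (x + y) = L x + L y) ->
     (forall x, L (- x) = - L x) -> (forall k x, L (k *: x) = k * L x) ->
     L 0 = 0 -> L A = L B) -> A = B.
Proof.
move=> H; have [I [b [k [_ dec]]]] := @findim_qmx R m p.
rewrite (dec A) (dec B); apply: eq_bigr => i _; congr (_ *: _).
by apply: (H (k i)) => *; rewrite ?linearD ?linearN ?linearZ ?linear0.
Qed.

(** Words are kept associated to the left, so inside a longer word a relation [X *q Y = Z] is
    visible only after a prefix A. *)
Lemma qmul_rule m p q (X : qmx R m p) (Y : qmx R p q) (Z : qmx R m q) :
  X *q Y = Z -> forall l (A : qmx R l m), A *q X *q Y = A *q Z.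
Proof. by move=> <- l A; rewrite qmulA. Qed.

End LinearExtensionality.

(* Applying an arbitrary linear functional turns an equality of linear
   combinations of words into one that [ring] can decide. *)
Ltac qabel :=
  let L := fresh in let LD := fresh in let LN := fresh in let LZ := fresh in
  let LO := fresh in
  apply: qmx_functional_ext => L LD LN LZ LO;
  rewrite ?(LD, LN, LZ, LO); ring.

Ltac qdistr := rewrite ?(qmulDl, qmulDr, qmulNl, qmulNr, qmulZl, qmulZr,
  qmul0l, qmul0r, qmul1l, qmul1r, qmulA).

Section Projectors.
Context {R : realType} {N : nat}.
Local Notation V := (qmx R N N).

Definition projector (P : V) : Prop := P^*q = P /\ P *q P = P.

(** The linearization of the two equations of [projector]. *)
Definition tangent (P X : V) : Prop := X^*q = X /\ X *q P + P *q X = X.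

Definition symT (P S : V) : Prop := [/\ S^*q = S, P *q S = S & qre S = 0].

Definition act (S X : V) : V := X *q S + S *q X.

(** This is (1 - P) Z P + P Z (1 - P), the off-diagonal blocks of Z for the splitting into W and its
    complement. *)
Definition tproj (P Z : V) : V := Z *q P + P *q Z - 2 *: (P *q Z *q P).

Lemma tangent_rule P X : tangent P X -> X *q P = X - P *q X.
Proof. by move=> [_ E]; apply/eqP; rewrite eq_sym subr_eq E. Qed.

Lemma symT_rule P S : projector P -> symT P S -> S *q P = S.
Proof.
by move=> [hP _] [hS PS _]; have := congr1 (@qadj R N N) PS; rewrite qadjM hP hS.
Qed.

Lemma tangent_lin P a X Y : tangent P X -> tangent P Y -> tangent P (a *: X + Y).
Proof.
move=> [hX tX] [hY tY]; split; first by rewrite qadjD qadjZ hX hY.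
by qdistr; rewrite addrACA -scalerDr tX tY.
Qed.

Lemma tangent0 P : tangent P 0.
Proof. by split; rewrite ?qadj0 // qmul0l qmul0r addr0. Qed.

Lemma symT_lin P a S T : symT P S -> symT P T -> symT P (a *: S + T).
Proof.
move=> [hS pS tS] [hT pT tT]; split; first by rewrite qadjD qadjZ hS hT.
- by qdistr; rewrite pS pT.
- by rewrite qreD qreZ tS tT mulr0 addr0.
Qed.

Lemma act_is_bilinear : is_bilinear act.
Proof. by split=> Y a X Z; rewrite /act; qdistr; qabel. Qed.

Lemma tproj_is_linear P : linear (tproj P).
Proof. by move=> a X Y; rewrite /tproj; qdistr; qabel. Qed.

Lemma tproj_tangent P Z : projector P -> Z^*q = Z -> tangent P (tproj P Z).
Proof.
move=> [hP PP] hZ; split; rewrite /tproj.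
  by rewrite qadjB qadjD qadjZ !qadjM hZ hP -qmulA [X in X - _]addrC.
by qdistr; rewrite ?(PP, qmul_rule PP); qabel.
Qed.

Lemma tproj_id P X : projector P -> tangent P X -> tproj P X = X.
Proof.
move=> [hP PP] /tangent_rule tX; rewrite /tproj; qdistr.
rewrite ?(tX, qmul_rule tX); qdistr; rewrite ?(PP, qmul_rule PP); qabel.
Qed.

(** The discarded diagonal blocks of Z are trace-orthogonal to Y, which is off-diagonal. *)
Lemma tproj_orth P Z Y : projector P -> tangent P Y ->
  qre (tproj P Z *q Y) = qre (Z *q Y).
Proof.
move=> [hP PP] /[dup] tY [_ Y2]; have PYP : P *q Y *q P = 0.
  by rewrite -qmulA (tangent_rule tY); qdistr; rewrite PP subrr.
rewrite /tproj; qdistr; rewrite qreB qreD qreZ.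
have -> : qre (P *q Z *q P *q Y) = 0.
  by rewrite -!qmulA qre_mulC -!qmulA (qmulA P Y) PYP qmul0r qre0.
rewrite mulr0 subr0 -(qmulA P Z) (qre_mulC P) -!qmulA -qreD -qmulDr.
by rewrite addrC Y2.
Qed.

Section Act.
Variables (P S T X Y : V).
Hypotheses (hP : projector P) (sS : symT P S) (sT : symT P T).
Hypotheses (tX : tangent P X) (tY : tangent P Y).

Let PP : P *q P = P. Proof. by case: hP. Qed.
Let PS : P *q S = S. Proof. by case: sS. Qed.
Let PT : P *q T = T. Proof. by case: sT. Qed.
Let SP : S *q P = S. Proof. exact: symT_rule. Qed.
Let TP : T *q P = T. Proof. exact: symT_rule. Qed.
Let XP : X *q P = X - P *q X. Proof. exact: tangent_rule. Qed.
(** X maps W into its complement while S lives on W. This and the next two vanishing words carry the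
    whole algebra of [act]. *)
Lemma PXS0 : P *q X *q S = 0.
Proof.
have /eqP : X *q (P *q S) = X *q S by rewrite PS.
rewrite qmulA XP qmulBl subr_eq -subr_eq0 opprD addrA subrr sub0r oppr_eq0.
by move=> /eqP.
Qed.

Lemma SXP0 : S *q X *q P = 0.
Proof. by rewrite -qmulA XP qmulBr qmulA SP subrr. Qed.

Lemma SXT0 : S *q X *q T = 0.
Proof. by rewrite -PT qmulA SXP0 qmul0l. Qed.

Lemma act_tangent : tangent P (act S X).
Proof.
split; first by rewrite qadjD !qadjM; case: sS => -> _ _; case: tX => -> _;
  rewrite addrC.
rewrite /act; qdistr; rewrite PXS0 SXP0 PS -(qmulA X) SP; qabel.
Qed.

(** The two words with X in the middle vanish. Composites thus depend only on the products of S and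
    T, so the Clifford relations pass from these to the operators. *)
Lemma act_act : act S (act T X) = X *q T *q S + S *q T *q X.
Proof.
rewrite /act; qdistr; rewrite SXT0 -[T *q X *q S]qmulA.
have -> : T *q (X *q S) = 0 by rewrite -TP -!qmulA (qmulA P) PXS0 qmul0r.
by qabel.
Qed.

Lemma act_selfadj : qre (act S X *q Y) = qre (X *q act S Y).
Proof.
rewrite /act; qdistr; rewrite !qreD addrC.
by congr (_ + _); rewrite -!qmulA qre_mulC -!qmulA.
Qed.

End Act.

End Projectors.

(** * Adapted frames *)

Section Frames.
Context {R : realType}.

(** Here (P - K)^2 = P - K has trace zero, and the trace of the square of a Hermitian matrix is
    definite. *)
Lemma projector_eq N (P K : qmx R N N) : projector P -> projector K ->
  P *q K = K -> qre P = qre K -> P = K.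
Proof.
move=> [hP PP] [hK KK] PK tr; apply/subr0_eq/qsq_eq0.
have KP : K *q P = K by have := congr1 (@qadj R N N) PK; rewrite qadjM hP hK.
rewrite qadjB hP hK; qdistr.
by rewrite PP PK KP KK ?(qreD, qreN) tr; ring.
Qed.

Lemma qcols_projector N k (w : 'I_k -> qmx R N 1) : qorthonormal w ->
  projector (qcols w *q (qcols w)^*q) /\ qre (qcols w *q (qcols w)^*q) = k%:R.
Proof.
move=> /qorthonormalP E; split; last by rewrite qre_mulC E qre1.
split; first by rewrite qadjM qadjK.
by rewrite -qmulA (qmulA _^*q) E qmul1l.
Qed.

(** The trace shows that K is not the identity, so 1 - K has a nonzero column, which is then
    normalized. *)
Lemma unit_orthogonal N (K : qmx R N N) : projector K -> qre K < N%:R ->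
  exists v : qmx R N 1, qherm v v = qone /\ K *q v = 0.
Proof.
move=> [hK KK] lt.
have [j vj] : exists j, (qid N - K) *q qe j <> 0.
  apply: contrapT => /forallNP H.
  have : qid N - K = 0.
    apply: qmx_ext => i j; rewrite qmul0r qmul0l -qmulA.
    by have /contrapT -> := H j; rewrite qmul0r.
  by move=> /subr0_eq E; move: lt; rewrite -E qre1 ltxx.
set v := (qid N - K) *q qe j in vj *.
have Kv : K *q v = 0 by rewrite /v qmulA qmulBr qmul1r KK subrr qmul0l.
have v0 := qsq_gt0 vj.
have Ev : qherm v v = qre (v^*q *q v) *: qone.
  by apply: qherm_real; rewrite /qherm qadjM qadjK.
set r := qre _ in v0 Ev.
exists ((Num.sqrt r)^-1 *: v); split; last by rewrite qmulZr Kv scaler0.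
rewrite /qherm qadjZ qmulZl qmulZr -[_ *q v]/(qherm v v) Ev !scalerA.
rewrite -[RHS]scale1r; congr (_ *: _).
rewrite -invfM -expr2 sqr_sqrtr; last exact: ltW.
by rewrite mulVf //; exact: lt0r_neq0 v0.
Qed.

(** P plus the projector K onto the vectors already found is a projector of trace m + k < N, so a
    further unit vector fits. *)
Lemma orthonormal_complement N (P : qmx R N N) m k : projector P ->
  qre P = m%:R -> (m + k <= N)%N ->
  exists wp : 'I_k -> qmx R N 1, qorthonormal wp /\ forall l, P *q wp l = 0.
Proof.
move=> hP trP; elim: k => [|k IH] lek.
  by exists (fun=> 0); split=> -[].
have [|wp [ow Pw]] := IH; first by rewrite (leq_trans _ lek) // leq_add2l.
have [[hK KK] trK] := qcols_projector ow.
set K := qcols wp *q _ in hK KK trK.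
have PK : P *q K = 0.
  by rewrite /K qcols_sum qmul_sumr big1 // => l _; rewrite qmulA Pw qmul0l.
have KP : K *q P = 0.
  by have := congr1 (@qadj R N N) PK; rewrite qadjM qadj0 hK hP.1.
have prPK : projector (P + K).
  split; first by rewrite qadjD hP.1 hK.
  by rewrite qmulDl !qmulDr hP.2 PK KP KK addr0 add0r.
have [|v [vv Kv]] := unit_orthogonal prPK.
  by rewrite qreD trP trK -natrD ltr_nat -addnS.
have Pv : P *q v = 0.
  have := congr1 (fun x => P *q x) Kv.
  by rewrite /= qmul0r qmulA qmulDr hP.2 PK addr0.
have wv l : qherm (wp l) v = 0.
  have Kv' : K *q v = 0 by rewrite -[LHS]add0r -{1}Pv -qmulDl.
  have : (wp l)^*q *q K = (wp l)^*q.
    have := congr1 (fun X => (qe l)^*q *q X *q (qcols wp)^*q) ((qorthonormalP wp).1 ow).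
    by rewrite /= !qmulA qmul1r qcols_adj -qmulA.
  by rewrite /qherm => <-; rewrite -qmulA Kv' qmul0r.
exists (fun i : 'I_k.+1 => if unlift ord_max i is Some j then wp j else v).
split=> [i j|i]; last by case: unliftP => [l _|_].
case: (unliftP ord_max i) => [i' ->|->]; case: (unliftP ord_max j) => [j' ->|->].
- by rewrite ow (inj_eq lift_inj).
- by rewrite wv eq_sym (negPf (neq_lift _ _)).
- by rewrite (negPf (neq_lift _ _)) /qherm -[v in _^*q *q v]qadjK -?qadjM -[X in _ = X]qadj0
    -(wv j') /qherm qadjM qadjK.
- by rewrite eqxx.
Qed.

End Frames.

Section AdaptedFrames.
Context {R : realType} {n : nat}.
Local Notation N := n.+2.
Implicit Types (P : qmx R N N) (w : 'I_2 -> qmx R N 1) (wp : 'I_n -> qmx R N 1).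

Lemma qplaneE w : qplane w = qcols w *q (qcols w)^*q.
Proof. by rewrite qcols_sum. Qed.

Lemma Gr_projector P : Gr R n P -> projector P /\ qre P = 2.
Proof. by move=> [w /qcols_projector ow ->]; rewrite qplaneE. Qed.

Lemma adapted_exists P : Gr R n P -> exists w wp, adapted P w wp.
Proof.
move=> GP; have [prP trP] := Gr_projector GP; case: GP => w ow PE.
have [|wp [owp Pwp]] := orthonormal_complement (m := 2) (k := n) prP trP => //.
exists w, wp; split=> // a l.
have : (w a)^*q *q P = (w a)^*q.
  have := congr1 (fun X => (qe a)^*q *q X *q (qcols w)^*q) ((qorthonormalP w).1 ow).
  by rewrite PE qplaneE /= !qmulA qmul1r qcols_adj -qmulA.
by rewrite /qherm => <-; rewrite -qmulA Pwp qmul0r.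
Qed.

Section Adapted.
Variables (P : qmx R N N) (w : 'I_2 -> qmx R N 1) (wp : 'I_n -> qmx R N 1).
Hypothesis ad : adapted P w wp.
Local Notation W := (qcols w).
Local Notation Wp := (qcols wp).

Lemma adapted_PE : P = W *q W^*q.
Proof. by case: ad => _ -> _ _; rewrite qplaneE. Qed.

Lemma adapted_Gr : Gr R n P.
Proof. by case: ad => ow -> _ _; exists w. Qed.

Lemma adapted_WW : W^*q *q W = qid 2.
Proof. by case: ad => ow _ _ _; apply/qorthonormalP. Qed.

Lemma adapted_WWp : W^*q *q Wp = 0.
Proof.
case: ad => _ _ _ H; apply: qmx_ext => i j.
by rewrite qmulA qcols_adj -qmulA qcolsE qmul0r qmul0l -[RHS](H i j).
Qed.

Lemma adapted_PW : P *q W = W.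
Proof. by rewrite adapted_PE -qmulA adapted_WW qmul1r. Qed.

Lemma adapted_WpP : Wp^*q *q P = 0.
Proof.
have H := congr1 (@qadj R _ _) adapted_WWp.
by rewrite adapted_PE qmulA; move: H; rewrite qadjM qadjK qadj0 => ->; rewrite qmul0l.
Qed.

Lemma adapted_PWp : P *q Wp = 0.
Proof. by rewrite adapted_PE -qmulA adapted_WWp qmul0r. Qed.

(** Two mutually orthogonal projectors whose traces 2 and n add up to the dimension. *)
Lemma adapted_complete : P + Wp *q Wp^*q = qid N.
Proof.
have [[hP PP] trP] := Gr_projector adapted_Gr.
have [[hK KK] trK] : projector (Wp *q Wp^*q) /\ qre (Wp *q Wp^*q) = n%:R.
  by case: ad => _ _ owp _; exact: qcols_projector.
apply/esym/projector_eq.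
- by split; [exact: qadj1|rewrite qmul1l].
- split; first by rewrite qadjD hP hK.
  rewrite qmulDl !qmulDr PP KK [P *q (_ *q _)]qmulA adapted_PWp qmul0l.
  by rewrite -[_ *q P]qmulA adapted_WpP qmul0r addr0 add0r.
- by rewrite qmul1l.
by rewrite qre1 qreD trP trK -natrD.
Qed.

(** The endomorphism of W with matrix [s2 a] in the basis [w]. The basis [wp] does not enter, as C_4
    acts from the side of W. *)
Definition symF (a : 'I_5 -> R) : qmx R N N := W *q s2 a *q W^*q.

Lemma symF_mul a b : symF a *q symF b = W *q (s2 a *q s2 b) *q W^*q.
Proof.
by rewrite /symF !qmulA -[W *q _ *q W^*q *q W]qmulA adapted_WW qmul1r.
Qed.

Lemma qre_symF (A : qmx R 2 2) : qre (W *q A *q W^*q) = qre A.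
Proof. by rewrite qre_mulC qmulA adapted_WW qmul1l. Qed.

Lemma symF_polar a b :
  symF a *q symF b + symF b *q symF a = (2 * \sum_k a k * b k) *: P.
Proof.
rewrite !symF_mul -qmulDl -qmulDr s2_polar qmulZr qmulZl qmul1r.
by rewrite -adapted_PE.
Qed.

Lemma qre_symF2 a b : qre (symF a *q symF b) = 2 * \sum_k a k * b k.
Proof.
have := congr1 (@qre R N) (symF_polar a b).
rewrite qreD (qre_mulC (symF b)) qreZ.
have [_ ->] := Gr_projector adapted_Gr => E.
have {}E : (qre (symF a *q symF b) : R) + qre (symF a *q symF b) =
  2 * (\sum_k a k * b k) * 2 by [].
suff : (qre (symF a *q symF b) : R) = 2 * (\sum_k a k * b k) by [].
lra.
Qed.

Lemma symF_symT a : symT P (symF a).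
Proof.
split; first by rewrite /symF !qadjM qadjK s2_adj qmulA.
  by rewrite /symF !qmulA adapted_PW.
by rewrite qre_symF s2_tr.
Qed.

(** S = P S P is conjugate through W to the 2x2 matrix [W^*q *q S *q W], again Hermitian and
    traceless. *)
Lemma symT_symF S : symT P S -> exists a, S = symF a.
Proof.
have prP := (Gr_projector adapted_Gr).1.
move=> sS; have SP := symT_rule prP sS; case: (sS) => hS PS tS.
have E : S = W *q (W^*q *q S *q W) *q W^*q.
  by rewrite !qmulA -adapted_PE PS -qmulA -adapted_PE SP.
have [||a Ea] := @s2_surj R (W^*q *q S *q W).
- by rewrite !qadjM qadjK hS qmulA.
- by rewrite -qre_symF -E.
by exists a; rewrite E Ea.
Qed.

Lemma symF_linear c a b : symF (fun k => c * a k + b k) = c *: symF a + symF b.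
Proof. by rewrite /symF s2_linear; qdistr. Qed.

Lemma symF_sum a : symF a = \sum_k a k *: symF (dlt k).
Proof.
rewrite /symF s2_sum qmul_sumr qmul_suml; apply: eq_bigr => k _.
by rewrite qmulZr qmulZl.
Qed.

Lemma qrow_coords X l : qrow (coords w wp X l) = (wp l)^*q *q X *q W.
Proof.
rewrite [RHS]qrow_eta /coords /qherm; congr (qrow (_, _));
  by rewrite -!qmulA qcolsE; congr (_ *q (_ *q w _)); apply: val_inj.
Qed.

Lemma of_coordsE q : of_coords w wp q =
  (\sum_l wp l *q qrow (q l) *q W^*q) + (\sum_l wp l *q qrow (q l) *q W^*q)^*q.
Proof.
rewrite /of_coords; set A := \sum_l _; set B := \sum_l _; suff -> : A = B by [].
apply: eq_bigr => l _; rewrite /qrow qmulDr qmulDl !qmulA; congr (_ + _);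
  by rewrite -[in RHS]qmulA qcols_adj; congr (_ *q (w _)^*q); apply: val_inj.
Qed.

Lemma tangent_PXS X S : tangent P X -> symT P S -> P *q X *q S = 0.
Proof. by move=> tX sS; apply: (PXS0 sS tX). Qed.

Lemma coords_act a X l : tangent P X ->
  qrow (coords w wp (act (symF a) X) l) = qrow (coords w wp X l) *q s2 a.
Proof.
move=> tX; rewrite !qrow_coords /act qmulDr qmulDl.
have -> : (wp l)^*q *q (symF a *q X) = 0.
  have H : (wp l)^*q *q W = 0.
    have := congr1 (fun Y => (qe l)^*q *q Y) (congr1 (@qadj R _ _) adapted_WWp).
    by rewrite /= qadjM qadjK qadj0 qmul0r qmulA qcols_adj.
  by rewrite /symF !qmulA H !qmul0l.
by rewrite qmul0l addr0 /symF -!qmulA adapted_WW qmul1r.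
Qed.

(** The rows only describe the block of X S from W to its complement. Inserting P + Wp Wp^* = 1
    shows that this block is all of X S, because P X S = 0; the adjoint contributes S X. *)
Lemma of_coords_act k X : tangent P X ->
  of_coords w wp (fun l => C4 k (coords w wp X l)) = act (symF (dlt k)) X.
Proof.
move=> tX; rewrite of_coordsE.
have -> : \sum_l wp l *q qrow (C4 k (coords w wp X l)) *q W^*q = X *q symF (dlt k).
  have -> : X *q symF (dlt k) = (Wp *q Wp^*q) *q (X *q symF (dlt k)).
    have := symF_symT (dlt k); move: (symF (dlt k)) => S sS.
    rewrite -[Wp *q _](addKr P) adapted_complete; qdistr.
    by rewrite (tangent_PXS tX sS) oppr0 add0r.
  rewrite qcols_sum qmul_suml; apply: eq_bigr => l _.
  by rewrite qrow_C4 qrow_coords /symF !qmulA.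
rewrite /act qadjM; case: tX => -> _; by case: (symF_symT (dlt k)) => -> _ _.
Qed.

End Adapted.
End AdaptedFrames.

(** * Gram-Schmidt and the tangent space *)

Section SmoothQuaternion.
Context {R : realType} {X : normedModType R}.
Implicit Types D : set X.

Lemma smooth_on_qmul m p q D (f : X -> qmx R m p) (g : X -> qmx R p q) :
  open D -> smooth_on D f -> smooth_on D g -> smooth_on D (fun x => f x *q g x).
Proof.
move=> oD sf sg.
by apply: smooth_on_bil => //; [exact: qmul_is_bilinear|exact: findim_qmx..].
Qed.

Lemma smooth_on_qadj m p D (f : X -> qmx R m p) :
  open D -> smooth_on D f -> smooth_on D (fun x => (f x)^*q).
Proof.
move=> oD sf.
by apply: smooth_on_linear => //; [exact: qadj_is_linear|exact: findim_qmx].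
Qed.

Lemma smooth_on_qre m D (f : X -> qmx R m m) :
  open D -> smooth_on D f -> smooth_on D (fun x => qre (f x)).
Proof.
move=> oD sf.
by apply: smooth_on_linear => //; [exact: qre_is_linear|exact: findim_qmx].
Qed.

Lemma open_pos D (f : X -> R^o) : open D -> smooth_on D f ->
  open [set x | D x /\ 0 < f x].
Proof.
move=> oD sf; rewrite openE => x [Dx fx].
have cf := smooth_on_continuous sf Dx.
have nD : \forall y \near x, D y by apply: open_nbhs_nbhs.
have nf : \forall y \near x, 0 < f y by apply: (cvgr_gt (f x) cf).
by rewrite /interior /=; near=> y; split; near: y.
Unshelve. all: by end_near. Qed.

(* The criterion in the last clause makes the result global for the curve in
   [tangent_tspace] and local in [local_frames]. *)
Lemma gram_schmidt N k D (f : 'I_k -> X -> qmx R N 1) : open D ->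
  (forall i, smooth_on D (f i)) ->
  exists (D' : set X) (e : 'I_k -> X -> qmx R N 1),
  [/\ open D', (forall x, D' x -> D x), (forall i, smooth_on D' (e i)),
      (forall x, D' x -> [/\ qorthonormal (e ^~ x),
         forall j, (\sum_i e i x *q (e i x)^*q) *q f j x = f j x &
         forall p (Y : qmx R p N), (forall j, Y *q f j x = 0) ->
           forall i, Y *q e i x = 0]) &
      (forall x, D x -> (exists d : 'I_k -> qmx R N 1,
         forall i j, qherm (d i) (f j x) = if i == j then qone else 0) -> D' x)].
Proof.
move=> oD; elim: k f => [|k IH] f sf.
  exists D, f; split=> // x _; split; by [case|move=> []|move=> p Y _ []].
have [D1 [e [oD1 D1D se He dual1]]] := IH (fun i => f (lift ord_max i)) (fun i => sf _).
pose K x := \sum_i e i x *q (e i x)^*q.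
pose r x := f ord_max x - K x *q f ord_max x.
pose nu x : R^o := qre ((r x)^*q *q r x).
have sK : smooth_on D1 K.
  by apply: smooth_on_sum => // i; apply: smooth_on_qmul => //; apply: smooth_on_qadj.
have sfm : smooth_on D1 (f ord_max) by apply: smooth_on_sub (sf _).
have sr : smooth_on D1 r by apply: smooth_onB => //; apply: smooth_on_qmul.
have snu : smooth_on D1 nu.
  by apply: smooth_on_qre => //; apply: smooth_on_qmul => //; apply: smooth_on_qadj.
pose D2 := [set x | D1 x /\ 0 < nu x].
(* The residual [r] can be normalized only where it is nonzero; the domain shrinks to this open
   set. *)
have oD2 : open D2 by apply: open_pos.
pose v x := ((Num.sqrt (nu x))^-1 : R^o) *: r x.
exists D2, (fun i => if unlift ord_max i is Some j then e j else v); split.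
- exact: oD2.
- by move=> x [/D1D].
- move=> i; case: unliftP => [j _|_]; first by apply: smooth_on_sub (se j) => x [].
  apply: smooth_onZ => //; last by apply: smooth_on_sub sr => x [].
  by apply: smooth_on_invsqrt => //; [apply: smooth_on_sub snu => x []|move=> x []].
- move=> x [D1x nux]; have [oe Kf Ye] := He x D1x.
  have Ke i : K x *q e i x = e i x.
    rewrite /K qmul_suml (bigD1 i) //= -qmulA [_^*q *q _]oe eqxx qoneE qmul1r.
    by rewrite big1 ?addr0 // => j /negPf ji; rewrite -qmulA [_^*q *q _]oe ji qmul0r.
  have hK : (K x)^*q = K x.
    by rewrite /K qadj_sum; apply: eq_bigr => i _; rewrite qadjM qadjK.
  have eK i : (e i x)^*q *q K x = (e i x)^*q by rewrite -[in RHS]Ke qadjM hK.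
  have er i : (e i x)^*q *q r x = 0 by rewrite /r qmulBr qmulA eK subrr.
  have ev i : (e i x)^*q *q v x = 0 by rewrite /v qmulZr er scaler0.
  have rr : (r x)^*q *q r x = nu x *: qone.
    by apply: qherm_real; rewrite qadjM qadjK.
  have s2 : (Num.sqrt (nu x))^-1 * (Num.sqrt (nu x))^-1 * nu x = 1.
    rewrite -invfM -expr2 sqr_sqrtr; last exact: ltW.
    by rewrite mulVf //; exact: lt0r_neq0 nux.
  have vv : (v x)^*q *q v x = qone.
    by rewrite /v qadjZ qmulZl qmulZr rr !scalerA s2 scale1r.
  have KK : K x *q K x = K x.
    by rewrite {2}/K qmul_sumr; apply: eq_bigr => i _; rewrite qmulA Ke.
  have Kr : K x *q r x = 0 by rewrite /r qmulBr qmulA KK subrr.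
  have vf : v x *q (v x)^*q *q f ord_max x = r x.
    have -> : f ord_max x = r x + K x *q f ord_max x by rewrite /r subrK.
    rewrite qmulDr -!qmulA (qmulA _^*q (K x)).
    have -> : (v x)^*q *q K x = 0.
      by rewrite /v qadjZ qmulZl -hK -qadjM Kr qadj0 scaler0.
    rewrite qmul0l qmul0r addr0 /v qadjZ !qmulZl rr qmulZr.
    by rewrite qmulZr qoneE qmul1r !scalerA s2 scale1r.
  have vfl j : (v x)^*q *q f (lift ord_max j) x = 0.
    rewrite -Kf -/(K x) qmulA /v qadjZ qmulZl.
    by rewrite -[_ *q K x]qadjK qadjM qadjK hK Kr qadj0 scaler0 qmul0l.
  have sum' : \sum_(i < k.+1) (if unlift ord_max i is Some j then e j else v) x *q
      ((if unlift ord_max i is Some j then e j else v) x)^*q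
      = v x *q (v x)^*q + K x.
    rewrite (bigD1_ord ord_max) //= unlift_none; congr (_ + _).
    by apply: eq_bigr => i _; rewrite liftK.
  split.
  + move=> i j; rewrite /qherm.
    case: (unliftP ord_max i) => [i' ->|->]; case: (unliftP ord_max j) => [j' ->|->].
    * by rewrite [LHS]oe (inj_eq lift_inj).
    * by rewrite ev eq_sym (negPf (neq_lift _ _)).
    * by rewrite (negPf (neq_lift _ _)) -[LHS]qadjK qadjM qadjK ev qadj0.
    * by rewrite eqxx vv.
  + move=> j; rewrite sum' qmulDl.
    case: (unliftP ord_max j) => [j' ->|->]; last by rewrite vf /r subrK.
    by rewrite -qmulA vfl qmul0r add0r; exact: Kf.
  + move=> p Y Yf i.
    have Yl i' : Y *q e i' x = 0 by apply: Ye => j; exact: Yf.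
    case: unliftP => [i' _|_]; first exact: Yl.
    rewrite /v qmulZr /r qmulBr Yf sub0r /K qmul_suml qmul_sumr big1 ?oppr0 ?scaler0 //.
    by move=> i' _; rewrite !qmulA Yl !qmul0l.
- move=> x Dx [d dP].
  have D1x : D1 x.
    apply: dual1 => //; exists (fun i => d (lift ord_max i)) => i j.
    by rewrite dP (inj_eq lift_inj).
  (* Were the residual zero, [f ord_max x] would lie in the span of the earlier vectors, which the
     last dual vector annihilates, whereas it pairs with [f ord_max x] to one. *)
  split=> //; apply: qsq_gt0 => r0.
  have [oe Kf Ye] := He x D1x.
  have de i : (d ord_max)^*q *q e i x = 0.
    by apply: Ye => j; rewrite [LHS]dP (negPf (neq_lift _ _)).
  have : (d ord_max)^*q *q f ord_max x = 0.
    move: r0 => /subr0_eq ->; rewrite /K qmul_suml qmul_sumr big1 // => i _.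
    by rewrite !qmulA de !qmul0l.
  rewrite [_ *q _]dP eqxx qoneE => /(congr1 (@qre R 1)).
  rewrite qre1 qre0 => /eqP; apply/negP; exact: oner_neq0.
Qed.

End SmoothQuaternion.

Lemma linear_derive {R : realType} {X W W' : normedModType R} (L : W -> W')
    (f : X -> W) x v : linear L -> findim W -> differentiable f x ->
  'D_v (fun y => L (f y)) x = L ('D_v f x).
Proof.
move=> lL fW df.
pose LL : {linear W -> W'} := HB.pack L (GRing.isLinear.Build _ _ _ _ _ lL).
have cL : continuous LL by apply: findim_linear_continuous.
have dL y : differentiable LL y by apply: linear_differentiable.
have dc : differentiable (LL \o f) x by apply: differentiable_comp.
by rewrite -[LHS]/(derive (LL \o f) x v) !deriveE // (diff_comp df) // diff_lin.
Qed.

Lemma qmul_derive {R : realType} {X : normedModType R} m p q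
    (f : X -> qmx R m p) (g : X -> qmx R p q) x v :
  differentiable f x -> differentiable g x ->
  'D_v (fun y => f y *q g y) x = 'D_v f x *q g x + f x *q 'D_v g x.
Proof.
move=> df dg; have bq := @qmul_is_bilinear R m p q.
have cq := findim_bilinear_continuous bq (@findim_qmx R m p) (@findim_qmx R p q).
by have [_ ->] := bil_derive bq cq df dg.
Qed.

(** * Tangent spaces and local adapted frames *)

Section TangentSpace.
Context {R : realType} {n : nat}.
Local Notation V := (qmx R n.+2 n.+2).
Local Notation M := (Gr R n).

Lemma tspace_tangent (P X : V) : tspace M P X -> tangent P X.
Proof.
move=> [c [sc Mc c0 cX]].
have dc : differentiable c 0 by apply: smooth_on_differentiable sc _.
have cX' : 'D_1 c 0 = X by rewrite -cX derive1E.
have pc t : (c t)^*q = c t /\ c t *q c t = c t by case: (Gr_projector (Mc t)) => [[]].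
have cadj : (fun t => (c t)^*q) = c by apply/funext => t; case: (pc t).
have csq : (fun t => c t *q c t) = c by apply/funext => t; case: (pc t).
split.
  have := linear_derive (1 : R^o) (@qadj_is_linear R n.+2 n.+2) (@findim_qmx R n.+2 n.+2) dc.
  by rewrite cadj cX' => <-.
by have := qmul_derive (1 : R^o) dc dc; rewrite csq cX' c0 => <-.
Qed.

Lemma tangent_PXP (P X : V) : projector P -> tangent P X -> P *q X *q P = 0.
Proof.
move=> [hP PP] tX.
by rewrite -qmulA (tangent_rule tX) qmulBr qmulA PP subrr.
Qed.

(** X is the velocity at 0 of the planes spanned by the vectors w_a + t X w_a. *)
Lemma tangent_tspace (P X : V) : M P -> tangent P X -> tspace M P X.
Proof.
move=> MP tX; have [prP trP] := Gr_projector MP; have [w [wp ad]] := adapted_exists MP.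
have PXP := tangent_PXP prP tX.
have ow : qorthonormal w by case: ad.
have Pw a : P *q w a = w a by rewrite -(qcolsE w) qmulA (adapted_PW ad).
have wP a : (w a)^*q *q P = (w a)^*q by rewrite -[in RHS]Pw qadjM prP.1.
have PXw a : P *q X *q w a = 0 by rewrite -(Pw a) qmulA PXP qmul0l.
have oT : open [set: R^o] by exact: openT.
pose f (a : 'I_2) (t : R^o) := w a + t *: (X *q w a).
have sf a : smooth_on setT (f a).
  apply: smooth_onD => //; first exact: smooth_on_cst.
  by apply: smooth_onZ => //; [exact: smooth_on_id|exact: smooth_on_cst].
have [D' [e [oD' _ se He dual]]] := gram_schmidt oT sf.
(* Since w_i^* X w_j = 0, the initial basis stays dual to the moving one. Gram-Schmidt therefore
   never degenerates, and the curve exists for all t, as [mcurve] demands. *)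
have DT t : D' t.
  apply: dual => //; exists w => i j.
  rewrite /qherm /f qmulDr qmulZr -(wP i) -!qmulA (qmulA P X) PXw qmul0r scaler0 addr0.
  by rewrite Pw [LHS]ow.
have {}se i : smooth_on setT (e i) by apply: smooth_on_sub (se i).
pose c (t : R^o) : V := qplane (e ^~ t).
have Mc t : M (c t) by have [oe _ _] := He t (DT t); exists (e ^~ t).
have sc : smooth_on setT c.
  by apply: smooth_on_sum => // i; apply: smooth_on_qmul => //; apply: smooth_on_qadj.
have cf j t : c t *q f j t = f j t by have [_ + _] := He t (DT t); apply.
have f0 j : f j 0 = w j by rewrite /f scale0r addr0.
have c0 : c 0 = P.
  have [pr0 tr0] := Gr_projector (Mc 0).
  apply: projector_eq => //; last by rewrite tr0 trP.
  rewrite (adapted_PE ad) qcols_sum qmul_sumr; apply: eq_bigr => j _.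
  by rewrite qmulA -f0 cf.
have dc : differentiable c 0 by apply: smooth_on_differentiable sc _.
set Z := 'D_1 c 0.
have cZ : derive1 c 0 = Z by rewrite derive1E.
have tZ : tangent P Z by apply: tspace_tangent; exists c; split.
(* Obtained by differentiating c f_j = f_j at 0, where the term P X w_j vanishes. Knowing Z on W is
   enough, because Z is Hermitian and off-diagonal. *)
have Zw j : Z *q w j = X *q w j.
  have df : differentiable (f j) 0 by apply: smooth_on_differentiable (sf j) _.
  have f' : 'D_1 (f j) 0 = X *q w j.
    have bs := @scale_is_bilinear R (qmx R n.+2 1).
    have cs := findim_bilinear_continuous bs (@findim_R R) (@findim_qmx R n.+2 1).
    have dk : differentiable (cst (X *q w j) : R^o -> _) 0 by exact: differentiable_cst.
    have di : differentiable (id : R^o -> R^o) 0 by [].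
    have [d1 d2] := bil_derive bs cs di dk.
    have dw : differentiable (cst (w j) : R^o -> _) 0 by exact: differentiable_cst.
    rewrite -[LHS]/(derive (cst (w j) + (fun y : R^o => y *: cst (X *q w j) y)) 0 1).
    rewrite deriveD; [|exact: diff_derivable..].
    by rewrite d2 !derive_cst derive_id scale1r scale0r add0r addr0.
  have := qmul_derive (1 : R^o) dc df.
  have -> : (fun t => c t *q f j t) = f j by apply/funext => t; exact: cf.
  by rewrite f' c0 f0 qmulA PXw addr0 => ->.
have ZP : Z *q P = X *q P.
  rewrite (adapted_PE ad) !qcols_sum !qmul_sumr; apply: eq_bigr => j _.
  by rewrite !qmulA Zw.
have PZ : P *q Z = P *q X.
  have := congr1 (@qadj R n.+2 n.+2) ZP.
  by rewrite !qadjM; case: tZ => -> _; case: tX => -> _; case: prP => ->.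
have ZX : Z = X by case: tZ => _ <-; case: tX => _ <-; rewrite ZP PZ.
by exists c; split; [exact: sc|exact: Mc|exact: c0|rewrite cZ].
Qed.

Lemma tspaceP (P X : V) : M P -> (tspace M P X <-> tangent P X).
Proof. by move=> MP; split; [exact: tspace_tangent|exact: tangent_tspace]. Qed.

(** A frame adapted at P0 is projected by P and by 1 - P, then orthonormalized; at P0 it is its own
    dual family, so the process works nearby. The annihilator clause, with Y = 1 - P and Y = P,
    keeps the new vectors in W and in its complement. *)
Lemma local_frames (P0 : V) : M P0 -> exists (U : set V)
    (w : 'I_2 -> V -> qmx R n.+2 1) (wp : 'I_n -> V -> qmx R n.+2 1),
  [/\ open U, U P0 & adapted_local U w wp].
Proof.
move=> MP0; have [prP0 trP0] := Gr_projector MP0.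
have [w0 [wp0 ad]] := adapted_exists MP0.
have [ow _ owp wwp] := ad.
have Pw a : P0 *q w0 a = w0 a by rewrite -(qcolsE w0) qmulA (adapted_PW ad).
have Pwp l : P0 *q wp0 l = 0 by rewrite -(qcolsE wp0) qmulA (adapted_PWp ad) qmul0l.
have oT : open [set: V] by exact: openT.
have sid : smooth_on setT (id : V -> V) by exact: smooth_on_id.
have scst m p (A : qmx R m p) : smooth_on [set: V] (cst A) by exact: smooth_on_cst.
have sf a : smooth_on setT (fun P : V => P *q w0 a).
  by apply: smooth_on_qmul => //; exact: scst.
have sg l : smooth_on setT (fun P : V => (qid n.+2 - P) *q wp0 l).
  apply: smooth_on_qmul => //; last exact: scst.
  by apply: smooth_onB => //; exact: scst.
have [D1 [e [oD1 _ se He dual1]]] := gram_schmidt oT sf.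
have [D2 [e' [oD2 _ se' He' dual2]]] := gram_schmidt oT sg.
exists (D1 `&` D2), e, e'; split; first exact: openI.
  split; [apply: dual1|apply: dual2] => //.
    by exists w0 => i j; rewrite Pw ow.
  by exists wp0 => i j; rewrite qmulBl qmul1l Pwp subr0 owp.
split=> [a|l|P MP [D1P D2P]].
- by apply: (msmooth_of oD1) => // x _ [].
- by apply: (msmooth_of oD2) => // x _ [].
have [prP trP] := Gr_projector MP; have [hP PP] := prP.
have [oe Ke Ye] := He P D1P; have [oe' Ke' Ye'] := He' P D2P.
have Pe a : P *q e a P = e a P.
  apply/esym/subr0_eq; rewrite -[X in X - _]qmul1l -qmulBl; apply: Ye => j.
  by rewrite qmulA qmulBl qmul1l PP subrr qmul0l.
have Pe' l : P *q e' l P = 0.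
  by apply: Ye' => j; rewrite qmulA qmulBr qmul1r PP subrr qmul0l.
split=> //.
  have GK : M (qplane (e ^~ P)) by exists (e ^~ P).
  have [prK trK] := Gr_projector GK.
  apply: projector_eq => //; last by rewrite trP trK.
  by rewrite /qplane qmul_sumr; apply: eq_bigr => j _; rewrite qmulA Pe.
by move=> a l; rewrite /qherm -[e a P]Pe qadjM hP -qmulA Pe' qmul0r.
Qed.

End TangentSpace.

(** * The bundle E *)

Section MSmoothQuaternion.
Context {R : realType} {X : normedModType R} (M : set X).
Implicit Types U : set X.

Lemma msmooth_qmul m p q U (f : X -> qmx R m p) (g : X -> qmx R p q) :
  msmooth M U f -> msmooth M U g -> msmooth M U (fun x => f x *q g x).
Proof.
move=> sf sg; apply: msmooth_bil => //; [exact: qmul_is_bilinear|exact: findim_qmx..].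
Qed.

Lemma msmooth_qadj m p U (f : X -> qmx R m p) :
  msmooth M U f -> msmooth M U (fun x => (f x)^*q).
Proof.
move=> sf; apply: msmooth_linear => //; [exact: qadj_is_linear|exact: findim_qmx].
Qed.

Lemma msmooth_qre m U (f : X -> qmx R m m) :
  msmooth M U f -> msmooth M U (fun x => qre (f x)).
Proof.
move=> sf; apply: msmooth_linear => //; [exact: qre_is_linear|exact: findim_qmx].
Qed.

Lemma msmoothN {W : normedModType R} U (f : X -> W) :
  msmooth M U f -> msmooth M U (fun x => - f x).
Proof.
move=> sf; have := msmoothZ (@msmooth_cst R X M R^o U (- 1)) sf.
by apply: msmooth_eq => x _ _; rewrite scaleN1r.
Qed.

Lemma msmoothB {W : normedModType R} U (f g : X -> W) :
  msmooth M U f -> msmooth M U g -> msmooth M U (fun x => f x - g x).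
Proof. by move=> sf sg; apply: msmoothD => //; apply: msmoothN. Qed.

End MSmoothQuaternion.

Section Bundle.
Context {R : realType} {n : nat}.
Local Notation N := n.+2.
Local Notation V := (qmx R n.+2 n.+2).
Local Notation M := (Gr R n).
Implicit Types (P X Z S : V) (A : V -> V).

Definition Eact P S : V -> V := patch (fun=> 0) (tspace M P) (act S).

Lemma EactE P S X : tspace M P X -> Eact P S X = act S X.
Proof. by move=> TX; rewrite /Eact patchT //; apply/mem_set. Qed.

Lemma Eact_out P S X : ~ tspace M P X -> Eact P S X = 0.
Proof. by move=> TX; rewrite /Eact patchN //; apply/negP => /set_mem. Qed.

Lemma Eact_linear P a S T : Eact P (a *: S + T) = a *: Eact P S + Eact P T.
Proof.
apply/funext => X; rewrite !fctE; have [TX|nTX] := pselect (tspace M P X).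
  by rewrite !EactE // (act_is_bilinear.1 X).
by rewrite !Eact_out // scaler0 addr0.
Qed.

Lemma Eact0 P : Eact P 0 = 0.
Proof.
apply/funext => X; have [TX|nTX] := pselect (tspace M P X).
  by rewrite EactE // (bil0l act_is_bilinear).
by rewrite Eact_out.
Qed.

Lemma Eact_sum P I (r : seq I) (a : I -> R) (F : I -> V) :
  Eact P (\sum_(i <- r) a i *: F i) = \sum_(i <- r) a i *: Eact P (F i).
Proof.
elim: r => [|i r IH]; first by rewrite !big_nil Eact0.
by rewrite !big_cons Eact_linear IH.
Qed.

Definition EB P : set (V -> V) := [set A | exists2 S, symT P S & A = Eact P S].

(** An off-diagonal block of a constant matrix together with its adjoint. These global tangent
    fields are the probes that recover S from its operator, and later the fields on which curvature
    is tested. *)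
Definition Xfield Z P : V := (qid N - P) *q Z *q P + P *q Z^*q *q (qid N - P).

Lemma Xfield_tangent Z P : projector P -> tangent P (Xfield Z P).
Proof.
move=> [hP PP]; split.
  rewrite /Xfield qadjD !qadjM qadjB qadj1 hP qadjK addrC.
  by congr (_ + _); rewrite qmulA.
rewrite /Xfield; qdistr.
by rewrite ?(PP, qmul_rule PP); qabel.
Qed.

Lemma Xfield_msmooth Z (U : set V) : msmooth M U (Xfield Z).
Proof.
have sP : msmooth M U (id : V -> V) by exact: msmooth_id.
have sQ : msmooth M U (fun P => qid N - P).
  by apply: msmoothB => //; exact: msmooth_cst.
apply: msmoothD; apply: msmooth_qmul => //; apply: msmooth_qmul => //;
  exact: msmooth_cst.
Qed.

Lemma Xfield_vfield Z (U : set V) : vfield M U (Xfield Z).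
Proof.
split; first exact: Xfield_msmooth.
move=> P MP _; apply/tspaceP => //; apply: Xfield_tangent.
by case: (Gr_projector MP).
Qed.

Definition Eunit (p q : 'I_N) : V := qe p *q (qe q)^*q.

(* A left inverse of [Eact P], linear in the endomorphism and polynomial in P: for
   A = Eact P S the summand is E_qp (1 - P) E_pq S, and these add up to
   tr (1 - P) S = n S. *)
Definition Sof P A : V := n%:R^-1 *:
  \sum_p \sum_q Eunit q p *q (qid N - P) *q A (Xfield (Eunit p q) P).

Lemma Sof_linear P a A B : Sof P (a *: A + B) = a *: Sof P A + Sof P B.
Proof.
rewrite /Sof scalerA mulrC -scalerA -scalerDr; congr (_ *: _).
rewrite scaler_sumr -big_split; apply: eq_bigr => p _ /=.
rewrite scaler_sumr -big_split; apply: eq_bigr => q _ /=.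
by rewrite !fctE qmulDr qmulZr.
Qed.

Lemma Sof_Eact P S : (0 < n)%N -> M P -> symT P S -> Sof P (Eact P S) = S.
Proof.
move=> n0 MP sS; have [prP trP] := Gr_projector MP; have [hP PP] := prP.
have [hS PS _] := sS; have SP := symT_rule prP sS.
have E p q : Eunit q p *q (qid N - P) *q Eact P S (Xfield (Eunit p q) P) =
    qre ((qid N - P) *q (qe p *q (qe p)^*q)) *: (qe q *q (qe q)^*q *q S).
  have tX : tangent P (Xfield (Eunit p q) P) by exact: Xfield_tangent.
  rewrite EactE; last by apply/tspaceP.
  (* The factor 1 - P kills S X and, as S lives on W, reduces X S to the block (1 - P) E_pq S. *)
  have -> : Eunit q p *q (qid N - P) *q act S (Xfield (Eunit p q) P) =
      Eunit q p *q (qid N - P) *q Eunit p q *q S.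
    rewrite /act /Xfield; move: (Eunit p q) => Z; move: (Eunit q p) => Z'; qdistr.
    rewrite ?(PP, qmul_rule PP, PS, qmul_rule PS, SP, qmul_rule SP).
    by qabel.
  rewrite /Eunit.
  have -> : qe q *q (qe p)^*q *q (qid N - P) *q (qe p *q (qe q)^*q) *q S =
     qe q *q ((qe p)^*q *q (qid N - P) *q qe p) *q (qe q)^*q *q S.
    by rewrite !qmulA.
  (* A diagonal entry of a Hermitian matrix is real, so it leaves the word as a scalar; summed over
     p these entries give tr (1 - P) = n. *)
  rewrite (@qherm_real R ((qe p)^*q *q (qid N - P) *q qe p)); last first.
    by rewrite !qadjM qadjK qadjB qadj1 hP !qmulA.
  rewrite qmulZr !qmulZl qoneE qmul1r; congr (_ *: _).
  by rewrite -qmulA qre_mulC -qmulA.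
rewrite /Sof; under eq_bigr => p _ do under eq_bigr => q _ do rewrite E.
under eq_bigr => p _ do rewrite -scaler_sumr -qmul_suml qe_sum qmul1l.
rewrite -scaler_suml -qre_sum -qmul_sumr qe_sum qmul1r qreB qre1 trP.
rewrite scalerA -[RHS]scale1r; congr (_ *: _).
rewrite -natrB // subn2 /= mulVf // pnatr_eq0; by case: n n0.
Qed.

Lemma EB_Sof P A : (0 < n)%N -> M P -> EB P A ->
  symT P (Sof P A) /\ A = Eact P (Sof P A).
Proof. by move=> n0 MP [S sS ->]; rewrite Sof_Eact. Qed.

Lemma Eact_endT P S : M P -> symT P S -> endT M P (Eact P S).
Proof.
move=> MP sS; have prP := (Gr_projector MP).1; split.
- by move=> X; exact: Eact_out.
- move=> X TX; rewrite EactE //; apply/tspaceP => //; apply: act_tangent => //.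
  exact/tspaceP.
- move=> a X Y TX TY; rewrite !EactE // ?(act_is_bilinear.2 S) //.
  by apply/tspaceP => //; apply: tangent_lin; exact/tspaceP.
Qed.

Lemma sym_esec (U : set V) (S : V -> V) : msmooth M U S ->
  (forall P, M P -> U P -> symT P (S P)) ->
  esec M EB U (fun P => Eact P (S P)).
Proof.
move=> sS symS; split; last by move=> P MP UP; exists (S P) => //; exact: symS.
split=> [P MP UP|Y [sY TY]]; first by apply: Eact_endT => //; exact: symS.
apply: (@msmooth_eq _ _ _ _ _ (fun P => act (S P) (Y P))).
  by move=> P MP UP; rewrite EactE //; exact: TY.
by apply: msmoothD; apply: msmooth_qmul.
Qed.

(** [Sof] evaluates s only on the smooth fields [Xfield], which is exactly what [endsec]
    controls. *)
Lemma Sof_msmooth (U : set V) (s : V -> (V -> V)) :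
  endsec M U s -> msmooth M U (fun P => Sof P (s P)).
Proof.
move=> [_ ss]; apply: msmoothZ; first exact: msmooth_cst.
apply: msmooth_sum => p; apply: msmooth_sum => q; apply: msmooth_qmul.
  apply: msmooth_qmul; first exact: msmooth_cst.
  by apply: msmoothB; [exact: msmooth_cst|exact: msmooth_id].
by apply: ss; exact: Xfield_vfield.
Qed.

Lemma esec_sym (U : set V) (s : V -> (V -> V)) : (0 < n)%N ->
  esec M EB U s -> [/\ msmooth M U (fun P => Sof P (s P)),
    forall P, M P -> U P -> symT P (Sof P (s P)) &
    forall P, M P -> U P -> s P = Eact P (Sof P (s P))].
Proof.
move=> n0 [es Es]; split; first exact: Sof_msmooth.
  by move=> P MP UP; have [] := EB_Sof n0 MP (Es P MP UP).
by move=> P MP UP; have [] := EB_Sof n0 MP (Es P MP UP).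
Qed.

(** The five basic S square to P, of trace 2; the factor 1/2 makes the C_4 involutions
    orthonormal. *)
Definition hB P (A B : V -> V) : R^o := 2^-1 * qre (Sof P A *q Sof P B).

Lemma idTE P X : tspace M P X -> idT M P X = X.
Proof. by move=> TX; rewrite /idT patchT //; apply/mem_set. Qed.

Lemma idT_out P X : ~ tspace M P X -> idT M P X = 0.
Proof. by move=> TX; rewrite /idT patchN //; apply/negP => /set_mem. Qed.

Lemma symT_polar P S T : M P -> symT P S -> symT P T ->
  S *q T + T *q S = qre (S *q T) *: P.
Proof.
move=> MP sS sT; have [w [wp ad]] := adapted_exists MP.
have [a ->] := symT_symF ad sS; have [b ->] := symT_symF ad sT.
by rewrite (symF_polar ad) (qre_symF2 ad).
Qed.

Lemma tspace_lin P a X Y : M P -> tspace M P X -> tspace M P Y ->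
  tspace M P (a *: X + Y).
Proof.
move=> MP /(tspaceP _ MP) tX /(tspaceP _ MP) tY; apply/tspaceP => //.
exact: tangent_lin.
Qed.

Lemma tspace0 P : M P -> tspace M P 0.
Proof. by move=> MP; apply/tspaceP => //; apply: tangent0. Qed.

(** By [act_act] the sum sends X to X (S T + T S) + (S T + T S) X. The bracket is a multiple of P,
    and X P + P X = X. *)
Lemma Eact_polar P S T : M P -> symT P S -> symT P T ->
  (Eact P S \o Eact P T) + (Eact P T \o Eact P S) = qre (S *q T) *: idT M P.
Proof.
move=> MP sS sT; have prP := (Gr_projector MP).1.
apply/funext => X.
rewrite -[LHS]/(Eact P S (Eact P T X) + Eact P T (Eact P S X)).
rewrite -[RHS]/(qre (S *q T) *: idT M P X).
have [TX|nTX] := pselect (tspace M P X); last first.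
  have T0 := tspace0 MP.
  rewrite !(Eact_out _ nTX) (idT_out nTX).
  by rewrite !EactE // !(bil0r act_is_bilinear) addr0 scaler0.
have tX : tangent P X by apply/tspaceP.
have [_ tS _] := Eact_endT MP sS; have [_ tT _] := Eact_endT MP sT.
rewrite (EactE S (tT _ TX)) (EactE T (tS _ TX)) !EactE // idTE //.
rewrite (act_act prP sS sT tX) (act_act prP sT sS tX).
have -> : X *q T *q S + S *q T *q X + (X *q S *q T + T *q S *q X) =
   X *q (S *q T + T *q S) + (S *q T + T *q S) *q X by qdistr; qabel.
rewrite [_ + _]addrC (symT_polar MP sS sT) qmulZr qmulZl -scalerDr addrC.
by case: tX => _ ->.
Qed.

Lemma Eact_selfadj P S : M P -> symT P S -> selfadjT M (gGr R n) P (Eact P S).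
Proof.
move=> MP sS X Y TX TY; rewrite !EactE //.
exact: (act_selfadj S X Y).
Qed.

Section LocalFrame.
Variables (w : 'I_2 -> qmx R n.+2 1) (wp : 'I_n -> qmx R n.+2 1) (P : V).
Hypothesis ad : adapted P w wp.

Lemma sigmaE k : sigma w wp P k = Eact P (symF w (dlt k)).
Proof.
apply/funext => X; have [TX|nTX] := pselect (tspace M P X).
  rewrite EactE // /sigma patchT; last exact/mem_set.
  apply: (of_coords_act ad k); apply/tspaceP => //; exact: adapted_Gr ad.
by rewrite Eact_out // /sigma patchN //; apply/negP => /set_mem.
Qed.

Lemma EB_basis : (0 < n)%N -> basis_for (EB P) (fun k => sigma w wp P k).
Proof.
move=> n0; have MP := adapted_Gr ad.
have symE a : \sum_k a k *: sigma w wp P k = Eact P (symF w a).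
  rewrite (symF_sum w a) Eact_sum; apply: eq_bigr => k _; by rewrite sigmaE.
split.
  apply/seteqP; split=> [A [S sS ->]|A [a ->]].
    by have [a ->] := symT_symF ad sS; exists a; rewrite symE.
  by rewrite symE; exists (symF w a) => //; apply: (symF_symT ad).
(* Independence: [Sof] turns the vanishing operator into [symF w a = 0], whose trace pairing with
   the i-th generator is twice [a i]. *)
move=> a; rewrite symE => E i.
have sa := symF_symT ad a.
have : symF w a = 0.
  rewrite -(Sof_Eact n0 MP sa) E.
  by have := Sof_linear P (- 1) 0 0; rewrite scaler0 addr0 scaleN1r addNr.
move=> a0; have := qre_symF2 ad a (dlt i).
rewrite a0 qmul0l qre0 (bigD1 i) //= /dlt eqxx mulr1 big1 ?addr0.
  by move/eqP; rewrite eq_sym mulf_eq0 pnatr_eq0 /= => /eqP.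
by move=> j /negPf ji; rewrite eq_sym ji mulr0.
Qed.

Lemma sigma_hB k j : (0 < n)%N ->
  hB P (sigma w wp P k) (sigma w wp P j) = (k == j)%:R.
Proof.
move=> n0; have MP := adapted_Gr ad.
rewrite /hB !sigmaE !Sof_Eact //; [|exact: (symF_symT ad)..].
rewrite (qre_symF2 ad) mulrA mulVf ?mul1r ?pnatr_eq0 //.
rewrite (bigD1 k) //= /dlt eqxx mul1r big1 ?addr0 1?eq_sym //.
by move=> i /negPf ik; rewrite eq_sym ik mul0r.
Qed.

End LocalFrame.
End Bundle.

(** * The volume element *)

Section Volume.
Context {R : realType} {m : nat}.
Local Notation T := (qmx R m m).

(** These structures allow a noncommutative product of sums to be expanded by [bigA_distr_bigA]. *)
HB.instance Definition _ := Monoid.isLaw.Build T (@qid R m) (@qmul R m m m)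
  (@qmulA R m m m m) (@qmul1l R m m) (@qmul1r R m m).
HB.instance Definition _ := Monoid.isMulLaw.Build T 0 (@qmul R m m m)
  (@qmul0l R m m m) (@qmul0r R m m m).
(* A copy of the addition: [+%R] itself already has a canonical [Monoid.add_law]
   structure, for another product. *)
Definition qadd (x y : T) : T := x + y.
HB.instance Definition _ := Monoid.isComLaw.Build T 0 qadd
  (@addrA T) (@addrC T) (@add0r T).
HB.instance Definition _ := Monoid.isAddLaw.Build T (@qmul R m m m) qadd
  (@qmulDl R m m m) (@qmulDr R m m m).

Definition qprod (g : 'I_5 -> T) : T := \big[@qmul R m m m/qid m]_i g i.

Lemma qprodE g : qprod g = g o0 *q g o1 *q g o2 *q g o3 *q g o4.
Proof.
rewrite /qprod !big_ord_recl big_ord0 qmul1r !qmulA.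
by congr (g _ *q g _ *q g _ *q g _ *q g _); apply: val_inj.
Qed.

Definition anticommuting (g : 'I_5 -> T) : Prop :=
  forall i j, i != j -> g i *q g j = - (g j *q g i).

(** Exchanging two letters at distance d takes 2 d - 1 exchanges of neighbours, an odd number. *)
Lemma anticommuting_tperm g x y : anticommuting g -> x != y ->
  qprod (g \o tperm x y) = - qprod g.
Proof.
move=> ag; wlog lt : x y / (x < y)%N => [H|] xy.
  have [lt|] := ltnP x y; first exact: H.
  rewrite leq_eqVlt => /orP[/eqP E|lt]; last by rewrite tpermC; apply: H; rewrite // eq_sym.
  by move: xy; rewrite eq_sym => /eqP; case; apply: val_inj.
rewrite !qprodE /=.
have [e10 e20 e30 e40] : [/\ g o1 *q g o0 = - (g o0 *q g o1),
  g o2 *q g o0 = - (g o0 *q g o2), g o3 *q g o0 = - (g o0 *q g o3) &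
  g o4 *q g o0 = - (g o0 *q g o4)] by split; exact: ag.
have [e21 e31 e41] : [/\ g o2 *q g o1 = - (g o1 *q g o2),
  g o3 *q g o1 = - (g o1 *q g o3) & g o4 *q g o1 = - (g o1 *q g o4)] by split; exact: ag.
have [e32 e42 e43] : [/\ g o3 *q g o2 = - (g o2 *q g o3),
  g o4 *q g o2 = - (g o2 *q g o4) & g o4 *q g o3 = - (g o3 *q g o4)] by split; exact: ag.
(* Each exchange is restated after an arbitrary prefix, so that rewriting can sort the letters of a
   left-associated word. *)
have r (a b c : T) : a *q b = - (b *q a) -> c *q a *q b = - (c *q b *q a).
  by move=> E; rewrite -qmulA E qmulNr qmulA.
have [[[f10 f20] f30] f40] := (fun c => r _ _ c e10, fun c => r _ _ c e20,
  fun c => r _ _ c e30, fun c => r _ _ c e40).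
have [[f21 f31] f41] := (fun c => r _ _ c e21, fun c => r _ _ c e31, fun c => r _ _ c e41).
have [[f32 f42] f43] := (fun c => r _ _ c e32, fun c => r _ _ c e42, fun c => r _ _ c e43).
have tE (a b c : 'I_5) : tperm a b c = if c == a then b else if c == b then a else c.
  by case: tpermP => [->|->|/eqP/negPf -> /eqP/negPf ->]; rewrite ?eqxx //; case: eqP.
rewrite !tE.
have [|[|[|[|]]]] := ord5P x => Ex; subst x;
have [|[|[|[|]]]] := ord5P y => Ey; subst y => //=;
by rewrite ?(e10, e20, e30, e40, e21, e31, e41, e32, e42, e43,
  f10, f20, f30, f40, f21, f31, f41, f32, f42, f43, qmulNl, opprK).
Qed.

Lemma anticommuting_perm g (s : 'S_5) : anticommuting g ->
  qprod (g \o s) = (-1) ^+ s *: qprod g.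
Proof.
have [ts -> _] := prod_tpermP s; elim: ts g {s} => [|[x y] ts IH] g ag.
  rewrite big_nil odd_perm1 expr0 scale1r; congr qprod.
  by apply/funext => i /=; rewrite perm1.
rewrite big_cons /= odd_mul_tperm; set t := (\prod_(_ <- _) _)%g in IH *.
have ->  : g \o (tperm x y * t)%g = (g \o t) \o tperm x y.
  by apply/funext => i /=; rewrite permM.
have agt : anticommuting (g \o t) by move=> i j ij; apply: ag; rewrite (inj_eq perm_inj).
have [<-|xy] := eqVneq x y.
  by rewrite tperm1 -IH //; congr qprod; apply/funext => i /=; rewrite perm1.
by rewrite anticommuting_tperm // IH // addTb signrN scaleNr.
Qed.

Lemma qprodZ (c : 'I_5 -> R) g :
  qprod (fun i => c i *: g i) = (\prod_i c i) *: qprod g.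
Proof.
rewrite /qprod; elim: (index_enum _) => [|i r IH]; first by rewrite !big_nil scale1r.
by rewrite !big_cons IH qmulZl qmulZr scalerA.
Qed.

(* Antisymmetrizing the product of an anticommuting family changes it by the
   factor 5!, and makes it alternating in the family. *)
Lemma qprod_det g (A : 'M[R]_5) : anticommuting g ->
  anticommuting (fun i => \sum_j A i j *: g j) ->
  qprod (fun i => \sum_j A i j *: g j) = \det A *: qprod g.
Proof.
move=> ag agA; set f := fun i => _ in agA *.
have n0 : (#|{: 'S_5}|%:R : R) != 0 by rewrite card_Sn pnatr_eq0.
apply: (scalerI n0).
(* Permuting an anticommuting family yields the sign once more, so all 5! summands equal
   [qprod f]. *)
have -> : #|{: 'S_5}|%:R *: qprod f = \sum_(s : 'S_5) (-1) ^+ s *: qprod (f \o s).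
  under eq_bigr => s _ do rewrite anticommuting_perm // scalerA -signr_addb addbb scale1r.
  by rewrite sumr_const scaler_nat.
have -> : \sum_(s : 'S_5) (-1) ^+ s *: qprod (f \o s) =
    \sum_(s : 'S_5) \sum_(F : {ffun 'I_5 -> 'I_5})
      ((-1) ^+ s * \prod_i A (s i) (F i)) *: qprod (g \o F).
  apply: eq_bigr => s _.
  have -> : qprod (f \o s) = \sum_(F : {ffun 'I_5 -> 'I_5})
      (\prod_i A (s i) (F i)) *: qprod (g \o F).
    have E := @bigA_distr_bigA T 0 (qid m) (@qmul R m m m : Monoid.mul_law 0)
      (qadd : Monoid.add_law 0 (@qmul R m m m)) _ _
      (fun i j : 'I_5 => A (s i) j *: g j).
    by apply: etrans E _; apply: eq_bigr => F _; rewrite -qprodZ.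
  by rewrite scaler_sumr; apply: eq_bigr => F _; rewrite scalerA.
rewrite exchange_big /=.
have detE (F : {ffun 'I_5 -> 'I_5}) :
    \sum_(s : 'S_5) ((-1) ^+ s * \prod_i A (s i) (F i)) *: qprod (g \o F)
    = \det (\matrix_(i, j) A j (F i)) *: qprod (g \o F).
  rewrite -scaler_suml; congr (_ *: _); apply: eq_bigr => s _; congr (_ * _).
  by apply: eq_bigr => i _; rewrite mxE.
under eq_bigr => F _ do rewrite detE.
(* A non-injective F gives a determinant with two equal rows; only permutations survive. *)
rewrite (bigID (fun F : {ffun 'I_5 -> 'I_5} => injectiveb F)) /= addrC big1 ?add0r.
  rewrite (reindex (@pval _)) /=; last first.
    pose in_Sn := insubd (1%g : 'S_5).
    by exists in_Sn => /= F UF; first apply: val_inj; apply: insubdK.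
  rewrite (eq_bigl xpredT) => [|s]; last exact: (valP s).
  (* The sign from permuting the rows cancels the sign from permuting g, so each permutation
     contributes the same term. *)
  rewrite (eq_bigr (fun=> \det A *: qprod g)) ?sumr_const ?scaler_nat //.
  move=> s _.
  have -> : g \o pval s = g \o s by apply/funext => i; rewrite /= pvalE.
  rewrite anticommuting_perm // scalerA; congr (_ *: _).
  have -> : \matrix_(i, j) A j (pval s i) = row_perm s A^T.
    by apply/matrixP => i j; rewrite !mxE pvalE.
  by rewrite row_permE det_mulmx det_perm det_tr mulrAC -signr_addb addbb mul1r.
move=> F /injectivePn[i1 [i2 Di12 Ef12]].
rewrite (determinant_alternate Di12) ?scale0r //= => j; by rewrite !mxE Ef12.
Qed.

End Volume.

Section CliffordVolume.
Context {R : realType}.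

Lemma s2_anticommuting (A : 'M[R]_5) : A *m A^T = 1%:M ->
  anticommuting (fun i => s2 (A i)).
Proof.
move=> AA i j ij; apply/eqP; rewrite -addr_eq0 s2_polar.
have := congr1 (fun B : 'M[R]_5 => B i j) AA; rewrite !mxE (negPf ij) => E.
rewrite (eq_bigr (fun k => A i k * A^T k j)); last by move=> k _; rewrite mxE.
by rewrite E mulr0 scale0r.
Qed.

Lemma s2_det (A : 'M[R]_5) : A *m A^T = 1%:M ->
  qprod (fun i => s2 (A i)) = - \det A *: qid 2.
Proof.
move=> AA; have E : (fun i => s2 (A i)) = (fun i => \sum_j A i j *: s2 (dlt j)).
  by apply/funext => i; rewrite -s2_sum.
have s1 : (fun i => s2 ((1%:M : 'M[R]_5) i)) = (fun i => s2 (dlt i)).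
  by apply/funext => i; congr s2; apply/funext => j; rewrite mxE.
rewrite E qprod_det -?E.
- by rewrite qprodE s2_volume scalerN scaleNr.
- by rewrite -s1; apply: s2_anticommuting; rewrite trmx1 mulmx1.
- exact: s2_anticommuting.
Qed.

End CliffordVolume.

(** * The Clifford morphism *)

Section CliffordMorphism.
Context {R : realType} {n : nat}.
Local Notation N := n.+2.
Local Notation V := (qmx R n.+2 n.+2).
Local Notation M := (Gr R n).
Implicit Types (P X Y : V) (A B : V -> V) (w : seq (V -> V)) (s t : seq (R * seq (V -> V))).
Hypothesis n0 : (0 < n)%N.

Definition wcomp P w : V -> V := foldr (fun A B => A \o B) (idT M P) w.

(** Words of every length are composed, so this is the representation of the full Clifford algebra
    in which E acts by its own operators; the even morphism is its restriction. *)
Definition phi P s : V -> V := \sum_(p <- s) p.1 *: wcomp P p.2.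

Lemma endT_tspace P A X : M P -> endT M P A -> tspace M P (A X).
Proof.
move=> MP [A0 AT _]; have [TX|nTX] := pselect (tspace M P X); first exact: AT.
by rewrite A0 //; apply: tspace0.
Qed.

Lemma endT0 P A : M P -> endT M P A -> A 0 = 0.
Proof.
move=> MP [_ _ Al]; have T0 := tspace0 MP.
by have := Al (- 1) 0 0 T0 T0; rewrite scaler0 addr0 scaleN1r addNr.
Qed.

Lemma idT_endT P : M P -> endT M P (idT M P).
Proof.
move=> MP; split=> [X nTX|X TX|a X Y TX TY]; first exact: idT_out.
  by rewrite idTE.
by rewrite !idTE //; apply: tspace_lin.
Qed.

Lemma endT_comp P A B : M P -> endT M P A -> endT M P B -> endT M P (A \o B).
Proof.
move=> MP eA eB; split=> [X nTX|X TX|a X Y TX TY] /=.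
- by case: eB => -> // _ _; exact: endT0 eA.
- exact: endT_tspace.
- by case: (eB) => _ BT Bl; rewrite Bl //; case: eA => _ _ -> //; exact: BT.
Qed.

Lemma endT_linear P a A B : M P -> endT M P A -> endT M P B -> endT M P (a *: A + B).
Proof.
move=> MP eA eB; split=> [X nTX|X TX|c X Y TX TY]; rewrite !fctE.
- by case: eA => -> // _ _; case: eB => -> // _ _; rewrite scaler0 addr0.
- by apply: tspace_lin => //; exact: endT_tspace.
- case: eA => _ _ -> //; case: eB => _ _ -> //.
  by rewrite !scalerDr !scalerA (mulrC a) addrACA.
Qed.

Lemma zero_endT P : M P -> endT M P 0.
Proof.
move=> MP; split=> [//|X _|a X Y _ _]; first exact: tspace0.
by rewrite -[RHS]/(a *: (0 : V) + 0) scaler0 addr0.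
Qed.

Lemma EB_endT P A : M P -> EB P A -> endT M P A.
Proof. by move=> MP [S sS ->]; apply: Eact_endT. Qed.

Lemma wcomp_endT P w : M P -> word_in (EB P) w -> endT M P (wcomp P w).
Proof.
move=> MP; elim: w => [|A w IH] Ew /=; first exact: idT_endT.
apply: endT_comp => //; first by apply: EB_endT => //; apply: Ew; rewrite mem_head.
by apply: IH => B Bw; apply: Ew; rewrite in_cons Bw orbT.
Qed.

Lemma idT_comp P A : M P -> endT M P A -> idT M P \o A = A.
Proof. by move=> MP eA; apply/funext => X /=; rewrite idTE //; exact: endT_tspace. Qed.

Lemma word_in_cons (F : set (V -> V)) A w : word_in F (A :: w) <-> F A /\ word_in F w.
Proof.
split=> [H|[H H'] B].
  by split=> [|B Bw]; apply: H; rewrite ?mem_head // in_cons Bw orbT.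
by rewrite in_cons => /orP[/eqP->|/H'].
Qed.

Lemma wcomp_cat P w w' : M P -> word_in (EB P) w' ->
  wcomp P (w ++ w') = wcomp P w \o wcomp P w'.
Proof.
move=> MP Ew'; elim: w => [|A w IH] /=; last by rewrite IH.
by rewrite idT_comp //; apply: wcomp_endT.
Qed.

Lemma phi_cat P s t : phi P (s ++ t) = phi P s + phi P t.
Proof. by rewrite /phi big_cat. Qed.

Lemma phi1 P a w : phi P [:: (a, w)] = a *: wcomp P w.
Proof. by rewrite /phi big_seq1. Qed.

Lemma phi2 P a w b w' :
  phi P [:: (a, w); (b, w')] = a *: wcomp P w + b *: wcomp P w'.
Proof. by rewrite /phi big_cons big_seq1. Qed.

Lemma phi_endT P s : M P -> cl_in (EB P) s -> endT M P (phi P s).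
Proof.
move=> MP; elim: s => [|p s IH] Es; first by rewrite /phi big_nil; apply: zero_endT.
rewrite /phi big_cons; apply: endT_linear => //.
  by apply: wcomp_endT => //; apply: Es; rewrite mem_head.
by apply: IH => q qs; apply: Es; rewrite in_cons qs orbT.
Qed.

Lemma EB_linear P a A B : EB P A -> EB P B -> EB P (a *: A + B).
Proof.
move=> [S sS ->] [T sT ->]; exists (a *: S + T); first exact: symT_lin.
by rewrite Eact_linear.
Qed.

Lemma EB_polar P A B : M P -> EB P A -> EB P B ->
  (A \o B) + (B \o A) = (2 * hB P A B) *: idT M P.
Proof.
move=> MP [S sS ->] [T sT ->]; rewrite Eact_polar // /hB !Sof_Eact //.
by rewrite mulrA mulfV ?mul1r // pnatr_eq0.
Qed.

Lemma EB_sq P A : M P -> EB P A -> A \o A = hB P A A *: idT M P.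
Proof.
move=> MP EA; have := EB_polar MP EA EA.
move=> /(congr1 (fun B : V -> V => (2^-1 : R) *: B)) /=.
rewrite scalerA mulrA mulVf ?mul1r ?pnatr_eq0 // => <-.
rewrite scalerDr -scalerDl -[LHS]scale1r; congr (_ *: _); lra.
Qed.

(** Only two generating relations involve geometry: [cl_sq], which is [EB_sq], and [cl_lin]. Both
    need the inner word to produce a tangent vector, since operators are linear on the tangent space
    only. *)
Lemma phi_cl_eq P s t : M P -> cl_eq (EB P) (hB P) s t -> phi P s = phi P t.
Proof.
move=> MP; elim=> {s t} //=.
- by move=> s t u _ -> _ ->.
- by move=> s s' t t' _ E _ E'; rewrite !phi_cat E E'.
- by move=> s t _ _; rewrite !phi_cat addrC.
- by move=> w _; rewrite phi1 scale0r /phi big_nil.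
- by move=> a b w _; rewrite phi1 phi2 scalerDl.
- move=> c a A B w w' EA EB' Ew Ew'.
  rewrite phi1 phi2 -scalerA -scalerDr; congr (_ *: _).
  have ec C : EB P C -> word_in (EB P) (C :: w') by move=> EC; apply/word_in_cons.
  rewrite !wcomp_cat //; try by apply: ec.
    apply/funext => X; rewrite !fctE /=.
    have ew' := wcomp_endT MP Ew'; have [_ _ wl] := wcomp_endT MP Ew.
    have TX : tspace M P (wcomp P w' X) by exact: endT_tspace.
    by rewrite wl //; apply: endT_tspace => //; exact: EB_endT.
  by apply: ec; apply: EB_linear.
- move=> c A w w' EA Ew Ew'.
  rewrite !phi1 -scalerA; congr (_ *: _).
  have EAA : word_in (EB P) (A :: A :: w') by do 2 (apply/word_in_cons; split => //).
  rewrite !wcomp_cat //=.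
  have ew' := wcomp_endT MP Ew'; have [_ _ wl] := wcomp_endT MP Ew.
  apply/funext => X; rewrite !fctE /=.
  have TX : tspace M P (wcomp P w' X) by exact: endT_tspace.
  have -> : A (A (wcomp P w' X)) = hB P A A *: wcomp P w' X.
    rewrite -[LHS]/((A \o A) (wcomp P w' X)) (EB_sq MP EA).
    by rewrite -[LHS]/(hB P A A *: idT M P (wcomp P w' X)) idTE.
  by have := wl (hB P A A) _ _ TX (tspace0 MP); rewrite (endT0 MP (wcomp_endT MP Ew)) !addr0.
Qed.

Lemma endT_sum P I (r : seq I) (a : I -> R) (F : I -> V -> V) A : M P -> endT M P A ->
  (forall i X, tspace M P (F i X)) ->
  A \o (\sum_(i <- r) a i *: F i) = \sum_(i <- r) a i *: (A \o F i).
Proof.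
move=> MP eA FT; apply/funext => X.
have E (G : I -> V -> V) (r' : seq I) :
    (\sum_(i <- r') a i *: G i) X = \sum_(i <- r') a i *: G i X.
  by elim: r' => [|i r' IH]; rewrite ?big_nil // !big_cons !fctE -IH.
rewrite E /= E; elim: r => [|i r IH]; first by rewrite !big_nil; exact: endT0 eA.
rewrite !big_cons -IH; case: eA => _ _ -> //.
elim: r {IH} => [|j r IH]; rewrite ?big_nil ?big_cons; first exact: tspace0.
exact: tspace_lin.
Qed.

Lemma phi_mul P s t : M P -> cl_in (EB P) s -> cl_in (EB P) t ->
  phi P (cl_mul s t) = phi P s \o phi P t.
Proof.
move=> MP Es Et; rewrite /phi /cl_mul big_allpairs_dep /=.
have -> : (\sum_(p <- s) p.1 *: wcomp P p.2) \o (\sum_(q <- t) q.1 *: wcomp P q.2) =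
    \sum_(p <- s) p.1 *: (wcomp P p.2 \o (\sum_(q <- t) q.1 *: wcomp P q.2)).
  elim: s {Es} => [|p s IH]; first by rewrite !big_nil.
  by rewrite !big_cons -IH.
rewrite [LHS]big_seq [RHS]big_seq; apply: eq_bigr => p ps.
(* Words outside t are replaced by 0, so that the tangency required by [endT_sum] holds for every
   index. *)
pose G (q : R * seq (V -> V)) := if q \in t then wcomp P q.2 else 0.
have GE : \sum_(q <- t) q.1 *: wcomp P q.2 = \sum_(q <- t) q.1 *: G q.
  by rewrite !big_seq; apply: eq_bigr => q qt; rewrite /G qt.
rewrite GE (@endT_sum P _ t (fun q => q.1) G _ MP); last 2 first.
- by apply: wcomp_endT => //; exact: Es.
- move=> q X; rewrite /G; case: ifP => qt; last exact: tspace0.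
  by apply: endT_tspace => //; apply: wcomp_endT => //; exact: Et.
rewrite scaler_sumr [LHS]big_seq [RHS]big_seq; apply: eq_bigr => q qt.
by rewrite wcomp_cat ?scalerA /G ?qt //; exact: Et.
Qed.

Lemma phi_scale P a s : phi P (cl_scale a s) = a *: phi P s.
Proof.
rewrite /phi /cl_scale big_map scaler_sumr; apply: eq_bigr => p _.
by rewrite scalerA.
Qed.

Lemma phi_one P : phi P cl_one = idT M P.
Proof. by rewrite phi1 scale1r. Qed.

Lemma endsec_comp (U : set V) (A B : V -> V -> V) :
  endsec M U A -> endsec M U B -> endsec M U (fun P => A P \o B P).
Proof.
move=> [eA sA] [eB sB]; split=> [P MP UP|Y vY].
  by apply: endT_comp; [|exact: eA|exact: eB].
apply: (sA (fun P => B P (Y P))); split; first exact: sB.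
by move=> P MP UP; case: (eB P MP UP) => _ BT _; apply: BT; case: vY => _; apply.
Qed.

Lemma endsec_idT (U : set V) : endsec M U (fun P => idT M P).
Proof.
split=> [P MP _|Y [sY TY]]; first exact: idT_endT.
by apply: (msmooth_eq _ sY) => P MP UP; rewrite idTE //; exact: TY.
Qed.

Lemma endsec_linear (U : set V) (f : V -> R^o) (A B : V -> V -> V) :
  msmooth M U f -> endsec M U A -> endsec M U B ->
  endsec M U (fun P => f P *: A P + B P).
Proof.
move=> sf [eA sA] [eB sB]; split=> [P MP UP|Y vY].
  by apply: endT_linear; [|exact: eA|exact: eB].
apply: (@msmooth_eq _ _ _ _ _ (fun P => f P *: A P (Y P) + B P (Y P))).
  by move=> P _ _; rewrite !fctE.
by apply: msmoothD; [apply: msmoothZ => //; exact: sA|exact: sB].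
Qed.

Lemma phi_endsec (U : set V) c : cl0_section M EB U c ->
  endsec M U (fun P => phi P (cl_at c P)).
Proof.
elim: c => [|p c IH] Hs.
  have -> : (fun P => phi P (cl_at [::] P)) = (fun P => 0).
    by apply/funext => P; rewrite /phi big_nil.
  split=> [P MP _|Y _]; first exact: zero_endT.
  exact: msmooth_cst.
have [sp Ep _] := Hs p (mem_head _ _).
have -> : (fun P => phi P (cl_at (p :: c) P)) =
    (fun P => p.1 P *: wcomp P [seq u P | u : V -> (V -> V) <- p.2] + phi P (cl_at c P)).
  by apply/funext => P; rewrite /phi /cl_at big_cons.
apply: endsec_linear => //; last by apply: IH => q qs; apply: Hs; rewrite in_cons qs orbT.
elim: (p.2) Ep => [|u w IHw] Ew /=; first exact: endsec_idT.
apply: endsec_comp; first by have [] := Ew u (mem_head _ _).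
by apply: IHw => v vw; apply: Ew; rewrite in_cons vw orbT.
Qed.

Lemma phi_wedge P A B : M P -> EB P A -> EB P B ->
  phi P (wedge A B) = 2^-1 *: (A \o B) - 2^-1 *: (B \o A).
Proof.
move=> MP EA EB'; rewrite /wedge phi2 scaleNr /=.
have idr C : EB P C -> C \o idT M P = C.
  move=> EC; have eC := EB_endT MP EC; apply/funext => X /=.
  have [TX|nTX] := pselect (tspace M P X); first by rewrite idTE.
  by rewrite idT_out // (endT0 MP eC); case: eC => ->.
by rewrite !idr.
Qed.

Lemma EB_selfadj P A : M P -> EB P A -> selfadjT M (gGr R n) P A.
Proof. by move=> MP [S sS ->]; exact: Eact_selfadj. Qed.

(** The image is half the commutator of two self-adjoint operators. *)
Lemma phi_wedge_skew P A B : M P -> EB P A -> EB P B ->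
  skewT M (gGr R n) P (phi P (wedge A B)).
Proof.
move=> MP EA EB' X Y TX TY; rewrite phi_wedge //.
have aA := EB_selfadj MP EA; have aB := EB_selfadj MP EB'.
have tA Z : tspace M P (A Z) by apply: endT_tspace => //; exact: EB_endT.
have tB Z : tspace M P (B Z) by apply: endT_tspace => //; exact: EB_endT.
have E1 : gGr R n P (A (B X)) Y = gGr R n P X (B (A Y)) by rewrite aA // aB.
have E2 : gGr R n P (B (A X)) Y = gGr R n P X (A (B Y)) by rewrite aB // aA.
move: E1 E2; rewrite !fctE /= /gGr -!/(qre _) !(qmulDl, qmulDr, qmulNl, qmulNr, qmulZl, qmulZr).
rewrite !(qreD, qreN, qreZ) => -> ->; ring.
Qed.

End CliffordMorphism.

(** * Orientation and the even Clifford structure *)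

Section EvenClifford.
Context {R : realType} {n : nat}.
Local Notation N := n.+2.
Local Notation V := (qmx R n.+2 n.+2).
Local Notation M := (Gr R n).
Implicit Types (P X Y : V) (A B : V -> V) (e : 'I_5 -> V -> V).
Hypothesis n0 : (0 < n)%N.

Lemma hB_linear P a A A' B : hB P (a *: A + A') B = a * hB P A B + hB P A' B.
Proof.
by rewrite /hB Sof_linear qmulDl qmulZl qreD qreZ mulrDr mulrCA.
Qed.

Lemma hB_sym P A B : hB P A B = hB P B A.
Proof. by rewrite /hB [in LHS]qre_mulC. Qed.

Lemma hB_metric : bundle_metric M EB (@hB R n).
Proof.
split.
- by move=> P _ a A A' B _ _ _; exact: hB_linear.
- by move=> P _ A B _ _; exact: hB_sym.
- move=> P MP A EA A0; have [[hS _ _] E] := EB_Sof n0 MP EA.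
  rewrite /hB mulr_gt0 ?invr_gt0 ?ltr0n // -[X in X *q _]hS; apply: qsq_gt0 => S0.
  by apply: A0; rewrite E S0 Eact0.
- move=> U s t _ [ss _] [st _]; apply: msmoothZ; first exact: msmooth_cst.
  by apply: msmooth_qre; apply: msmooth_qmul; apply: Sof_msmooth.
Qed.

Lemma endsec_eq (U : set V) (s t : V -> (V -> V)) :
  (forall P, M P -> U P -> s P = t P) -> endsec M U s -> endsec M U t.
Proof.
move=> E [es ss]; split=> [P MP UP|Y vY]; first by rewrite -E //; exact: es.
by apply: (msmooth_eq _ (ss Y vY)) => P MP UP; rewrite E.
Qed.

Lemma sigma_esec (U : set V) w wp k : adapted_local U w wp ->
  esec M EB U (fun P => sigma (w ^~ P) (wp ^~ P) P k).
Proof.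
move=> [sw swp ad].
have [es Es] : esec M EB U (fun P => Eact P (symF (w ^~ P) (dlt k))).
  apply: sym_esec => [|P MP UP]; last exact: (symF_symT (ad P MP UP)).
  have sW : msmooth M U (fun P => qcols (w ^~ P)).
    by apply: msmooth_sum => j; apply: msmooth_qmul => //; exact: msmooth_cst.
  apply: msmooth_qmul; last exact: msmooth_qadj.
  by apply: msmooth_qmul => //; exact: msmooth_cst.
have E P : M P -> U P -> Eact P (symF (w ^~ P) (dlt k)) = sigma (w ^~ P) (wp ^~ P) P k.
  by move=> MP UP; rewrite (sigmaE (ad P MP UP)).
split; first exact: endsec_eq es.
by move=> P MP UP; rewrite -E //; exact: Es.
Qed.

Lemma EB_sigma P w wp k : adapted P w wp -> EB P (sigma w wp P k).
Proof.
move=> ad; exists (symF w (dlt k)); last exact: (sigmaE ad).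
exact: (symF_symT ad).
Qed.

Lemma sigma_generate (U : set V) w wp : adapted_local U w wp ->
  involutions_generate M (gGr R n) EB (@hB R n) U
    (fun k P => sigma (w ^~ P) (wp ^~ P) P k).
Proof.
move=> al; have [_ _ ad] := al.
have inv P i : M P -> U P -> sigma (w ^~ P) (wp ^~ P) P i \o sigma (w ^~ P) (wp ^~ P) P i
    = idT M P.
  move=> MP UP; rewrite (EB_sq n0 MP (EB_sigma i (ad P MP UP))).
  by rewrite (sigma_hB (ad P MP UP)) // eqxx scale1r.
split.
- by move=> i; have [] := sigma_esec i al.
- by move=> P MP UP; apply: (EB_basis (ad P MP UP)).
- by move=> P MP UP i j; apply: (sigma_hB (ad P MP UP)).
- by move=> P i MP UP; exact: inv.
- move=> P i j MP UP ij; apply/eqP; rewrite -addr_eq0.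
  rewrite (EB_polar n0 MP (EB_sigma i (ad P MP UP)) (EB_sigma j (ad P MP UP))).
  by rewrite (sigma_hB (ad P MP UP)) // (negPf ij) mulr0 scale0r.
(* Orthogonality holds because a self-adjoint involution preserves the metric. *)
- move=> P i MP UP X Y TX TY.
  have Es := EB_sigma i (ad P MP UP).
  rewrite (EB_selfadj MP Es) //; last by apply: endT_tspace => //; exact: EB_endT.
  rewrite -[X in gGr _ _ _ _ X]/((sigma (w ^~ P) (wp ^~ P) P i \o
    sigma (w ^~ P) (wp ^~ P) P i) Y) inv //.
  by rewrite idTE.
- by move=> P i MP UP; apply: EB_selfadj => //; exact: EB_sigma (ad P MP UP).
Qed.

Lemma EB_subbundle : subbundle M 5 (@EB R n).
Proof.
move=> P MP; have [U [w [wp [oU UP al]]]] := local_frames MP.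
have G := sigma_generate al.
exists U, (fun k P => sigma (w ^~ P) (wp ^~ P) P k); split=> //.
  exact: ig_section G.
exact: ig_basis G.
Qed.

(* The product of an orthonormal frame is P or - P; the sign is that of C_4, see
   [s2_volume]. *)
Definition orn P : set ('I_5 -> (V -> V)) := [set e |
  [/\ forall i, EB P (e i), orthonormal_for (hB P) e &
      qre (qprod (fun i => Sof P (e i))) = - 2]].

(** * Frames of E as real 5x5 matrices in an adapted basis *)

Section Frame.
Variables (P : V) (w : 'I_2 -> qmx R N 1) (wp : 'I_n -> qmx R N 1).
Hypothesis ad : adapted P w wp.
Local Notation frame B := (fun i : 'I_5 => Eact P (symF w (B i))).

Let MP : M P. Proof. exact: adapted_Gr ad. Qed.

Lemma frame_matrix e : (forall i, EB P (e i)) ->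
  exists B : 'M[R]_5, e = frame B.
Proof.
move=> Ee.
have /choice[f fE] : forall i, exists a, e i = Eact P (symF w a).
  by move=> i; have [S sS ->] := Ee i; have [a ->] := symT_symF ad sS; exists a.
exists (\matrix_(i, j) f i j); apply/funext => i; rewrite fE; congr (Eact P (symF w _)).
by apply/funext => j; rewrite mxE.
Qed.

Lemma frame_EB (B : 'M[R]_5) i : EB P (frame B i).
Proof. by exists (symF w (B i)) => //; exact: (symF_symT ad). Qed.

Lemma frame_hB (B : 'M[R]_5) i j : hB P (frame B i) (frame B j) = (B *m B^T) i j.
Proof.
rewrite /hB !Sof_Eact //; [|exact: (symF_symT ad)..].
rewrite (qre_symF2 ad) mulrA mulVf ?mul1r ?pnatr_eq0 // mxE.
by apply: eq_bigr => k _; rewrite mxE.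
Qed.

Lemma frame_orthonormal (B : 'M[R]_5) :
  orthonormal_for (hB P) (frame B) <-> B *m B^T = 1%:M.
Proof.
split=> [H|E i j]; last by rewrite frame_hB E mxE.
by apply/matrixP => i j; rewrite -frame_hB H mxE.
Qed.

(** Up to conjugation by W the product is that of the [s2 (B i)], namely - det B times the identity
    of size 2, whose trace is 2. Hence the value - 2 in [orn] means det B = 1. *)
Lemma frame_volume (B : 'M[R]_5) : B *m B^T = 1%:M ->
  qre (qprod (fun i => Sof P (frame B i))) = - 2 * \det B.
Proof.
move=> BB; have -> : (fun i => Sof P (frame B i)) = (fun i => symF w (B i)).
  by apply/funext => i; rewrite Sof_Eact //; exact: (symF_symT ad).
have mulW (A C : qmx R 2 2) : qcols w *q A *q (qcols w)^*q *q
    (qcols w *q C *q (qcols w)^*q) = qcols w *q (A *q C) *q (qcols w)^*q.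
  by rewrite !qmulA -[_ *q (qcols w)^*q *q qcols w]qmulA (adapted_WW ad) qmul1r.
rewrite qprodE /symF !mulW (qre_symF ad) -(qprodE (fun i => s2 (B i))) s2_det //.
by rewrite qreZ qre1; ring.
Qed.

Lemma orn_frame (B : 'M[R]_5) : orn P (frame B) <-> (B *m B^T = 1%:M /\ \det B = 1).
Proof.
split=> [[_ /frame_orthonormal BB]|[BB dB]].
  rewrite frame_volume // => E; split=> //.
  have {}E : - 2 * \det B = - 2 :> R by [].
  lra.
split; [exact: frame_EB|exact/frame_orthonormal|].
by rewrite frame_volume // dB mulr1.
Qed.

Lemma frame_lin (A B : 'M[R]_5) :
  (fun i => \sum_j A i j *: frame B j) = frame (A *m B).
Proof.
apply/funext => i; rewrite -Eact_sum; congr (Eact P _).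
have -> : (A *m B) i = (fun k => \sum_j A i j * B j k) by apply/funext => k; rewrite mxE.
elim: (index_enum _) => [|j r IH].
  rewrite big_nil /symF; have -> : (fun k => \sum_(j <- [::]) A i j * B j k) = (fun=> 0).
    by apply/funext => k; rewrite big_nil.
  have := symF_linear w 0 (fun=> 0) (fun=> 0).
  rewrite scale0r add0r => E; apply/esym.
  have -> : s2 (fun=> 0) = 0 :> qmx R 2 2.
    have := s2_linear (- 1) (fun=> 0 : R) (fun=> 0).
    by rewrite scaleN1r addNr => <-; congr s2; apply/funext => k; rewrite mulr0 addr0.
  by rewrite qmul0r qmul0l.
rewrite big_cons IH -symF_linear; congr (symF w _).
by apply/funext => k; rewrite big_cons.
Qed.

Lemma orn_basis e : orn P e -> basis_for (EB P) e.
Proof.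
move=> oe; have [Ee on _] := oe; have [B eE] := frame_matrix Ee.
have BB : B *m B^T = 1%:M by apply/frame_orthonormal; rewrite -eE.
have BB' : B^T *m B = 1%:M by exact: mulmx1C.
have symE a : \sum_i a i *: e i = Eact P (symF w (fun k => \sum_i a i * B i k)).
  (* All rows of C equal a, so that one row of [frame_lin] is the wanted linear combination. *)
  pose C : 'M[R]_5 := \matrix_(i, j) a j.
  have E := congr1 (fun f => f o0) (frame_lin C B).
  transitivity (\sum_j C o0 j *: Eact P (symF w (B j))).
    by rewrite eE; apply: eq_bigr => j _; rewrite mxE.
  rewrite [LHS]E; congr (Eact P (symF w _)); apply/funext => k; rewrite mxE.
  by apply: eq_bigr => j _; rewrite mxE.
split.
  apply/seteqP; split=> [A [S sS ->]|A [a ->]]; last first.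
    by rewrite symE; eexists; [|reflexivity]; exact: (symF_symT ad).
  have [c ->] := symT_symF ad sS.
  (* The coordinates in the new frame are c B^T, because B^T B = 1. *)
  exists (fun i => \sum_k c k * B i k); rewrite symE; congr (Eact P (symF w _)).
  apply/funext => k.
  under eq_bigr => i _ do rewrite mulr_suml.
  rewrite exchange_big /=.
  transitivity (\sum_j c j * (B^T *m B) j k).
    by rewrite BB' (bigD1 k) //= mxE eqxx mulr1 big1 ?addr0 // => j /negPf jk; rewrite mxE jk mulr0.
  apply: eq_bigr => j _; rewrite mxE mulr_sumr; apply: eq_bigr => i _.
  by rewrite mxE mulrA.
move=> a a0 i.
have : hB P (\sum_j a j *: e j) (e i) = a i.
  have hs (r : seq 'I_5) : hB P (\sum_(j <- r) a j *: e j) (e i) = \sum_(j <- r) a j * (j == i)%:R.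
    elim: r => [|j r IH]; last by rewrite !big_cons hB_linear IH on.
    rewrite !big_nil; have := hB_linear P (- 1) 0 0 (e i).
    by rewrite scaler0 addr0 mulN1r addNr.
  rewrite hs (bigD1 i) //= eqxx mulr1 big1 ?addr0 // => j /negPf ->; exact: mulr0.
rewrite a0 => <-; have := hB_linear P (- 1) 0 0 (e i).
by rewrite scaler0 addr0 mulN1r addNr.
Qed.

End Frame.

Lemma orn_orientation : orientation M EB (@hB R n) orn.
Proof.
split.
- move=> P e MP oe; have [w [wp ad]] := adapted_exists MP.
  by split; [exact: (orn_basis ad)|case: oe].
- move=> P e A MP oe; have [w [wp ad]] := adapted_exists MP.
  have [B eE] := frame_matrix ad (let: And3 h _ _ := oe in h).
  rewrite eE in oe *; rewrite frame_lin; have [BB dB] := (orn_frame ad B).1 oe.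
  (* As B lies in SO(5), the product A B lies there exactly when A does. *)
  apply: (iff_trans (orn_frame ad _)).
  by rewrite trmx_mul mulmxA -(mulmxA A) BB mulmx1 det_mulmx dB mulr1.
- move=> P MP; have [U [w [wp [oU UP al]]]] := local_frames MP.
  exists U, (fun k P => sigma (w ^~ P) (wp ^~ P) P k); split=> //.
    by move=> i; exact: sigma_esec al.
  move=> Q MQ UQ; have [_ _ /(_ Q MQ UQ) ad] := al.
  have -> : (fun k => sigma (w ^~ Q) (wp ^~ Q) Q k) =
      (fun i => Eact Q (symF (w ^~ Q) ((1%:M : 'M[R]_5) i))).
    apply/funext => k; rewrite (sigmaE ad); congr (Eact Q (symF _ _)).
    by apply/funext => j; rewrite mxE.
  by apply/(orn_frame ad); rewrite trmx1 mulmx1 det1.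
Qed.

Lemma phi_morphism : algebra_bundle_morphism M EB (@hB R n) (@phi R n).
Proof.
split.
- by move=> P s MP [Es _]; exact: phi_endT.
- by move=> P s t MP _ _; exact: phi_cl_eq.
- by move=> P s t _ _ _; exact: phi_cat.
- by move=> P a s _ _; exact: phi_scale.
- by move=> P _; exact: phi_one.
- by move=> P s t MP [Es _] [Et _]; exact: phi_mul.
- by move=> U s _; exact: phi_endsec.
Qed.

Lemma Gr_even_clifford :
  even_clifford_structure M (gGr R n) EB (@hB R n) orn (@phi R n).
Proof.
split; [exact: EB_subbundle|exact: hB_metric|exact: orn_orientation|exact: phi_morphism|].
by move=> P A B MP EA EB'; exact: phi_wedge_skew.
Qed.

Lemma phi_wedge_orth P A B : M P -> EB P A -> EB P B -> hB P A B = 0 ->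
  phi P (wedge A B) = A \o B.
Proof.
move=> MP EA EB' h0; rewrite phi_wedge //.
have := EB_polar n0 MP EA EB'; rewrite h0 mulr0 scale0r => /eqP.
rewrite addrC addr_eq0 => /eqP ->; rewrite scalerN opprK -scalerDl.
by rewrite -[RHS]scale1r; congr (_ *: _); lra.
Qed.

Lemma qrow_C4lin a p : qrow (C4lin a p) = qrow p *q s2 a :> qmx R 1 2.
Proof.
rewrite s2_sum qmul_sumr /C4lin.
have lq : linear (@qrow R).
  by move=> c [x y] [x' y']; rewrite /qrow /=; qdistr; qabel.
rewrite (lin_sum lq); apply: eq_bigr => k _.
by rewrite (linZ lq) qrow_C4 qmulZr.
Qed.

Lemma coords_phi P w wp (a b : 'I_5 -> R) X l : adapted P w wp ->
  let u := \sum_k a k *: sigma w wp P k in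
  let v := \sum_k b k *: sigma w wp P k in
  hB P u v = 0 -> tspace M P X ->
  coords w wp (phi P (wedge u v) X) l = C4lin a (C4lin b (coords w wp X l)).
Proof.
move=> ad u v h0 TX; have MP := adapted_Gr ad.
have symE c : \sum_k c k *: sigma w wp P k = Eact P (symF w c).
  by rewrite (symF_sum w c) Eact_sum; apply: eq_bigr => k _; rewrite (sigmaE ad).
have EE c : EB P (Eact P (symF w c)) by exists (symF w c) => //; exact: (symF_symT ad).
have uE : u = Eact P (symF w a) := symE a.
have vE : v = Eact P (symF w b) := symE b.
have Eu : EB P u by rewrite uE.
have Ev : EB P v by rewrite vE.
rewrite (phi_wedge_orth MP Eu Ev h0) uE vE.
have TvX : tspace M P (Eact P (symF w b) X).
  by apply: endT_tspace => //; apply: EB_endT.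
apply: qrow_inj; rewrite /= (EactE _ TvX) (coords_act ad); last exact/tspaceP.
by rewrite (EactE _ TX) (coords_act ad) ?qrow_C4lin //; exact/tspaceP.
Qed.

End EvenClifford.

(** * The connections *)

Section ParallelAlgebra.
Context {R : realType} {N : nat}.
Variables (P S X Y c b : qmx R N N).
Hypotheses (prP : projector P) (sS : symT P S) (tX : tangent P X) (tY : tangent P Y).
Hypotheses (hc : c^*q = c) (cE : X *q S + P *q c = c).

Let PP : P *q P = P. Proof. by case: prP. Qed.
Let PS : P *q S = S. Proof. by case: sS. Qed.
Let SP : S *q P = S. Proof. exact: symT_rule. Qed.

Lemma dsym_left : P *q c = c - X *q S.
Proof. by apply/eqP; rewrite eq_sym subr_eq addrC cE. Qed.

Lemma dsym_right : c *q P = c - S *q X.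
Proof.
have := congr1 (@qadj R N N) dsym_left; rewrite qadjM qadjB qadjM hc.
by case: prP => -> _; case: sS => -> _ _; case: tX => -> _.
Qed.

(** Differentiating P S = S forces the off-diagonal blocks of c to be X S and S X; only its block on
    W is free. *)
Lemma dsym_block : P *q c *q P = c - S *q X - X *q S.
Proof.
by rewrite dsym_left qmulBl dsym_right -qmulA SP.
Qed.

(** [act S] commutes with [tproj P], so b cancels; the off-diagonal blocks of c combine with Y into
    diagonal blocks, which [tproj] removes. *)
Lemma tproj_act : tproj P (act S b + act c Y) - act S (tproj P b) =
  act (P *q c *q P) Y.
Proof.
have cYP : c *q Y *q P = S *q X *q Y.
  rewrite -qmulA (tangent_rule tY) qmulBr qmulA dsym_right qmulBl opprB addrC subrK.
  by [].
have PYc : P *q Y *q c = Y *q X *q S.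
  have := congr1 (@qadj R N N) cYP; rewrite !qadjM hc.
  case: prP => -> _; case: sS => -> _ _; case: tX => -> _; case: tY => -> _.
  by rewrite !qmulA.
rewrite dsym_block /tproj /act; qdistr.
rewrite ?(PS, qmul_rule PS, SP, qmul_rule SP, PYc, cYP, qmul_rule cYP).
rewrite -?[_ *q c *q P]qmulA ?dsym_right ?dsym_left; qdistr.
rewrite ?(PS, qmul_rule PS, SP, qmul_rule SP, PYc, cYP).
have -> : X *q S *q Y *q P = 0.
  by rewrite -[X *q S *q Y]qmulA -qmulA (SXP0 prP sS tY) qmul0r.
qabel.
Qed.

End ParallelAlgebra.

Section Connections.
Context {R : realType} {n : nat}.
Local Notation N := n.+2.
Local Notation V := (qmx R n.+2 n.+2).
Local Notation M := (Gr R n).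
Hypothesis n0 : (0 < n)%N.

Lemma tder_qmul m p q (f : V -> qmx R m p) (g : V -> qmx R p q) P X :
  M P -> tspace M P X -> msmooth M setT f -> msmooth M setT g ->
  tder M (fun Q => f Q *q g Q) P X = tder M f P X *q g P + f P *q tder M g P X.
Proof.
move=> MP TX sf sg; apply: tder_bil => //; [exact: qmul_is_bilinear|exact: findim_qmx..].
Qed.

Lemma tder_act (f g : V -> V) P X :
  M P -> tspace M P X -> msmooth M setT f -> msmooth M setT g ->
  tder M (fun Q => act (f Q) (g Q)) P X
    = act (tder M f P X) (g P) + act (f P) (tder M g P X).
Proof.
move=> MP TX sf sg; apply: tder_bil => //; [exact: act_is_bilinear|exact: findim_qmx..].
Qed.

Lemma tder_qadj (f : V -> V) P X : M P -> tspace M P X -> msmooth M setT f ->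
  tder M (fun Q => (f Q)^*q) P X = (tder M f P X)^*q.
Proof.
move=> MP TX sf; apply: tder_of_linear => //; [exact: qadj_is_linear|exact: findim_qmx].
Qed.

Lemma tder_qre (f : V -> V) P X : M P -> tspace M P X -> msmooth M setT f ->
  tder M (fun Q => qre (f Q)) P X = qre (tder M f P X).
Proof.
move=> MP TX sf; apply: tder_of_linear => //; [exact: qre_is_linear|exact: findim_qmx].
Qed.

Lemma msmooth_P (U : set V) : msmooth M U (id : V -> V).
Proof. exact: msmooth_id. Qed.

Section Derivatives.
Variables (P X : V).
Hypotheses (MP : M P) (TX : tspace M P X).

Lemma tder_vfield (Y : V -> V) : vfield M setT Y ->
  let b := tder M Y P X in
  b^*q = b /\ b *q P + P *q b = b - (Y P *q X + X *q Y P).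
Proof.
move=> [sY TY] b; have tY Q : M Q -> tangent Q (Y Q) by move=> MQ; apply/tspaceP => //; exact: TY.
split.
  have E := tder_qadj MP TX sY; rewrite /b -E.
  by apply: (tder_eq TX) => Q MQ; case: (tY Q MQ).
have E : tder M (fun Q => Y Q *q Q + Q *q Y Q) P X = b.
  by apply: tder_eq => // Q MQ; case: (tY Q MQ).
have sP : msmooth M setT (id : V -> V) by exact: msmooth_P.
rewrite tderD ?tder_qmul // ?tder_id // -/b in E; try exact: msmooth_qmul.
by rewrite -[in RHS]E; qabel.
Qed.

Lemma tder_sym (S : V -> V) : msmooth M setT S -> (forall Q, M Q -> symT Q (S Q)) ->
  let c := tder M S P X in [/\ c^*q = c, X *q S P + P *q c = c & qre c = 0].
Proof.
move=> sS symS c; split.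
- have E := tder_qadj MP TX sS; rewrite /c -E.
  by apply: (tder_eq TX) => Q MQ; case: (symS Q MQ).
- have E : tder M (fun Q => Q *q S Q) P X = c.
    by apply: tder_eq => // Q MQ; case: (symS Q MQ).
  by rewrite tder_qmul // ?tder_id // in E; exact: msmooth_P.
- have E := tder_qre MP TX sS; rewrite /c -E -(tder_cst (0 : R^o) MP TX).
  by apply: (tder_eq TX) => Q MQ; case: (symS Q MQ).
Qed.

(** Compression to W keeps the trace zero, since the blocks S X and X S it removes are
    off-diagonal. *)
Lemma dsym_symT (S : V -> V) : msmooth M setT S -> (forall Q, M Q -> symT Q (S Q)) ->
  symT P (P *q tder M S P X *q P).
Proof.
move=> sS symS; have [hc cE trc] := tder_sym sS symS.
set c := tder M S P X in hc cE trc *.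
have prP := (Gr_projector MP).1; have [hP PP] := prP.
have tX : tangent P X by apply/tspaceP.
have sP := symS P MP.
split; first by rewrite !qadjM hP hc qmulA.
  by rewrite !qmulA PP.
rewrite (dsym_block prP sP tX hc cE) !qreB trc (qre_mulC X).
have -> : qre (S P *q X) = 0.
  have PS : P *q S P = S P by case: sP.
  by rewrite -PS -qmulA qre_mulC (SXP0 prP sP tX) qre0.
by rewrite !subr0.
Qed.

End Derivatives.

Definition Dg (X Y : V -> V) : V -> V := fun P => tproj P (tder M Y P (X P)).

Definition DE (X : V -> V) (s : V -> (V -> V)) : V -> (V -> V) := fun P =>
  Eact P (P *q tder M (fun Q => Sof Q (s Q)) P (X P) *q P).

Lemma vfield_tangent (X : V -> V) P : vfield M setT X -> M P -> tangent P (X P).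
Proof. by move=> [_ TX] MP; apply/tspaceP => //; exact: TX. Qed.

Lemma vfield_tspace (X : V -> V) P : vfield M setT X -> M P -> tspace M P (X P).
Proof. by move=> [_ TX] MP; exact: TX. Qed.

Lemma tprojD (P A B : V) : tproj P (A + B) = tproj P A + tproj P B.
Proof. exact: (linD (tproj_is_linear P)). Qed.
Lemma tprojZ (P : V) a A : tproj P (a *: A) = a *: tproj P A.
Proof. exact: (linZ (tproj_is_linear P)). Qed.

Lemma Dg_eq X Y Y' P : M P -> vfield M setT X -> (forall Q, M Q -> Y Q = Y' Q) ->
  Dg X Y P = Dg X Y' P.
Proof.
by move=> MP vX E; rewrite /Dg (tder_eq (vfield_tspace vX MP) E).
Qed.

Lemma Dg_leibniz (X : V -> V) (f : V -> R^o) s t P :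
  vfield M setT X -> msmooth M setT f -> vfield M setT s -> vfield M setT t -> M P ->
  Dg X (fun Q => f Q *: s Q + t Q) P
    = tder M f P (X P) *: s P + f P *: Dg X s P + Dg X t P.
Proof.
move=> vX sf [ss Ts] [st Tt] MP; have TX := vfield_tspace vX MP.
rewrite /Dg tderD //; last exact: msmoothZ.
rewrite tderZ //; last exact: findim_qmx.
rewrite !tprojD !tprojZ tproj_id //; first by case: (Gr_projector MP).
by apply/tspaceP => //; exact: Ts.
Qed.

Lemma Dg_vfield X Y : vfield M setT X -> vfield M setT Y -> vfield M setT (Dg X Y).
Proof.
move=> vX vY; have [sY TY] := vY; split.
  have sb := msmooth_tder (@findim_qmx R N N) vX sY.
  have sP : msmooth M setT (id : V -> V) by exact: msmooth_P.
  apply: msmoothB; first by apply: msmoothD; apply: msmooth_qmul.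
  apply: msmoothZ; first exact: msmooth_cst.
  by apply: msmooth_qmul => //; apply: msmooth_qmul.
move=> P MP _; apply/tspaceP => //; apply: tproj_tangent; first by case: (Gr_projector MP).
by have [] := tder_vfield MP (vfield_tspace vX MP) vY.
Qed.

Lemma Dg_connection : connection M (vfield M setT) Dg.
Proof.
split; [exact: Dg_vfield| |by move=> *; exact: Dg_leibniz].
move=> X Y f s vX vY sf [ss Ts] P MP.
have TX := vfield_tspace vX MP; have TY := vfield_tspace vY MP.
by rewrite /Dg tder_linear ?tprojD ?tprojZ //; exact: tspace_lin.
Qed.

Lemma Dg_levi_civita : levi_civita M (gGr R n) Dg.
Proof.
split; first exact: Dg_connection.
- move=> X s t vX vs vt P MP; have TX := vfield_tspace vX MP.
  have [ss Ts] := vs; have [st Tt] := vt.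
  have prP := (Gr_projector MP).1.
  rewrite /gGr -!/(qre _) (@tder_qre (fun Q => s Q *q t Q)) //; last exact: msmooth_qmul.
  rewrite tder_qmul // qreD (tproj_orth _ prP (vfield_tangent vt MP)).
  congr (_ + _); rewrite [in RHS]qre_mulC (tproj_orth _ prP (vfield_tangent vs MP)).
  exact: qre_mulC.
- move=> X Y vX vY P MP; have TX := vfield_tspace vX MP; have TY := vfield_tspace vY MP.
  move: (tder_vfield MP TX vY) (tder_vfield MP TY vX); rewrite /Dg /lie /=.
  move: (tder M Y P (X P)) (tder M X P (Y P)) => b b' [hb bE] [hb' bE'].
  (* The two derivatives miss the tangent equation by the same symmetric term X Y + Y X, so their
     difference, the Lie bracket, is already tangent and [tproj] fixes it. *)
  have -> : tproj P b - tproj P b' = tproj P (b - b').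
    by rewrite -scaleN1r -tprojZ -tprojD scaleN1r.
  apply: tproj_id; first by case: (Gr_projector MP).
  split; first by rewrite qadjB hb hb'.
  have -> : (b - b') *q P + P *q (b - b') = (b *q P + P *q b) - (b' *q P + P *q b').
    by qdistr; qabel.
  by rewrite bE bE'; qabel.
Qed.

Section ESections.
Variables (s : V -> (V -> V)).
Hypothesis Es : esec M EB setT s.
Let S Q := Sof Q (s Q).

Lemma sec_msmooth : msmooth M setT S.
Proof. by have [] := esec_sym n0 Es. Qed.
Lemma sec_symT Q : M Q -> symT Q (S Q).
Proof. by move=> MQ; have [_ H _] := esec_sym n0 Es; exact: H. Qed.
Lemma sec_Eact Q : M Q -> s Q = Eact Q (S Q).
Proof. by move=> MQ; have [_ _ H] := esec_sym n0 Es; exact: H. Qed.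

Lemma DE_sec X : vfield M setT X -> esec M EB setT (DE X s).
Proof.
move=> vX; apply: sym_esec.
  have sb := msmooth_tder (@findim_qmx R N N) vX sec_msmooth.
  have sP : msmooth M setT (id : V -> V) by exact: msmooth_P.
  by apply: msmooth_qmul => //; apply: msmooth_qmul.
move=> P MP _; apply: dsym_symT => //; [exact: vfield_tspace|exact: sec_msmooth|exact: sec_symT].
Qed.

Lemma DE_parallel X Y P : vfield M setT X -> vfield M setT Y -> M P ->
  DE X s P (Y P) = Dg X (fun Q => s Q (Y Q)) P - s P (Dg X Y P).
Proof.
move=> vX vY MP; have TX := vfield_tspace vX MP; have TY := vfield_tspace vY MP.
have prP := (Gr_projector MP).1.
have [hc cE trc] := tder_sym MP TX sec_msmooth sec_symT.
rewrite (@Dg_eq X _ (fun Q => act (S Q) (Y Q))) //; last first.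
  by move=> Q MQ; rewrite sec_Eact // EactE //; exact: vfield_tspace.
rewrite sec_Eact // EactE; last by apply: vfield_tspace MP; exact: Dg_vfield.
rewrite /DE EactE // /Dg.
have [sY _] := vY; have sS := sec_msmooth.
rewrite (tder_act MP TX sS sY) {1}/S;
move: (tder M Y P (X P)) (tder M S P (X P)) hc cE trc => b c hc cE trc.
rewrite [X in tproj P X - _]addrC.
apply/esym.
exact: (tproj_act b prP (sec_symT MP) (vfield_tangent vX MP) (vfield_tangent vY MP) hc cE).
Qed.

End ESections.

Lemma DE_connection : connection M (esec M EB setT) DE.
Proof.
split; first by move=> X s vX Es; exact: DE_sec.
- move=> X Y f s vX vY sf Es P MP.
  have TX := vfield_tspace vX MP; have TY := vfield_tspace vY MP.
  rewrite /DE tder_linear //; last 2 first.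
  + exact: tspace_lin.
  + exact: sec_msmooth.
  by rewrite qmulDr qmulDl qmulZr qmulZl Eact_linear.
- move=> X f s t vX sf Es Et P MP; have TX := vfield_tspace vX MP.
  have sS := sec_msmooth Es; have sT := sec_msmooth Et.
  have prP := (Gr_projector MP).1; have sS' := sec_symT Es MP.
  rewrite /DE (@tder_eq _ _ _ _ _ (fun Q => f Q *: Sof Q (s Q) + Sof Q (t Q))) //; last first.
    by move=> Q _; rewrite -Sof_linear.
  rewrite tderD //; last exact: msmoothZ.
  rewrite tderZ //; last exact: findim_qmx.
  move: (sec_Eact Es MP) sS'; move: (Sof P (s P)) (tder M f P (X P))
    (tder M (fun Q => Sof Q (s Q)) P (X P)) (tder M (fun Q => Sof Q (t Q)) P (X P)).
  move=> S0 df c c' -> sS'; rewrite !qmulDr !qmulDl !qmulZr !qmulZl.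
  have -> : P *q S0 *q P = S0 by case: (sS') => _ -> _; exact: symT_rule.
  by rewrite -addrA !Eact_linear addrA.
Qed.

Lemma DE_compatible : compatible M (esec M EB setT) DE (@hB R n).
Proof.
move=> X s t vX Es Et P MP; have TX := vfield_tspace vX MP.
have sS := sec_msmooth Es; have sT := sec_msmooth Et.
have prP := (Gr_projector MP).1.
have H u (Eu : esec M EB setT u) : Sof P (DE X u P) =
    P *q tder M (fun Q => Sof Q (u Q)) P (X P) *q P.
  by rewrite Sof_Eact //; apply: dsym_symT => //; [exact: sec_msmooth|exact: sec_symT].
(* Compressing a derivative to W does not change its trace pairing with an element living on W. *)
have orth A T : symT P T -> qre (P *q A *q P *q T) = qre (A *q T).
  move=> sT'; have TP := symT_rule prP sT'; case: sT' => _ PT _.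
  by rewrite -!qmulA PT qre_mulC -!qmulA TP.
pose L (A : V) : R^o := 2^-1 * qre A.
have lL : linear L by move=> a A B; rewrite /L qreD qreZ mulrDr mulrCA.
have E1 : tder M (fun Q => hB Q (s Q) (t Q)) P (X P) =
    L (tder M (fun Q => Sof Q (s Q) *q Sof Q (t Q)) P (X P)).
  exact: (tder_of_linear lL (@findim_qmx R N N) MP TX (msmooth_qmul sS sT)).
rewrite E1 (tder_qmul MP TX sS sT).
have h1 : hB P (DE X s P) (t P) = L (P *q tder M (fun Q => Sof Q (s Q)) P (X P) *q P
    *q Sof P (t P)) by rewrite /hB (H s Es).
have h2 : hB P (s P) (DE X t P) = L (Sof P (s P) *q
    (P *q tder M (fun Q => Sof Q (t Q)) P (X P) *q P)) by rewrite /hB (H t Et).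
rewrite h1 h2 /L; move: (sec_symT Es MP) (sec_symT Et MP).
move: (Sof P (s P)) (Sof P (t P)) (tder M (fun Q => Sof Q (s Q)) P (X P))
  (tder M (fun Q => Sof Q (t Q)) P (X P)) => A B c c' sA sB.
rewrite qreD mulrDr (orth _ _ sB); congr (_ + _ * _).
by rewrite [RHS]qre_mulC (orth _ _ sA) qre_mulC.
Qed.

End Connections.

(** * Parallelism *)

Section SectionsAtPoint.
Context {R : realType} {V : normedModType R} (M : set V).
Implicit Types (x : V) (D : (V -> V) -> (V -> (V -> V)) -> (V -> (V -> V))).

Definition at_pt (w : seq (V -> (V -> V))) x : seq (V -> V) :=
  [seq u x | u : V -> (V -> V) <- w].

Lemma cl_at_cons (p : (V -> R^o) * seq (V -> (V -> V))) s x :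
  cl_at (p :: s) x = (p.1 x, at_pt p.2 x) :: cl_at s x.
Proof. by []. Qed.

Lemma cl_at_conn D X (p : (V -> R^o) * seq (V -> (V -> V))) s x :
  cl_at (cl_conn M D X (p :: s)) x =
  (tder M p.1 x (X x), at_pt p.2 x) ::
    [seq (p.1 x, at_pt w x) | w <- leibniz_word (D X) p.2] ++
    cl_at (cl_conn M D X s) x.
Proof. by rewrite /cl_at /cl_conn /= map_cat -map_comp. Qed.

End SectionsAtPoint.

Section Parallel.
Context {R : realType} {n : nat}.
Local Notation N := n.+2.
Local Notation V := (qmx R n.+2 n.+2).
Local Notation M := (Gr R n).
Hypothesis n0 : (0 < n)%N.

Definition secs (w : seq (V -> (V -> V))) : Prop :=
  forall u, u \in w -> esec M EB setT u.

Lemma secs_cons u w : secs (u :: w) -> esec M EB setT u /\ secs w.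
Proof.
move=> H; split=> [|v vw]; first by apply: H; rewrite mem_head.
by apply: H; rewrite in_cons vw orbT.
Qed.

Lemma wcomp_endsec w : secs w -> endsec M setT (fun P => wcomp P (at_pt w P)).
Proof.
elim: w => [|u w IH] Ew /=; first exact: endsec_idT.
have [Eu {}Ew] := secs_cons Ew.
by apply: endsec_comp; [case: Eu|exact: IH].
Qed.

Lemma endsec_vfield A Y : endsec M setT A -> vfield M setT Y ->
  vfield M setT (fun P => A P (Y P)).
Proof.
move=> [eA sA] vY; split; first exact: sA.
by move=> P MP _; apply: endT_tspace => //; exact: eA.
Qed.

Lemma leibniz_secs X w w' : vfield M setT X -> secs w ->
  w' \in leibniz_word (DE X) w -> secs w'.
Proof.
move=> vX; elim: w w' => [//|u w IH] w' Ew /=; have [Eu {}Ew] := secs_cons Ew.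
rewrite in_cons => /orP[/eqP ->|/mapP[w'' w''w ->]] v; rewrite in_cons.
  by move=> /orP[/eqP ->|/Ew //]; exact: DE_sec.
by move=> /orP[/eqP -> //|]; apply: (IH w'').
Qed.

Lemma endT_sum_app P (I : eqType) (r : seq I) (x : I -> V) A : M P -> endT M P A ->
  (forall i, i \in r -> tspace M P (x i)) ->
  A (\sum_(i <- r) x i) = \sum_(i <- r) A (x i) /\ tspace M P (\sum_(i <- r) x i).
Proof.
move=> MP eA; elim: r => [|i r IH] Tx.
  by rewrite !big_nil (endT0 MP eA); split=> //; exact: tspace0.
have [|IH1 IH2] := IH; first by move=> j jr; apply: Tx; rewrite in_cons jr orbT.
have Ti : tspace M P (x i) by apply: Tx; rewrite mem_head.
rewrite !big_cons -IH1; case: (eA) => _ _ Al.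
have := Al 1 _ _ Ti IH2; rewrite !scale1r => ->; split=> //.
by have := tspace_lin 1 MP Ti IH2; rewrite scale1r.
Qed.

(** Leibniz rule for composites: the first letter u is parallel by [DE_parallel] applied to the
    field obtained from Y by the remaining word, and the remaining word by induction under u. *)
Lemma word_parallel X Y w P : vfield M setT X -> vfield M setT Y -> secs w -> M P ->
  \sum_(w' <- leibniz_word (DE X) w) wcomp P (at_pt w' P) (Y P) =
  Dg X (fun Q => wcomp Q (at_pt w Q) (Y Q)) P - wcomp P (at_pt w P) (Dg X Y P).
Proof.
move=> vX vY + MP; have TY := vfield_tspace vY MP.
elim: w => [|u w IH] Ew /=.
  rewrite big_nil idTE; last by apply: (vfield_tspace _ MP); exact: Dg_vfield.
  rewrite (@Dg_eq _ _ X (fun Q => idT M Q (Y Q)) Y) ?subrr //.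
  by move=> Q MQ; rewrite idTE //; exact: vfield_tspace.
have [Eu {}Ew] := secs_cons Ew.
have eu : endT M P (u P) by case: Eu => -[eu _] _; exact: eu.
have vZ : vfield M setT (fun Q => wcomp Q (at_pt w Q) (Y Q)).
  exact: (endsec_vfield (wcomp_endsec Ew) vY).
set Z := (fun Q => wcomp Q _ _) in IH vZ *.
rewrite big_cons /= big_map /= -[wcomp P _ (Y P)]/(Z P).
rewrite (DE_parallel n0 Eu vX vZ MP).
rewrite -[X in _ - _ + X]/(\sum_(w' <- _) u P (wcomp P (at_pt w' P) (Y P))).
have TWw w' : w' \in leibniz_word (DE X) w -> tspace M P (wcomp P (at_pt w' P) (Y P)).
  move=> w'w; apply: endT_tspace => //.
  by have [ew' _] := wcomp_endsec (leibniz_secs vX Ew w'w); exact: ew'.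
have [<- _] := endT_sum_app MP eu TWw.
rewrite IH //.
have TZ : tspace M P (Dg X Z P) by apply: (vfield_tspace _ MP); exact: Dg_vfield.
have TW : tspace M P (wcomp P (at_pt w P) (Dg X Y P)).
  apply: endT_tspace => //.
  by have [ew _] := wcomp_endsec Ew; exact: ew.
have -> : u P (Dg X Z P - wcomp P (at_pt w P) (Dg X Y P)) =
    u P (Dg X Z P) - u P (wcomp P (at_pt w P) (Dg X Y P)).
  case: eu => _ _ Al; have := Al (- 1) _ _ TW TZ.
  by rewrite !scaleN1r addrC [RHS]addrC.
by rewrite addrA subrK.
Qed.

Lemma phi_nil_app P (Z : V) : phi P [::] Z = 0.
Proof. by rewrite /phi big_nil. Qed.

Lemma phi_cons_app P p s (Z : V) :
  phi P (p :: s) Z = p.1 *: wcomp P p.2 Z + phi P s Z.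
Proof. by rewrite /phi big_cons. Qed.

Lemma phi_cat_app P s t (Z : V) : phi P (s ++ t) Z = phi P s Z + phi P t Z.
Proof. by rewrite phi_cat. Qed.

Lemma parallel_nil X Y P : vfield M setT X -> M P ->
  phi P (cl_at (cl_conn M DE X [::]) P) (Y P) =
  Dg X (fun Q => phi Q (cl_at [::] Q) (Y Q)) P - phi P (cl_at [::] P) (Dg X Y P).
Proof.
move=> vX MP; rewrite !phi_nil_app subr0.
rewrite (@Dg_eq _ _ X _ (fun=> 0) P MP vX) => [|Q _]; last exact: phi_nil_app.
by rewrite /Dg (tder_cst _ MP (vfield_tspace vX MP)) (lin0 (tproj_is_linear P)).
Qed.

Lemma parallel_cons X Y p s P : vfield M setT X -> vfield M setT Y -> M P ->
  cl0_section M EB setT (p :: s) ->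
  phi P (cl_at (cl_conn M DE X s) P) (Y P) =
    Dg X (fun Q => phi Q (cl_at s Q) (Y Q)) P - phi P (cl_at s P) (Dg X Y P) ->
  phi P (cl_at (cl_conn M DE X (p :: s)) P) (Y P) =
    Dg X (fun Q => phi Q (cl_at (p :: s) Q) (Y Q)) P
    - phi P (cl_at (p :: s) P) (Dg X Y P).
Proof.
move=> vX vY MP Hs IH; have [sp Ep _] := Hs p (mem_head _ _).
have {}Hs : cl0_section M EB setT s by move=> q qs; apply: Hs; rewrite in_cons qs orbT.
have vW := endsec_vfield (wcomp_endsec Ep) vY.
have vs := endsec_vfield (phi_endsec Hs) vY.
have E Q : M Q -> phi Q (cl_at (p :: s) Q) (Y Q) =
    p.1 Q *: wcomp Q (at_pt p.2 Q) (Y Q) + phi Q (cl_at s Q) (Y Q).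
  by move=> _; rewrite cl_at_cons phi_cons_app.
rewrite (Dg_eq MP vX E) (Dg_leibniz vX sp vW vs MP).
rewrite (cl_at_cons p s P) [in RHS]phi_cons_app opprD addrACA -IH.
rewrite cl_at_conn phi_cons_app phi_cat_app [LHS]addrA; congr (_ + _).
rewrite -addrA; congr (_ + _); rewrite -scalerBr -(word_parallel vX vY Ep MP).
elim: (leibniz_word _ _) => [|w r IHr]; first by rewrite big_nil scaler0 phi_nil_app.
by rewrite big_cons scalerDr -IHr phi_cons_app.
Qed.

Lemma Gr_parallel : parallel_for M EB (@phi R n) Dg DE.
Proof.
move=> X Y s vX vY + P MP; elim: s => [|p s IH] Hs; first exact: parallel_nil.
apply: parallel_cons => //; apply: IH => q qs.
by apply: Hs; rewrite in_cons qs orbT.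
Qed.

End Parallel.

(** * Curvature *)

Section NonFlat.
Context {R : realType} {n : nat}.
Local Notation N := n.+2.
Local Notation V := (qmx R n.+2 n.+2).
Local Notation M := (Gr R n).
Hypothesis n0 : (0 < n)%N.

(** The compression of an ambient matrix field to W, corrected by a multiple of the projector. The
    test section and its covariant derivative both have this form, so one derivative formula serves
    twice. *)
Definition Hfield (G : V -> V) (f : V -> R^o) : V -> V :=
  fun Q => Q *q G Q *q Q - f Q *: Q.

Lemma Hfield_msmooth G f : msmooth M setT G -> msmooth M setT f ->
  msmooth M setT (Hfield G f).
Proof.
move=> sG sf; have sP : msmooth M setT (id : V -> V) by exact: msmooth_P.
by apply: msmoothB; [apply: msmooth_qmul => //; apply: msmooth_qmul|apply: msmoothZ].
Qed.

(** Differentiating the last Q of the correction gives f X, which disappears because P X P = 0. *)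
Lemma tder_Hfield G f P X : M P -> tspace M P X ->
  msmooth M setT G -> msmooth M setT f ->
  P *q tder M (Hfield G f) P X *q P =
  P *q (X *q G P + G P *q X + tder M G P X) *q P - tder M f P X *: P.
Proof.
move=> MP TX sG sf; have sP : msmooth M setT (id : V -> V) by exact: msmooth_P.
have sQG := msmooth_qmul sP sG.
have sQGQ := msmooth_qmul sQG sP.
have sfQ := msmoothZ sf sP.
have [prP _] := Gr_projector MP; have [_ PP] := prP.
have PXP : P *q X *q P = 0 by apply: tangent_PXP => //; apply/tspaceP.
have E1 := tderD MP TX sQGQ (msmoothN sfQ).
have E2 := tder_qmul MP TX sQG sP.
have E3 := tder_qmul MP TX sP sG.
have E4 := tderZ (@findim_qmx R N N) MP TX sf sP.
have E5 : tder M (fun Q => - (f Q *: Q)) P X = - tder M (fun Q => f Q *: Q) P X.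
  apply: tder_of_linear => //; last exact: findim_qmx.
  by move=> a A B; rewrite opprD scalerN.
rewrite -[tder M (Hfield G f) P X]/(tder M (fun Q => Q *q G Q *q Q + - (f Q *: Q)) P X).
rewrite E1 E2 E3 E5 E4 (tder_id MP TX).
move: (tder M G P X) (tder M f P X) (G P) (f P) => G' f' G0 g0.
qdistr; rewrite ?(PP, qmul_rule PP, PXP, qmul_rule PXP); qabel.
Qed.

Lemma DE_Eact X (S : V -> V) P : M P -> tspace M P (X P) ->
  (forall Q, M Q -> symT Q (S Q)) ->
  DE X (fun Q => Eact Q (S Q)) P = Eact P (P *q tder M S P (X P) *q P).
Proof.
move=> MP TX symS.
have E Q : M Q -> Sof Q (Eact Q (S Q)) = S Q.
  by move=> MQ; apply: Sof_Eact => //; exact: symS.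
by rewrite /DE (tder_eq TX E).
Qed.

Lemma DE_ext X s s' P : tspace M P (X P) -> (forall Q, M Q -> s Q = s' Q) ->
  DE X s P = DE X s' P.
Proof.
move=> TX E; have E' Q : M Q -> Sof Q (s Q) = Sof Q (s' Q) by move=> MQ; rewrite E.
by rewrite /DE (tder_eq TX E').
Qed.

Lemma lie_tspace X Y P : vfield M setT X -> vfield M setT Y -> M P ->
  tspace M P (lie M X Y P).
Proof.
move=> vX vY MP; have [_ _ /(_ X Y vX vY P MP) <-] := @Dg_levi_civita R n.
have TXY := vfield_tspace (Dg_vfield vX vY) MP.
have TYX := vfield_tspace (Dg_vfield vY vX) MP.
by have := tspace_lin (- 1) MP TYX TXY; rewrite scaleN1r addrC.
Qed.

Variable B : V.
Hypothesis hB0 : B^*q = B.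

(** The factor 1/2 makes the compression of B traceless, as Re tr Q = 2 on Gr. *)
Definition SB : V -> V := Hfield (fun=> B) (fun Q => 2^-1 * qre (Q *q B)).

(** An explicit formula for the covariant derivative of [SB] along Y, see [SB'E], in a form that can
    be differentiated again. *)
Definition SB' (Y : V -> V) : V -> V :=
  Hfield (fun Q => Y Q *q B + B *q Y Q) (fun Q => 2^-1 * qre (Y Q *q B)).

Let L (A : V) : R^o := 2^-1 * qre (A *q B).

Let lL : linear L.
Proof. by move=> a A A'; rewrite /L; qdistr; rewrite qreD qreZ mulrDr mulrCA. Qed.

Let cB : msmooth M setT (fun=> B). Proof. exact: msmooth_cst. Qed.

Lemma L_msmooth (f : V -> V) : msmooth M setT f -> msmooth M setT (fun Q => L (f Q)).
Proof. by move=> sf; apply: msmooth_linear => //; exact: findim_qmx. Qed.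

Lemma tder_L (f : V -> V) P X : M P -> tspace M P X -> msmooth M setT f ->
  tder M (fun Q => L (f Q)) P X = L (tder M f P X).
Proof. by move=> MP TX sf; apply: tder_of_linear => //; exact: findim_qmx. Qed.

Lemma SB_msmooth : msmooth M setT SB.
Proof. by apply: Hfield_msmooth => //; apply: L_msmooth; exact: msmooth_P. Qed.

Lemma SB_symT P : M P -> symT P (SB P).
Proof.
move=> MP; have [[hP PP] trP] := Gr_projector MP; rewrite /SB /Hfield; split.
- by rewrite qadjB qadjZ !qadjM hP hB0 qmulA.
- by qdistr; rewrite PP.
rewrite qreB qreZ trP -qmulA qre_mulC -qmulA PP (qre_mulC B).
by rewrite mulrAC mulVf ?mul1r ?subrr // pnatr_eq0.
Qed.

Lemma tder_SB P X : M P -> tspace M P X ->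
  P *q tder M SB P X *q P = P *q (X *q B + B *q X) *q P - L X *: P.
Proof.
move=> MP TX; have sP : msmooth M setT (id : V -> V) by exact: msmooth_P.
rewrite /SB (tder_Hfield MP TX cB (L_msmooth sP)) tder_cst // addr0.
have EL := tder_L MP TX sP; rewrite (tder_id MP TX) in EL.
by rewrite -EL.
Qed.

Section Curvature.
Variables (X Y : V -> V).
Hypotheses (vX : vfield M setT X) (vY : vfield M setT Y).

Lemma SB'_msmooth : msmooth M setT (SB' Y).
Proof.
have [sY _] := vY; apply: Hfield_msmooth; last exact: L_msmooth.
by apply: msmoothD; apply: msmooth_qmul.
Qed.

Lemma SB'E Q : M Q -> Q *q tder M SB Q (Y Q) *q Q = SB' Y Q.
Proof. by move=> MQ; rewrite tder_SB //; exact: vfield_tspace. Qed.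

Lemma SB'_symT Q : M Q -> symT Q (SB' Y Q).
Proof.
move=> MQ; rewrite -SB'E //; apply: dsym_symT => //;
  [exact: vfield_tspace|exact: SB_msmooth|exact: SB_symT].
Qed.

Lemma tder_SB' P : M P ->
  P *q tder M (SB' Y) P (X P) *q P =
  P *q (X P *q (Y P *q B + B *q Y P) + (Y P *q B + B *q Y P) *q X P
        + (tder M Y P (X P) *q B + B *q tder M Y P (X P))) *q P
  - L (tder M Y P (X P)) *: P.
Proof.
move=> MP; have TX := vfield_tspace vX MP; have [sY _] := vY.
have s1 := msmooth_qmul sY cB; have s2 := msmooth_qmul cB sY.
have E1 := tderD MP TX s1 s2.
have E2 := tder_qmul MP TX sY cB; have E3 := tder_qmul MP TX cB sY.
rewrite /SB' (tder_Hfield MP TX (msmoothD s1 s2) (L_msmooth sY)).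
rewrite E1 E2 E3 (tder_cst _ MP TX) qmul0r qmul0l addr0 add0r.
by have EL := tder_L MP TX sY; rewrite -EL.
Qed.

Lemma DE_SB P : M P -> DE X (DE Y (fun Q => Eact Q (SB Q))) P =
  Eact P (P *q tder M (SB' Y) P (X P) *q P).
Proof.
move=> MP; have TX := vfield_tspace vX MP.
rewrite (@DE_ext X _ (fun Q => Eact Q (SB' Y Q)) P TX); last first.
  move=> Q MQ; rewrite (DE_Eact MQ (vfield_tspace vY MQ)) ?SB'E //; exact: SB_symT.
by rewrite (DE_Eact MP TX) //; exact: SB'_symT.
Qed.

End Curvature.

(** Injectivity of [Eact], via its left inverse [Sof]: the vanishing of the curvature operator
    becomes an equation between matrices. *)
Lemma Eact_eq0 P A1 A2 A3 C1 C2 C3 : M P ->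
  symT P A1 -> symT P A2 -> symT P A3 -> A1 = C1 -> A2 = C2 -> A3 = C3 ->
  Eact P A1 - Eact P A2 - Eact P A3 = 0 -> C1 - C2 - C3 = 0.
Proof.
move=> MP y1 y2 y3 <- <- <- E.
have y : symT P ((- 1) *: A3 + ((- 1) *: A2 + A1)) by do 2 apply: symT_lin => //.
have -> : A1 - A2 - A3 = (- 1) *: A3 + ((- 1) *: A2 + A1) by qabel.
rewrite -(Sof_Eact n0 MP y) !Eact_linear !scaleN1r addrC [- _ + Eact P A1]addrC E.
by have := Sof_linear P (- 1) 0 0; rewrite scaler0 addr0 scaleN1r addNr.
Qed.

(** The derivatives of X and Y and the trace corrections cancel against the bracket term; the words
    X B Y and Y B X are symmetric in X, Y and cancel. Only the commutator of K with B is left. *)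
Lemma SB_curvature X Y P : vfield M setT X -> vfield M setT Y -> M P ->
  flat M (esec M EB setT) DE ->
  let K := X P *q Y P - Y P *q X P in P *q (K *q B - B *q K) *q P = 0.
Proof.
move=> vX vY MP fl K; pose s := fun Q => Eact Q (SB Q).
have Es : esec M EB setT s.
  by apply: sym_esec => [|Q MQ _]; [exact: SB_msmooth|exact: SB_symT].
have TX := vfield_tspace vX MP; have TY := vfield_tspace vY MP.
have Tl := lie_tspace vX vY MP.
have := fl X Y s vX vY Es P MP.
rewrite (DE_SB vX vY MP) (DE_SB vY vX MP) (DE_Eact MP Tl SB_symT).
have y1 := dsym_symT MP TX (SB'_msmooth vY) (SB'_symT vY).
have y2 := dsym_symT MP TY (SB'_msmooth vX) (SB'_symT vX).
have y3 := dsym_symT MP Tl SB_msmooth SB_symT.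
have T1 := tder_SB' vX vY MP.
have T2 := tder_SB' vY vX MP.
have T3 := tder_SB MP Tl.
move=> E; apply: etrans (Eact_eq0 MP y1 y2 y3 T1 T2 T3 E).
rewrite /lie /K.
set Y' := tder M Y P _; set X' := tder M X P _.
move: Y' X' (X P) (Y P) => Y' X' x y0.
rewrite (linD lL) (linN lL); move: (L Y') (L X') => l1 l2.
have -> : (x *q y0 - y0 *q x) *q B - B *q (x *q y0 - y0 *q x) =
    (x *q (y0 *q B + B *q y0) + (y0 *q B + B *q y0) *q x + (Y' *q B + B *q Y'))
    - (y0 *q (x *q B + B *q x) + (x *q B + B *q x) *q y0 + (X' *q B + B *q X'))
    - ((Y' - X') *q B + B *q (Y' - X')) by qdistr; qabel.
have E' (D1 D2 D3 : V) : P *q (D1 - D2 - D3) *q P = P *q D1 *q P - l1 *: P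
    - (P *q D2 *q P - l2 *: P) - (P *q D3 *q P - (l1 - l2) *: P) by qdistr; qabel.
exact: E'.
Qed.

End NonFlat.

(** * Non-flatness and the theorem *)

Section Final.
Context {R : realType} {n : nat}.
Local Notation N := n.+2.
Local Notation V := (qmx R n.+2 n.+2).
Local Notation M := (Gr R n).
Hypothesis n0 : (0 < n)%N.

Lemma Gr_nonempty : exists P : V, M P.
Proof.
have pr0 : projector (0 : V) by split; [exact: qadj0|exact: qmul0l].
have [w [ow _]] := orthonormal_complement (m := 0) (k := 2) pr0 (qre0 _) isT.
by exists (qplane w); exists w.
Qed.

(** The fields are chosen so that K = [X, Y] acts on W as diag (2 i, 0) in the basis w_0, w_1. It
    does not commute with the B that swaps this basis: the (0, 1) entry of their commutator is K_00
    - K_11 = 2 i. *)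
Lemma Gr_nonflat : ~ flat M (esec M EB setT) (@DE R n).
Proof.
move=> fl; have [P MP] := Gr_nonempty; have [w [wp ad]] := adapted_exists MP.
have [[hP PP] _] := Gr_projector MP; have [ow _ owp wwp] := ad.
pose v := wp (Ordinal n0); pose w0 := w 0; pose w1 := w 1.
have Pw a : P *q w a = w a by rewrite -(qcolsE w) qmulA (adapted_PW ad).
have Pv : P *q v = 0 by rewrite /v -(qcolsE wp) qmulA (adapted_PWp ad) qmul0l.
have vP : v^*q *q P = 0 by rewrite -hP -qadjM Pv qadj0.
have wP a : (w a)^*q *q P = (w a)^*q by rewrite -[in RHS]Pw qadjM hP.
have v1 : v^*q *q v = qone by rewrite [LHS]owp eqxx.
have w00 : w0^*q *q w0 = qone by rewrite [LHS]ow eqxx.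
have w11 : w1^*q *q w1 = qone by rewrite [LHS]ow eqxx.
have w01 : w0^*q *q w1 = 0 by rewrite [LHS]ow.
have w10 : w1^*q *q w0 = 0 by rewrite [LHS]ow.
have w0v : w0^*q *q v = 0 by exact: wwp.
have vw0 : v^*q *q w0 = 0 by rewrite -[LHS]qadjK qadjM qadjK w0v qadj0.
have vw1 : v^*q *q w1 = 0.
  by rewrite -[LHS]qadjK qadjM qadjK [_ *q _](wwp 1 (Ordinal n0)) qadj0.
(* X sends w_0 to v and Y sends w_0 to v i. Both vanish on w_1; on w_0 they differ by the unit i,
   which makes the commutator nonzero. *)
pose X := Xfield (v *q w0^*q); pose Y := Xfield (v *q qi *q w0^*q).
pose B := w0 *q w1^*q + w1 *q w0^*q.
have hB0 : B^*q = B by rewrite /B qadjD !qadjM !qadjK addrC.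
have /= := SB_curvature n0 hB0 (Xfield_vfield _ setT) (Xfield_vfield _ setT) MP fl
  : P *q ((X P *q Y P - Y P *q X P) *q B - B *q (X P *q Y P - Y P *q X P)) *q P = 0.
have QP : (qid N - P) *q v = v by rewrite qmulBl Pv subr0 qmul1l.
have vQ : v^*q *q (qid N - P) = v^*q by rewrite qmulBr vP subr0 qmul1r.
have XE : X P = v *q w0^*q + w0 *q v^*q.
  by rewrite /X /Xfield qadjM qadjK !qmulA QP Pw -!qmulA wP vQ.
have YE : Y P = v *q qi *q w0^*q + w0 *q qi^*q *q v^*q.
  by rewrite /Y /Xfield !qadjM qadjK !qmulA QP Pw -!qmulA wP vQ.
have qi' : qi^*q = - qi :> qmx R 1 1.
  by rewrite /qi /qadj /= !trmx0 !oppr0 trmx1; apply: qmx_eq; rewrite ?oppr0.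
have Bw1 : B *q w1 = w0 by rewrite /B qmulDl -!qmulA w11 w01 qmul0r addr0 qmul1r.
have w0B : w0^*q *q B = w1^*q.
  by rewrite /B qmulDr !qmulA w00 w01 qmul0l addr0 qmul1l.
move: (X P) (Y P) XE YE => x y XE YE.
have xw0 : x *q w0 = v by rewrite XE qmulDl -!qmulA w00 vw0 qmul0r addr0 qmul1r.
have yw0 : y *q w0 = v *q qi.
  by rewrite YE qmulDl -!qmulA w00 vw0 !qmul0r addr0 qmul1r.
have xw1 : x *q w1 = 0 by rewrite XE qmulDl -!qmulA w01 vw1 !qmul0r addr0.
have yw1 : y *q w1 = 0 by rewrite YE qmulDl -!qmulA w01 vw1 !qmul0r addr0.
have w0x : w0^*q *q x = v^*q by rewrite XE qmulDr !qmulA w00 w0v qmul0l add0r qmul1l.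
have w0y : w0^*q *q y = - (qi *q v^*q).
  by rewrite YE qmulDr !qmulA w00 w0v !qmul0l add0r qmul1l qi' qmulNl.
have FK (K : V) : w0^*q *q (P *q (K *q B - B *q K) *q P) *q w1 =
    w0^*q *q K *q w0 - w1^*q *q K *q w1.
  have Pw1 : P *q w1 = w1 by exact: Pw.
  have w0P : w0^*q *q P = w0^*q by exact: wP.
  rewrite !(qmulBr, qmulBl) !qmulA w0P w0B -!qmulA Pw1 Bw1.
  by [].
move=> /(congr1 (fun A => w0^*q *q A *q w1)); rewrite FK qmul0r qmul0l.
have -> : w0^*q *q (x *q y - y *q x) *q w0 - w1^*q *q (x *q y - y *q x) *q w1 =
    (w0^*q *q x) *q (y *q w0) - (w0^*q *q y) *q (x *q w0)
    - (w1^*q *q x *q (y *q w1) - w1^*q *q y *q (x *q w1)).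
  by rewrite !(qmulBr, qmulBl) !qmulA.
rewrite xw1 yw1 !qmul0r !subr0 xw0 yw0 w0x w0y qmulA v1 qmulNl -qmulA v1 qoneE.
rewrite qmul1l qmul1r opprK => E.
(* The entry is i + i; its i-component gives 1 + 1 = 0, a contradiction. *)
have := congr1 (fun A : qmx R 1 1 => A.1.1.2 0 0) E.
rewrite /qi /= !mxE /= => /eqP.
by rewrite -mulr2n mulrn_eq0 oner_eq0.
Qed.

End Final.

Unset Implicit Arguments.
Set Strict Implicit.

Theorem theorem12p4 (R : realType) (n : nat) (hn : (0 < n)%N) :
  let V := qmx R n.+2 n.+2 in
  let M : set V := Gr R n in
  let g : V -> V -> V -> R^o := gGr R n in
  exists (E : V -> set (V -> V)) (h : V -> (V -> V) -> (V -> V) -> R^o),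
    [/\ (* E is a rank 5 sub-bundle of End^+ *)
        subbundle M 5 E,
        forall P A, M P -> E P A -> endT M P A /\ selfadjT M g P A,
        (* local bases exist, and the Clifford system C_4 in any of them
           generates E *)
        forall P, M P -> exists (U : set V) w wp,
          [/\ open U, U P & adapted_local U w wp],
        forall (U : set V) w wp, open U -> adapted_local U w wp ->
          involutions_generate M g E h U
            (fun k P => sigma (w ^~ P) (wp ^~ P) P k) &
        exists (o : V -> set ('I_5 -> (V -> V)))
               (phi : V -> seq (R * seq (V -> V)) -> (V -> V)),
          [/\ even_clifford_structure M g E h o phi,
              nonflat_parallel M g E h phi,
              (* phi maps u /\ v to the composition u v *)
              forall P u v, M P -> E P u -> E P v ->
                h P u u = 1 -> h P v v = 1 -> h P u v = 0 ->
                phi P (wedge u v) = u \o v &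
              (* which acts diagonally on the n-tuples of pairs *)
              forall P w wp (a b : 'I_5 -> R), M P -> adapted P w wp ->
                let u := \sum_k a k *: sigma w wp P k in
                let v := \sum_k b k *: sigma w wp P k in
                h P u u = 1 -> h P v v = 1 -> h P u v = 0 ->
                forall X l, tspace M P X ->
                  coords w wp (phi P (wedge u v) X) l
                    = C4lin a (C4lin b (coords w wp X l))]].
Proof.
move=> V M g; exists EB, (@hB R n); split.
- exact: EB_subbundle.
- by move=> P A MP EA; split; [exact: EB_endT|exact: EB_selfadj].
- exact: local_frames.
- by move=> U w wp _; exact: sigma_generate.
exists (@orn R n), (@phi R n); split.
- exact: Gr_even_clifford.
- exists Dg, DE; split.
  + exact: Dg_levi_civita.
  + exact: DE_connection.
  + exact: DE_compatible.
  + exact: Gr_parallel.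
  + exact: Gr_nonflat.
- by move=> P u v MP Eu Ev _ _; exact: phi_wedge_orth.
- by move=> P w wp a b _ ad u v _ _ h0 X l; exact: coords_phi.
Qed.
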